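(* Let $p\ge 1$ be an integer and let $L$ be an invertible self-adjoint operator in a separable complex Hilbert space $\mathcal H$ with $\langle Lu,u\rangle\ge 0$ for all $u$ in the domain of $L$ and with $(L+I)^{-1}\in\mathcal B^p(\mathcal H)$. Assume that $L$ has discrete dimension spectrum, that the $\zeta$-function $\zeta(s;L)$ is regular at $s=0$, and that it has at most simple poles at $s=1,\ldots,p-1$. Then for all $z\in\mathbb C$ with $-z$ in the resolvent set of $L$, $$\det\nolimits_\zeta(L+z)=\exp\Bigl(\sum_{j=0}^{p-1}\frac{z^j}{j!}\cdot\frac{d^j}{dw^j}\log\det\nolimits_\zeta(L+w)\Big|_{w=0}\Bigr)\cdot\det\nolimits_p(I+z\cdot L^{-1}).$$
   Context: $\mathcal B^p(\mathcal H)$ is the Schatten class of order $p$. The spectrum of $L$ consists of eigenvalues $0<\lambda_1\le\lambda_2\le\dots$ of finite multiplicity; all sums and products over $\operatorname{spec}L$ are taken with multiplicity. Zeta function: $\zeta(s;L)=\sum_{\lambda\in\operatorname{spec}L\setminus\{0\}}\lambda^{-s}$, absolutely convergent for $\operatorname{Re}s>p$. $L$ has discrete dimension spectrum if $\zeta(s;L)$ extends to a meromorphic function on $\mathbb C$ such that on every finite vertical strip one has a uniform estimate $|\Gamma(s)\zeta(s;L)|=O(|s|^{-N})$ as $\operatorname{Im}(s)\to\infty$, for each $N\in\mathbb N$. For $-z$ in the resolvent set of $L$, $\zeta(s;L+z)=\sum_{\lambda\in\operatorname{spec}L}(\lambda+z)^{-s}$ for $\operatorname{Re}s$ large (complex powers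 defined with $\arg\in(-\pi,\pi]$, $\arg 1=0$), continued meromorphically in $s$; under the hypotheses it is regular at $s=0$, and $\det_\zeta(L+z):=\exp\bigl(-\partial_s\zeta(s;L+z)|_{s=0}\bigr)$. For $w$ near $0$, $\log\det_\zeta(L+w)$ denotes $-\partial_s\zeta(s;L+w)|_{s=0}$, which is holomorphic in $w$ near $0$. Regularized Fredholm determinant: $$\det\nolimits_p(I+z\cdot L^{-1}):=\prod_{q=1}^\infty\Bigl[(1+z\lambda_q^{-1})\exp\Bigl(\sum_{k=1}^{p-1}(-1)^k\frac{z^k\lambda_q^{-k}}{k}\Bigr)\Bigr].$$ *)

(* Defs.v *)
From HB Require Import structures.
From mathcomp Require Import all_boot all_order all_algebra.
From mathcomp Require Import complex.
From mathcomp Require Import all_classical all_reals all_analysis.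

Set Implicit Arguments.
Unset Strict Implicit.
Unset Printing Implicit Defensive.

Import Order.TTheory GRing.Theory Num.Theory.
Import numFieldNormedType.Exports.

Local Open Scope classical_set_scope.
Local Open Scope ring_scope.
Local Open Scope complex_scope.

Local Notation Re := complex.Re.
Local Notation Im := complex.Im.

(* The topology of R[i] is that of the normed module R[i]^o over R[i].  The
   norm `|z| has its values in R[i], and x <= y in R[i] means that y - x is
   a nonnegative real. *)
Notation cplx R := (R[i]^o) (only parsing).

Section ComplexFunctions.
Variable R : realType.
Local Notation C := (cplx R).

Definition cexp (z : C) : C :=
  (expR (Re z))%:C * (cos (Im z) +i* sin (Im z)).

Definition cabs (z : C) : R := Num.sqrt (Re z ^+ 2 + Im z ^+ 2).

(* For z != 0, carg z lies in ]- pi, pi], with carg 1 = 0. *)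
Definition carg (z : C) : R :=
  if 0 <= Im z then acos (Re z / cabs z) else - acos (Re z / cabs z).

Definition clog (z : C) : C := ln (cabs z) +i* carg z.

Definition cpow (z s : C) : C := cexp (s * clog z).

(* The integral of t^(s-1) e^(-t) over t > 0, by real and imaginary parts. *)
Definition gamma_integral (s : C) : C :=
  (\int[@lebesgue_measure R]_(t in `]0, +oo[)
      (t `^ (Re s - 1) * expR (- t) * cos (Im s * ln t)))
  +i*
  (\int[@lebesgue_measure R]_(t in `]0, +oo[)
      (t `^ (Re s - 1) * expR (- t) * sin (Im s * ln t))).

(* Continuation by Gamma(s) = Gamma(s + n) / (s (s + 1) ... (s + n - 1)), for
   an n such that 0 < Re s + n; the value at a pole is 0. *)
Definition cgamma (s : C) : C :=
  let n := (Num.truncn (- Re s)).+1 in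
  gamma_integral (s + n%:R) / \prod_(k < n) (s + k%:R).

Definition analytic_at (f : C -> C) (a : C) : Prop :=
  exists c : nat -> C, \forall z \near a,
    (series (fun n => c n * (z - a) ^+ n) : nat -> C) @ \oo --> f z.

Definition pole_at (f : C -> C) (a : C) (n : nat) : Prop :=
  (0 < n)%N /\
  exists g : C -> C, [/\ analytic_at g a, g a != 0 &
    \forall z \near a^', f z = g z / (z - a) ^+ n].

(* Meromorphic on the whole plane; the value of f at a pole is irrelevant. *)
Definition meromorphic (f : C -> C) : Prop :=
  forall a, analytic_at f a \/ exists n, pole_at f a n.

End ComplexFunctions.

Section Operators.
Variables (R : realType) (H : completeNormedModType R[i]).
Local Notation C := (cplx R).

Definition separable : Prop := exists2 A : set H, countable A & dense A.

(* The values of an operator outside its domain are irrelevant. *)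
Record operator := Operator {
  dom : set H;
  opfun :> H -> H;
  dom0 : dom 0;
  dom_lin : forall (a : R[i]) u v, dom u -> dom v -> dom (a *: u + v);
  opfun_lin : forall (a : R[i]) u v, dom u -> dom v ->
    opfun (a *: u + v) = a *: opfun u + opfun v }.

(* T is the bounded everywhere defined inverse of L - mu. *)
Definition is_resolvent (L : operator) (mu : C) (T : {linear H -> H}) : Prop :=
  [/\ continuous T,
      forall u, dom L (T u) /\ L (T u) - mu *: T u = u &
      forall u, dom L u -> T (L u - mu *: u) = u].

Definition resolvent_set (L : operator) : set C :=
  [set mu | exists T, is_resolvent L mu T].

Definition spectrum (L : operator) : set C := ~` resolvent_set L.

Definition eigenspace (L : operator) (mu : C) : set H :=
  [set u | dom L u /\ L u = mu *: u].

Definition has_dim (V : set H) (n : nat) : Prop :=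
  exists b : 'I_n -> H,
    V = [set u | exists c : 'I_n -> R[i], u = \sum_i c i *: b i] /\
    forall c : 'I_n -> R[i], \sum_i c i *: b i = 0 -> forall i, c i = 0.

(* The spectrum of L is the nondecreasing family of reals (lam q) for q in J,
   where J is nat, or [0, N[ if the spectrum is finite, and every eigenvalue
   is repeated according to its finite multiplicity. *)
Definition spec_enum (L : operator) (J : set nat) (lam : nat -> R) : Prop :=
  [/\ forall q r, (q <= r)%N -> J r -> J q,
      forall q r, (q <= r)%N -> J r -> lam q <= lam r,
      spectrum L = [set (lam q)%:C | q in J] &
      forall mu : R, exists2 n, has_dim (eigenspace L mu%:C) n &
        ([set q | J q /\ lam q = mu] #= `I_n)%card].

Definition spec_family (L : operator) : set nat * (nat -> R) :=
  xget (set0, fun=> 0) [set x | spec_enum L x.1 x.2].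

(* Sums and products over spec L, with multiplicity, of F lam for the lam
   satisfying P. *)
Definition spec_sum (L : operator) (P : R -> bool) (F : R -> C) : C :=
  let: (J, lam) := spec_family L in
  limn (fun n => \sum_(q < n | ((q : nat) \in J) && P (lam q)) F (lam q) : C).

Definition spec_prod (L : operator) (F : R -> C) : C :=
  let: (J, lam) := spec_family L in
  limn (fun n => \prod_(q < n | (q : nat) \in J) F (lam q) : C).

Section InnerProduct.
Variable dot : {dot H for Num.conj}.

Definition self_adjoint (L : operator) : Prop :=
  dense (dom L) /\
  forall v w, (dom L v /\ L v = w) <->
    (forall u, dom L u -> dot (L u) v = dot u w).

Definition nonnegative (L : operator) : Prop :=
  forall u, dom L u -> 0 <= dot (L u) u.

(* T u = \sum_n s_n <u, e_n> f_n is a singular value decomposition, where the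
   singular values s_n are p-summable.  Vectors e_n and f_n such that s_n = 0
   are unconstrained, so that finite rank is allowed. *)
Definition schatten (p : nat) (T : H -> H) : Prop :=
  exists (s : nat -> R) (e f : nat -> H),
  [/\ forall n, 0 <= s n,
      forall m n, s m != 0 -> s n != 0 ->
        dot (e m) (e n) = (m == n)%:R /\ dot (f m) (f n) = (m == n)%:R,
      cvgn (series (fun n => s n ^+ p)) &
      forall u, series (fun n => ((s n)%:C * dot u (e n)) *: f n) @ \oo --> T u].

End InnerProduct.

Definition zeta_sum (L : operator) (z s : C) : C :=
  spec_sum L (fun lam => lam%:C + z != 0) (fun lam => cpow (lam%:C + z) (- s)).

Definition zeta_continuation (L : operator) (z : C) (F : C -> C) : Prop :=
  meromorphic F /\
  exists sigma : R, forall s, sigma < Re s -> F s = zeta_sum L z s.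

(* The function s |-> zeta(s; L + z). *)
Definition zeta (L : operator) (z : C) : C -> C :=
  xget (fun=> 0) [set F | zeta_continuation L z F].

Definition discrete_dimension_spectrum (L : operator) : Prop :=
  zeta_continuation L 0 (zeta L 0) /\
  forall (a b : R) (N : nat), exists K T : R, forall s : C,
    a <= Re s <= b -> T <= Im s ->
    `|cgamma s * zeta L 0 s| <= K%:C * `|s| ^- N.

Definition logdet_zeta (L : operator) (z : C) : C := - derive1 (zeta L z) 0.

Definition det_zeta (L : operator) (z : C) : C := cexp (logdet_zeta L z).

(* The regularized Fredholm determinant of I + z L^-1. *)
Definition det_reg (p : nat) (L : operator) (z : C) : C :=
  spec_prod L (fun lam => (1 + z / lam%:C) *
    cexp (\sum_(1 <= k < p) (-1) ^+ k * (z ^+ k * lam%:C ^- k / k%:R))).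

End Operators.

(* Main.v *)
(* For |z| < lambda the binomial series expands (lambda + z)^-s in terms of the
   lambda^(-s-k).  Subtracting its first K terms and summing over the spectrum
   writes zeta(s; L + z) as sum_(k < K) binom(-s, k) z^k zeta(s + k; L) plus a
   series that is holomorphic for Re s > p - K, because
   sum lambda^-p converges; letting K grow continues zeta(s; L + z) to the
   whole plane.
   With K = p + 1 the derivative at s = 0 can be read off: binom(-s, k) vanishes
   at 0 for k >= 1, so the simple poles at 1, ..., p - 1 only contribute
   constants A_k, and
     log det_zeta(L + z) = sum_(k < p) A_k z^k
       + sum_lambda (log(lambda + z) - log lambda
                     + sum_(1 <= k < p) (-1)^k z^k lambda^-k / k).
   Near z = 0 the last sum is a power series without terms of degree < p, so
   the A_k are the Taylor coefficients of log det_zeta, while its exponential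
   is det_p(I + z L^-1).  Convergence of sum lambda^-p follows from the singular
   value decomposition of (L + I)^-1 by Bessel's and Jensen's inequalities. *)

Require Import Defs.
From HB Require Import structures.
From mathcomp Require Import all_boot all_order all_algebra.
From mathcomp Require Import complex.
From mathcomp Require Import all_classical all_reals all_analysis.
From mathcomp Require Import ring lra.

Set Implicit Arguments.
Unset Strict Implicit.
Unset Printing Implicit Defensive.

Import Order.TTheory GRing.Theory Num.Theory.
Import numFieldNormedType.Exports.

Local Open Scope classical_set_scope.
Local Open Scope ring_scope.
Local Open Scope complex_scope.

Local Notation Re := complex.Re.
Local Notation Im := complex.Im.

(** Analyticity means local convergence of a power series. In place of Cauchy's integral,
    [power_series] carries the weighted norm sum_k |c_k| r^k: it survives infinite sums over the
    spectrum and lets coefficients, hence derivatives at 0, be summed termwise. Two obstacles shape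
    the rest. The value of a meromorphic function at a pole is arbitrary and [zeta] is a choice
    among continuations, so functions are compared on punctured discs, and continuations are
    identified along the real axis. Moreover K = p + 1, taken so that the remainder is analytic on
    Re s > -1, a full neighbourhood of 0, brings in the term k = p and with it the behaviour of zeta
    near p, about which nothing is assumed. Its value there turns out to be sum lambda^-p, and this
    contribution cancels the surplus term k = p in the derivative of the remainder. The crude
    estimate |binom(-s, k)| <= D 2^k on a disc replaces the condition |z| < lambda by |z| < lambda /
    8; the finitely many eigenvalues that violate it contribute entire functions of s. *)

(** * The real-valued modulus and convergence in the complex plane *)

Section ComplexModulus.
Variable R : realType.
Local Notation C := (cplx R).
Implicit Types (x y z l : C) (u v : nat -> C).

Lemma cabsE z : `|z| = (cabs z)%:C.
Proof. exact: normc_def. Qed.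

Lemma cabs_ge0 z : 0 <= cabs z.
Proof. exact: sqrtr_ge0. Qed.

Lemma cabs_lt x (r : R) : (`|x| < r%:C) = (cabs x < r).
Proof. by rewrite cabsE ltcR. Qed.

Lemma ler_cabsD x y : cabs (x + y) <= cabs x + cabs y.
Proof. by rewrite -lecR -cabsE rmorphD /= -!cabsE; exact: ler_normD. Qed.

Lemma cabsM x y : cabs (x * y) = cabs x * cabs y.
Proof. by apply: complexI; rewrite rmorphM /= -!cabsE; exact: normrM. Qed.

Lemma cabsN x : cabs (- x) = cabs x.
Proof. by apply: complexI; rewrite -!cabsE normrN. Qed.

Lemma cabs_distC x y : cabs (x - y) = cabs (y - x).
Proof. by rewrite -cabsN opprB. Qed.

Lemma cabs0 : cabs (0 : C) = 0.
Proof. by apply: complexI; rewrite -!cabsE normr0. Qed.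

Lemma cabs1 : cabs (1 : C) = 1.
Proof. by apply: complexI; rewrite -!cabsE normr1. Qed.

Lemma cabsX x n : cabs (x ^+ n) = cabs x ^+ n.
Proof. by apply: complexI; rewrite rmorphXn /= -!cabsE normrX. Qed.

Lemma cabs_eq0 x : (cabs x == 0) = (x == 0).
Proof. by rewrite -(inj_eq (@complexI _)) -cabsE /= normr_eq0. Qed.

Lemma cabs_gt0 x : (0 < cabs x) = (x != 0).
Proof. by rewrite lt_neqAle cabs_ge0 andbT eq_sym cabs_eq0. Qed.

Lemma cabsV x : cabs (x^-1) = (cabs x)^-1.
Proof. by apply: complexI; rewrite fmorphV /= -!cabsE normfV. Qed.

Lemma cabs_real (r : R) : cabs (r%:C : C) = `|r|.
Proof. by rewrite /cabs /= expr0n /= addr0 sqrtr_sqr. Qed.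

Lemma cabs_nat n : cabs (n%:R : C) = n%:R.
Proof. by rewrite -[n%:R](rmorph_nat (real_complex R)) cabs_real normr_nat. Qed.

Lemma cabs_sum (I : Type) (s : seq I) (P : pred I) (F : I -> C) :
  cabs (\sum_(i <- s | P i) F i) <= \sum_(i <- s | P i) cabs (F i).
Proof.
elim/big_rec2: _ => [|i y1 y2 _ h]; first by rewrite cabs0.
by apply: le_trans (ler_cabsD _ _) _; rewrite lerD2l.
Qed.

Lemma ler_Re_cabs z : `|Re z| <= cabs z.
Proof. by rewrite -lecR -cabsE; exact: normc_ge_Re. Qed.

Lemma ler_Im_cabs z : `|Im z| <= cabs z.
Proof. by rewrite /cabs -sqrtr_sqr ler_sqrt ?addr_ge0 ?sqr_ge0// lerDr sqr_ge0. Qed.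

Lemma cabs_le_ReIm z : cabs z <= `|Re z| + `|Im z|.
Proof.
case: z => a b; rewrite /cabs /=.
rewrite -(ger0_norm (addr_ge0 (normr_ge0 a) (normr_ge0 b))) -sqrtr_sqr.
rewrite ler_sqrt ?sqr_ge0// sqrrD !real_normK ?num_real//.
have := mulr_ge0 (normr_ge0 a) (normr_ge0 b); lra.
Qed.

Lemma Re_add x y : Re (x + y) = Re x + Re y. Proof. by case: x; case: y. Qed.
Lemma Im_add x y : Im (x + y) = Im x + Im y. Proof. by case: x; case: y. Qed.
Lemma Re_opp x : Re (- x) = - Re x. Proof. by case: x. Qed.
Lemma Im_opp x : Im (- x) = - Im x. Proof. by case: x. Qed.
Lemma Re_mul x y : Re (x * y) = Re x * Re y - Im x * Im y.
Proof. by case: x; case: y. Qed.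
Lemma Im_mul x y : Im (x * y) = Re x * Im y + Im x * Re y.
Proof. by case: x => a b; case: y => c d /=; rewrite [in b * c]mulrC addrC. Qed.
Lemma Re_sum (I : Type) (s : seq I) (P : pred I) (F : I -> C) :
  Re (\sum_(i <- s | P i) F i) = \sum_(i <- s | P i) Re (F i).
Proof. by elim/big_rec2: _ => // i y1 y2 _ <-; rewrite Re_add. Qed.
Lemma Im_sum (I : Type) (s : seq I) (P : pred I) (F : I -> C) :
  Im (\sum_(i <- s | P i) F i) = \sum_(i <- s | P i) Im (F i).
Proof. by elim/big_rec2: _ => // i y1 y2 _ <-; rewrite Im_add. Qed.

(** A positive element of [R[i]] has zero imaginary part, so the complex-valued radii of the normed
    module reduce to real ones. *)
Lemma cvg_cabs (T : Type) (F : set_system T) (FF : Filter F) (f : T -> C) l :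
  f @ F --> l <-> (forall e : R, 0 < e -> \forall x \near F, cabs (f x - l) < e).
Proof.
split=> [/cvgrPdistC_lt h e e0|h].
  have := h e%:C; rewrite ltcR => /(_ e0); apply: filterS => x.
  by rewrite cabs_lt.
apply/cvgrPdistC_lt => -[e e'] /=; rewrite ltcE /= => /andP[/eqP ->] /h.
by apply: filterS => x; rewrite -cabs_lt.
Qed.

Lemma nbhs_cabs (a : C) (P : set C) :
  (\forall z \near a, P z) <->
  exists2 r : R, 0 < r & forall z, cabs (z - a) < r -> P z.
Proof.
split=> [/nbhs_ballP[[r r'] /=]|[r r0 h]].
  rewrite ltcE /= => /andP[/eqP-> r0] h; exists r => // z zr; apply: h.
  by rewrite /ball /= distrC cabs_lt.
apply/nbhs_ballP; exists r%:C => /=; first by rewrite ltcR.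
by move=> z; rewrite /ball /= distrC cabs_lt => /h.
Qed.

Lemma dnbhs_cabs (a : C) (P : set C) :
  (\forall z \near a^', P z) <->
  exists2 r : R, 0 < r & forall z, z != a -> cabs (z - a) < r -> P z.
Proof.
split=> [/nbhs_cabs[r r0 h]|[r r0 h]].
  by exists r => // z za zr; exact: h.
by apply/nbhs_cabs; exists r => // z zr za; exact: h.
Qed.

Lemma cvg_cabs0 u l : u @ \oo --> l <-> (fun n => cabs (u n - l)) @ \oo --> (0 : R).
Proof.
rewrite cvg_cabs; split=> [h|/cvgrPdist_lt h e /h].
  apply/cvgrPdist_lt => e /h; apply: filterS => n.
  by rewrite sub0r normrN ger0_norm ?cabs_ge0.
by apply: filterS => n; rewrite sub0r normrN ger0_norm ?cabs_ge0.
Qed.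

Lemma cvg_ReIm u (a b : R) :
  (fun n => Re (u n)) @ \oo --> a -> (fun n => Im (u n)) @ \oo --> b -> u @ \oo --> (a +i* b : C).
Proof.
move=> ha hb; apply/cvg_cabs0.
have h : (fun n => `|Re (u n) - a| + `|Im (u n) - b|) @ \oo --> (0 : R).
  have := cvgD (cvg_norm (cvgB ha (cvg_cst a))) (cvg_norm (cvgB hb (cvg_cst b))).
  by rewrite !subrr normr0 addr0 => hh; exact: hh.
apply: (squeeze_cvgr _ (cvg_cst 0) h).
apply: nearW => n; rewrite cabs_ge0 /=.
by apply: le_trans (cabs_le_ReIm _) _; rewrite Re_add Im_add Re_opp Im_opp.
Qed.

Lemma cvg_cabs_norm u l : u @ \oo --> l -> (fun n => cabs (u n)) @ \oo --> cabs l.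
Proof.
move/cvg_cabs0 => h; apply/cvgrPdistC_lt => e e0.
move/cvgrPdistC_lt: h => /(_ e e0); apply: filterS => n; rewrite subr0 /=.
apply: le_lt_trans; rewrite [leRHS]ger0_norm ?cabs_ge0// ler_norml lerBlDr.
have := ler_cabsD (u n - l) l; have := ler_cabsD (l - u n) (u n).
rewrite !subrK cabs_distC; lra.
Qed.

Lemma cabs_lim_le u l (M : R) : u @ \oo --> l -> (forall n, cabs (u n) <= M) -> cabs l <= M.
Proof.
move=> /cvg_cabs_norm h hM; rewrite -(cvg_lim _ h)//.
by apply: limr_le; [apply: cvgP h|exact: nearW].
Qed.

Lemma abs_cvg_real (u : nat -> R) (M : R) :
  (forall n, \sum_(k < n) `|u k| <= M) -> cvgn (series u).
Proof.
move=> h; apply: normed_cvg; apply: nondecreasing_is_cvgn.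
  by apply/nondecreasing_seqP => n; rewrite [leRHS]seriesSr lerDl normr_ge0.
by exists M => _ [n _ <-]; have := h n; rewrite -(big_mkord xpredT (fun k => `|u k|)).
Qed.

(** Real and imaginary parts are dominated by the modulus, so both real series converge absolutely;
    the bound passes from the partial sums to the limit. *)
Lemma abs_cvg u (M : R) : (forall n, \sum_(k < n) cabs (u k) <= M) ->
  exists2 l : C, series u @ \oo --> l & cabs l <= M.
Proof.
move=> h.
have hR : cvgn (series (fun k => Re (u k))).
  apply: (@abs_cvg_real _ M) => n; apply: le_trans (h n).
  by apply: ler_sum => k _; exact: ler_Re_cabs.
have hI : cvgn (series (fun k => Im (u k))).
  apply: (@abs_cvg_real _ M) => n; apply: le_trans (h n).
  by apply: ler_sum => k _; exact: ler_Im_cabs.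
have hu : series u @ \oo -->
    (limn (series (fun k => Re (u k))) +i* limn (series (fun k => Im (u k))) : C).
  apply: cvg_ReIm.
    rewrite (_ : (fun n => Re _) = series (fun k => Re (u k))) //.
    by apply/funext => n; rewrite /series /= Re_sum.
  rewrite (_ : (fun n => Im _) = series (fun k => Im (u k))) //.
  by apply/funext => n; rewrite /series /= Im_sum.
exists (limn (series (fun k => Re (u k))) +i* limn (series (fun k => Im (u k)))) => //.
apply: cabs_lim_le hu _ => n; rewrite /series /= big_mkord.
exact: le_trans (cabs_sum _ _ _) (h n).
Qed.

End ComplexModulus.

(** * Dominated series and power series *)

Section DominatedSeries.
Variable R : realType.
Local Notation C := (cplx R).

Definition sum_bounded (u : nat -> R) (M : R) := forall n, \sum_(k < n) u k <= M.

Lemma cvg_sum (n : nat) (a : nat -> nat -> C) (l : nat -> C) :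
  (forall i, (fun k => a k i) @ \oo --> l i) ->
  (fun k => \sum_(i < n) a k i) @ \oo --> \sum_(i < n) l i.
Proof.
move=> h; elim: n => [|n IH].
  by rewrite big_ord0; under eq_fun do rewrite big_ord0; exact: cvg_cst.
rewrite big_ord_recr /=; under eq_fun do rewrite big_ord_recr /=.
exact: (cvgD IH (h n)).
Qed.

Lemma seriesE (V : zmodType) (u : nat -> V) n : series u n = \sum_(k < n) u k.
Proof. by rewrite /series /= big_mkord. Qed.

Lemma cvg_seq_unique (u : nat -> C) (l l' : C) :
  u @ \oo --> l -> u @ \oo --> l' -> l = l'.
Proof. by move=> h h'; rewrite -(cvg_lim _ h) // (cvg_lim _ h'). Qed.

Lemma cvg_seq_eq (u v : nat -> C) (l : C) : u =1 v -> u @ \oo --> l -> v @ \oo --> l.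
Proof. by move=> /funext ->; apply. Qed.

Lemma cvg_shift N (u : nat -> C) (l : C) :
  (fun n => u (n + N)%N) @ \oo --> l <-> u @ \oo --> l.
Proof. by rewrite -[in X in _ <-> X](cvg_shiftn N). Qed.

Lemma sum_shift (V : zmodType) (u : nat -> V) N n :
  \sum_(N <= k < n + N) u k = \sum_(k < n) u (N + k)%N.
Proof.
rewrite -[X in \sum_(X <= _ < _) _]add0n big_addn addnK big_mkord.
by apply: eq_bigr => i _; rewrite addnC.
Qed.

Lemma sum_bounded_tail (u : nat -> R) (M e : R) : (forall k, 0 <= u k) ->
  sum_bounded u M -> 0 < e -> exists N, sum_bounded (fun k => u (N + k)%N) e.
Proof.
move=> u0 hM e0.
have nd : nondecreasing_seq (series u).
  by apply/nondecreasing_seqP => n; rewrite [leRHS]seriesSr lerDl.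
have cv : cvgn (series u).
  apply: nondecreasing_is_cvgn => //.
  by exists M => _ [n _ <-]; have := hM n; rewrite -(big_mkord xpredT).
have /cvgrPdist_lt /(_ e e0) [N _ /(_ N (leqnn N)) /= hN] := cv.
exists N => n; have := nondecreasing_cvgn_le nd cv (n + N)%N.
have := nondecreasing_cvgn_le nd cv N.
move: hN; rewrite series_addn.
rewrite sum_shift.
move=> h1 h2; rewrite ger0_norm ?subr_ge0 // in h1; lra.
Qed.

Lemma cabs_series_tail (u : nat -> C) (l : C) N (e : R) :
  series u @ \oo --> l -> sum_bounded (fun k => cabs (u (N + k)%N)) e ->
  cabs (l - \sum_(k < N) u k) <= e.
Proof.
move=> ul hN.
have h : (fun n => series u (n + N)%N - \sum_(k < N) u k) @ \oo -->
    l - \sum_(k < N) u k.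
  by apply: cvgB (cvg_cst _); apply/cvg_shift.
apply: cabs_lim_le h _ => n; rewrite series_addn.
rewrite {1}/series /= big_mkord addrC addKr.
rewrite sum_shift; exact: le_trans (cabs_sum _ _ _) (hN n).
Qed.

(* Tannery's theorem *)
Lemma dominated_series_cvg (a : nat -> nat -> C) (l S : nat -> C) (S0 : C)
    (M : nat -> R) (B : R) :
  (forall k n, cabs (a k n) <= M n) -> sum_bounded M B ->
  (forall n, (fun k => a k n) @ \oo --> l n) ->
  (forall k, series (a k) @ \oo --> S k) -> series l @ \oo --> S0 ->
  S @ \oo --> S0.
Proof.
move=> aM MB al aS lS; apply/cvg_cabs => e e0.
have M0 n : 0 <= M n by apply: le_trans (aM 0 n); exact: cabs_ge0.
have e4 : 0 < e / 4 by rewrite divr_gt0.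
(* Three errors of size e / 4: the two tails beyond N, small uniformly in k by domination, and a
   finite sum that converges term by term. *)
have [N hN] := sum_bounded_tail M0 MB e4.
have lM n : cabs (l n) <= M n by exact: cabs_lim_le (al n) _.
have h1 : cabs (S0 - \sum_(k < N) l k) <= e / 4.
  apply: cabs_series_tail lS _ => n; apply: le_trans (hN n).
  by apply: ler_sum => i _.
have /cvg_cabs /(_ _ e4) := @cvg_sum N a l al.
apply: filterS => k h2.
have h3 : cabs (S k - \sum_(i < N) a k i) <= e / 4.
  apply: cabs_series_tail (aS k) _ => n; apply: le_trans (hN n).
  by apply: ler_sum => i _.
rewrite cabs_distC in h1.
have -> : S k - S0 = (S k - \sum_(i < N) a k i) +
    ((\sum_(i < N) a k i - \sum_(i < N) l i) + (\sum_(i < N) l i - S0)) by ring.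
have := ler_cabsD (S k - \sum_(i < N) a k i)
    ((\sum_(i < N) a k i - \sum_(i < N) l i) + (\sum_(i < N) l i - S0)).
have := ler_cabsD (\sum_(i < N) a k i - \sum_(i < N) l i) (\sum_(i < N) l i - S0).
lra.
Qed.

(** Fubini's theorem for a double series whose rows have summable norms. It yields both the Cauchy
    product of exponentials and the sums of power series below. *)
Lemma series_exchange (a : nat -> nat -> C) (A b : nat -> C) (M : nat -> R) (B : R) :
  (forall q, sum_bounded (fun i => cabs (a q i)) (M q)) -> sum_bounded M B ->
  (forall q, series (a q) @ \oo --> A q) ->
  (forall n, series (fun q => a q n) @ \oo --> b n) ->
  exists S : C, [/\ series A @ \oo --> S, series b @ \oo --> S & cabs S <= B].
Proof.
move=> aM MB aA ab.
have AM q : cabs (A q) <= M q.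
  apply: cabs_lim_le (aA q) _ => n; rewrite /series /= big_mkord.
  exact: le_trans (cabs_sum _ _ _) (aM q n).
have [|S AS SB] := @abs_cvg _ A B.
  by move=> n; apply: le_trans (MB n); exact: ler_sum.
exists S; split => //.
(* Tannery's theorem for the rows truncated at N: their sum over q is the N-th partial sum of b. *)
apply: (@dominated_series_cvg (fun N q => \sum_(n < N) a q n) A (series b) S M B _ MB _ _ AS).
- by move=> N q; exact: le_trans (cabs_sum _ _ _) (aM q N).
- by move=> q; have := aA q; rewrite (funext (seriesE (a q))).
- move=> N; have := @cvg_sum N (fun Q n => series (fun q => a q n) Q) b ab.
  rewrite seriesE [X in X @ _ --> _ -> _](_ : _ =
    series (fun q => \sum_(n < N) a q n)); first by apply.
  apply/funext => Q; rewrite [RHS]seriesE [RHS]exchange_big.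
  by apply: eq_bigr => i _; exact: seriesE.
Qed.

End DominatedSeries.

(** * Power series with a bounded weighted norm *)

Section PowerSeries.
Variable R : realType.
Local Notation C := (cplx R).
Implicit Types (f g : C -> C) (a b s : C) (r M : R) (c d : nat -> C).

(** M bounds the weighted l1 norm of the coefficients, which dominates the supremum on the closed
    disc and, unlike the supremum, controls each coefficient directly. *)
Definition power_series f a r M c :=
  [/\ 0 < r, sum_bounded (fun k => cabs (c k) * r ^+ k) M &
  forall s, cabs (s - a) <= r -> series (fun n => c n * (s - a) ^+ n) @ \oo --> f s].

Lemma power_series_eq f g a r M c :
  (forall s, cabs (s - a) <= r -> f s = g s) ->
  power_series f a r M c -> power_series g a r M c.
Proof. by move=> fg [r0 cM h]; split=> [||s sr]; [exact: r0|exact: cM|rewrite -fg //; exact: h]. Qed.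

Lemma power_series_bound f a r M c : power_series f a r M c -> 0 <= M.
Proof. by case=> _ /(_ 0) + _; rewrite big_ord0. Qed.

Lemma power_series_term f a r M c k :
  power_series f a r M c -> cabs (c k) * r ^+ k <= M.
Proof.
case=> r0 /(_ k.+1) + _; rewrite big_ord_recr /=; apply: le_trans.
rewrite lerDr; apply: sumr_ge0 => i _.
by rewrite mulr_ge0 ?cabs_ge0 ?exprn_ge0 // ltW.
Qed.

Lemma power_series_shrink f a r r' M c : 0 < r' -> r' <= r ->
  power_series f a r M c -> power_series f a r' M c.
Proof.
move=> r'0 r'r [r0 cM h]; split=> [//|n|s sr]; last exact/h/(le_trans sr).
apply: le_trans (cM n); apply: ler_sum => i _.
by rewrite ler_wpM2l ?cabs_ge0 // lerXn2r // nnegrE ltW.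
Qed.

Lemma power_series_weaken f a r M M' c : M <= M' ->
  power_series f a r M c -> power_series f a r M' c.
Proof. by move=> MM' [r0 cM h]; split=> [|n|]; [exact: r0|exact: le_trans (cM n) _|exact: h]. Qed.

Lemma cvg_series_eq0 (u : nat -> C) : (forall n, u n.+1 = 0) -> series u @ \oo --> u 0.
Proof.
move=> h; apply/(cvg_shift 1); rewrite [X in X @ _](_ : _ = cst (u 0)).
  exact: cvg_cst.
apply/funext => n; rewrite /series /= addn1 big_nat_recl //= big1 ?addr0 //.
Qed.

Lemma power_series_center f a r M c : power_series f a r M c -> f a = c 0.
Proof.
case=> r0 _ /(_ a); rewrite subrr cabs0 => /(_ (ltW r0)) h.
apply: (cvg_seq_unique h).
have := @cvg_series_eq0 (fun n => c n * 0 ^+ n).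
by rewrite /= expr0 mulr1; apply=> n; rewrite expr0n mulr0.
Qed.

Lemma power_series_cst (x : C) a r : 0 < r ->
  power_series (fun=> x) a r (cabs x) (fun n => if n is 0 then x else 0).
Proof.
move=> r0; split=> [//|n|s _].
  case: n => [|n]; first by rewrite big_ord0 cabs_ge0.
  rewrite big_ord_recl /= mulr1 big1 ?addr0 // => i _; rewrite cabs0 mul0r //.
have := @cvg_series_eq0 (fun n => (if n is 0 then x else 0) * (s - a) ^+ n).
by rewrite /= expr0 mulr1; apply => n; rewrite mul0r.
Qed.

Lemma power_seriesD f g a r M M' c d :
  power_series f a r M c -> power_series g a r M' d ->
  power_series (fun s => f s + g s) a r (M + M') (fun n => c n + d n).
Proof.
move=> [r0 cM h] [_ dM h']; split=> [//|n|s sr].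
  apply: le_trans (lerD (cM n) (dM n)); rewrite -big_split /=.
  apply: ler_sum => i _; rewrite -mulrDl ler_wpM2r ?ler_cabsD //.
  by rewrite exprn_ge0 // ltW.
apply: (cvg_seq_eq _ (cvgD (h s sr) (h' s sr))) => n.
by rewrite ?fctE /= !seriesE -big_split; apply: eq_bigr => i _; rewrite mulrDl.
Qed.

Lemma power_seriesZ (x : C) f a r M c :
  power_series f a r M c ->
  power_series (fun s => x * f s) a r (cabs x * M) (fun n => x * c n).
Proof.
move=> [r0 cM h]; split=> [//|n|s sr].
  apply: le_trans (ler_wpM2l (cabs_ge0 _) (cM n)); rewrite mulr_sumr.
  by apply: ler_sum => i _; rewrite cabsM mulrA.
apply: (cvg_seq_eq _ (cvgM (cvg_cst x) (h s sr))) => n.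
by rewrite ?fctE /= !seriesE mulr_sumr; apply: eq_bigr => i _; rewrite mulrA.
Qed.

(** Write s + b = (s - a) + (a + b): the first summand shifts the coefficients at the cost of a
    factor r in the norm, the second is a scalar. *)
Lemma power_series_mul_linear f a r M c (b : C) :
  power_series f a r M c ->
  power_series (fun s => (s + b) * f s) a r ((r + cabs (a + b)) * M)
    (fun n => c n * (a + b) + (if n is m.+1 then c m else 0)).
Proof.
move=> [r0 cM h].
have sh : power_series (fun s => (s - a) * f s) a r (r * M)
    (fun n => if n is m.+1 then c m else 0).
  split=> [//|n|s sr].
    case: n => [|n]; first by rewrite big_ord0 mulr_ge0 ?(ltW r0) ?(power_series_bound (And3 r0 cM h)).
    rewrite big_ord_recl /= cabs0 mul0r add0r.
    apply: le_trans (ler_wpM2l (ltW r0) (cM n)); rewrite mulr_sumr.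
    by apply: ler_sum => i _; rewrite /bump /= add1n exprS mulrCA.
  apply/(cvg_shift 1).
  apply: (cvg_seq_eq _ (cvgM (cvg_cst (s - a)) (h s sr))) => n.
  rewrite ?fctE /= !seriesE addn1 big_ord_recl /= mul0r add0r.
  by rewrite mulr_sumr; apply: eq_bigr => i _; rewrite /bump /= add1n exprS mulrCA.
have -> : (r + cabs (a + b)) * M = cabs (a + b) * M + r * M by ring.
have -> : (fun n => c n * (a + b) + (if n is m.+1 then c m else 0)) =
    (fun n => (a + b) * c n + (if n is m.+1 then c m else 0)).
  by apply/funext => n; rewrite [c n * _]mulrC.
apply: power_series_eq (power_seriesD (power_seriesZ (a + b) (And3 r0 cM h)) sh).
by move=> s _; ring.
Qed.

Lemma power_series_shift f a r M c (b : C) :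
  power_series f (a + b) r M c -> power_series (fun s => f (s + b)) a r M c.
Proof.
move=> [r0 cM h]; split=> [||s sr]; [exact: r0|exact: cM|].
have e : s + b - (a + b) = s - a by ring.
by rewrite -e; apply: h; rewrite e.
Qed.

(* Weierstrass M-test in the norm sum |c_n| r^n *)
Lemma power_series_sum (f : nat -> C -> C) a r (M : nat -> R) B (c : nat -> nat -> C) :
  0 < r -> (forall q, power_series (f q) a r (M q) (c q)) -> sum_bounded M B ->
  exists d, [/\ power_series (fun s => limn (series (fun q => f q s) : nat -> C)) a r B d,
    forall n, series (fun q => c q n) @ \oo --> d n &
    forall s, cabs (s - a) <= r -> cvgn (series (fun q => f q s) : nat -> C)].
Proof.
move=> r0 hf MB.
have cd n : exists d : C, series (fun q => c q n) @ \oo --> d.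
  have [|d hd _] := @abs_cvg _ (fun q => c q n) (B / r ^+ n); last by exists d.
  move=> N; rewrite ler_pdivlMr ?exprn_gt0 //; apply: le_trans (MB N).
  by rewrite mulr_suml; apply: ler_sum => i _; exact: power_series_term (hf i).
have [d hd] := choice cd.
have ex s : cabs (s - a) <= r -> exists S : C,
    series (fun q => f q s) @ \oo --> S /\
    series (fun n => d n * (s - a) ^+ n) @ \oo --> S.
  move=> sr.
  have [||||S [S1 S2 _]] := @series_exchange _ (fun q n => c q n * (s - a) ^+ n)
      (fun q => f q s) (fun n => d n * (s - a) ^+ n) M B; last by exists S.
  - move=> q n; have [_ h _] := hf q; apply: le_trans (h n).
    apply: ler_sum => i _; rewrite cabsM ler_wpM2l ?cabs_ge0 // cabsX.
    by rewrite lerXn2r // nnegrE ?cabs_ge0 // ltW.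
  - by [].
  - by move=> q; have [_ _] := hf q; apply.
  - move=> n; apply: (cvg_seq_eq _ (cvgM (hd n) (cvg_cst ((s - a) ^+ n)))) => N.
    by rewrite ?fctE /= !seriesE mulr_suml.
exists d; split; [|exact: hd|by move=> s /ex[S [h _]]; exact: cvgP h].
split=> [//|N|s /ex[S [h1 h2]]]; last by rewrite (cvg_lim _ h1).
(* For the norm of the limit coefficients, the bound is proved for finitely many summands and
   finitely many coefficients, and passes to the limit in Q. *)
have h : (fun Q => \sum_(n < N) (cabs (series (fun q => c q n) Q) * r ^+ n)) @ \oo -->
    \sum_(n < N) (cabs (d n) * r ^+ n).
  elim: N => [|N IH].
    by rewrite big_ord0; under eq_fun do rewrite big_ord0; exact: cvg_cst.
  rewrite big_ord_recr /=; under eq_fun do rewrite big_ord_recr /=.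
  apply: cvgD => //; apply: cvgM; last exact: cvg_cst.
  exact: cvg_cabs_norm (hd N).
rewrite -(cvg_lim _ h) //; apply: limr_le; first exact: cvgP h.
apply: nearW => Q; apply: (@le_trans _ _ (\sum_(n < N) \sum_(q < Q) (cabs (c q n) * r ^+ n))).
  apply: ler_sum => n _; rewrite -mulr_suml ler_wpM2r ?exprn_ge0 ?(ltW r0) //.
  by rewrite seriesE; exact: cabs_sum.
rewrite exchange_big /=; apply: le_trans (MB Q); apply: ler_sum => q _.
by have [_ h' _] := hf q; exact: h'.
Qed.

End PowerSeries.

(** * Recentering, Taylor remainders, derivatives and zeros of analytic functions *)

Section AnalyticFunctions.
Variable R : realType.
Local Notation C := (cplx R).
Implicit Types (f g : C -> C) (a b s : C) (r M : R) (c d : nat -> C).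

(** When r + |b - a| is the old radius, the norm about b equals that of the monomial about a;
    recentering a whole series then costs nothing. The first two coefficients are recorded because
    they carry value and derivative. *)
Lemma power_series_monomial (x : C) a b r n : 0 < r ->
  exists d, power_series (fun s => x * (s - a) ^+ n) b r
      (cabs x * (r + cabs (b - a)) ^+ n) d /\
    (d 0 = x * (b - a) ^+ n /\ d 1 = x * n%:R * (b - a) ^+ n.-1).
Proof.
move=> r0; elim: n => [|n [d [h [d0 d1]]]].
  exists (fun n => if n is 0 then x else 0); split; last by rewrite !expr0 !mulr1 mulr0.
  rewrite expr0 mulr1; apply: power_series_eq (power_series_cst x b r0) => s _.
  by rewrite expr0 mulr1.
exists (fun n => d n * (b - a) + (if n is m.+1 then d m else 0)); split; last first.
  rewrite d1 /= d0 addr0 exprSr -mulrA; split=> //.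
  case: n {h d1 d0} => [|n] /=; first by rewrite !expr0 mulr0 !mul0r add0r !mulr1.
  by rewrite -[n.+2]addn1 natrD exprSr; ring.
have -> : cabs x * (r + cabs (b - a)) ^+ n.+1 =
   (r + cabs (b - a)) * (cabs x * (r + cabs (b - a)) ^+ n) by rewrite exprS; ring.
apply: power_series_eq (power_series_mul_linear (- a) h) => s _.
by rewrite exprS; ring.
Qed.

Lemma power_series_recenter f a b r M c :
  power_series f a r M c -> cabs (b - a) < r ->
  exists2 d, power_series f b (r - cabs (b - a)) M d &
    series (fun n => c n * n%:R * (b - a) ^+ n.-1) @ \oo --> d 1.
Proof.
move=> [r0 cM h] br.
have rb : 0 < r - cabs (b - a) by rewrite subr_gt0.
have /choice[d hd] n := power_series_monomial (c n) a b n rb.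
(* The new radius plus the distance of the centers is r, so the norms of the monomials still add up
   to at most M. *)
have hd1 q := (hd q).1; rewrite subrK in hd1.
have [e [e1 e2 e3]] := power_series_sum rb hd1 cM.
exists e; last first.
  apply: cvg_seq_eq (e2 1) => n; congr (series _ n); apply/funext => q.
  by have [_ [_ ->]] := hd q.
apply: power_series_eq e1 => s sb.
apply: (@cvg_lim _ (@norm_hausdorff _ _)); apply: h.
have := ler_cabsD (s - b) (b - a); rewrite addrA subrK; lra.
Qed.

(** For k >= N, |s - a|^k <= (|s - a| / r)^N r^k, so the tail is at most this factor times the
    norm. *)
Lemma power_series_taylor f a r M c N s :
  power_series f a r M c -> cabs (s - a) <= r ->
  cabs (f s - \sum_(k < N) c k * (s - a) ^+ k) <= (cabs (s - a) / r) ^+ N * M.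
Proof.
move=> [r0 cM h] sr; apply: cabs_series_tail (h s sr) _ => n.
have H : \sum_(k < n) cabs (c (N + k)%N) * r ^+ (N + k) <= M.
  apply: le_trans (cM (n + N)%N).
  rewrite -(big_mkord xpredT (fun k => cabs (c k) * r ^+ k)).
  rewrite (@big_cat_nat _ _ _ N) ?leq_addl //= (sum_shift (fun k => cabs (c k) * r ^+ k)).
  rewrite lerDr; apply: sumr_ge0 => i _.
  by rewrite mulr_ge0 ?cabs_ge0 // exprn_ge0 // ltW.
have q0 : 0 <= (cabs (s - a) / r) ^+ N by rewrite exprn_ge0 // divr_ge0 ?cabs_ge0 // ltW.
apply: le_trans (ler_wpM2l q0 H); rewrite mulr_sumr; apply: ler_sum => i _.
rewrite cabsM cabsX !exprD expr_div_n.
have -> : cabs (s - a) ^+ N / r ^+ N * (cabs (c (N + i)%N) * (r ^+ N * r ^+ i)) =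
  cabs (c (N + i)%N) * (cabs (s - a) ^+ N * r ^+ i).
  by field; rewrite expf_neq0 // gt_eqF.
rewrite ler_wpM2l ?cabs_ge0 // ler_wpM2l ?exprn_ge0 ?cabs_ge0 //.
by rewrite lerXn2r // nnegrE ?cabs_ge0 // ltW.
Qed.

Lemma power_series_continuous f a r M c (e : R) :
  power_series f a r M c -> 0 < e ->
  exists2 r', 0 < r' & forall s, cabs (s - a) < r' -> cabs (f s - f a) < e.
Proof.
move=> hf e0; have M0 := power_series_bound hf; have [r0 _ _] := hf.
have M1 : 0 < M + 1 by rewrite ltr_wpDl.
exists (Num.min r (r * e / (M + 1))).
  by rewrite lt_min r0 /= divr_gt0 ?mulr_gt0.
move=> s; rewrite lt_min => /andP[sr s2].
have := power_series_taylor 1 hf (ltW sr).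
rewrite big_ord1 expr0 mulr1 -(power_series_center hf) expr1 => h.
apply: le_lt_trans h _; rewrite mulrAC ltr_pdivrMr //.
apply: (@le_lt_trans _ _ (cabs (s - a) * (M + 1))); last first.
  by rewrite [e * r]mulrC -ltr_pdivlMr.
by rewrite ler_wpM2l ?cabs_ge0 // lerDl.
Qed.

(** Convergence at one point at distance r / 2 bounds the terms |c_n| (r / 2)^n by K + 1; at radius
    r / 4 they are dominated by a geometric series of ratio 1 / 2. *)
Lemma analytic_series f a :
  analytic_at f a -> exists r M c, power_series f a r M c.
Proof.
move=> [c /nbhs_cabs[r r0 h]].
have r2 : cabs ((a + (r / 2)%:C) - a) = r / 2.
  by rewrite addrC addKr cabs_real ger0_norm // divr_ge0 // ltW.
have /h : cabs ((a + (r / 2)%:C) - a) < r by rewrite r2; lra.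
move=> hc; have := cvg_series_cvg_0 (cvgP _ hc).
move=> /cvg_cabs_norm /cvgP /cvg_seq_bounded[K [_ hK]].
have {}hK n : cabs (c n) * (r / 2) ^+ n <= K + 1.
  have := hK (K + 1); rewrite ltrDl ltr01 => /(_ isT n I) /=.
  by rewrite ger0_norm ?cabs_ge0 // cabsM cabsX r2.
exists (r / 4), (2 * (K + 1)), c; split=> [|n|s sr]; [lra| |apply: h; lra].
apply: (@le_trans _ _ (\sum_(k < n) (K + 1) * (1 / 2) ^+ k)).
  apply: ler_sum => k _.
  have -> : r / 4 = r / 2 * (1 / 2) by field.
  by rewrite exprMn mulrA ler_wpM2r // exprn_ge0.
rewrite -mulr_sumr mulrC ler_wpM2r //.
  by apply: le_trans (hK 0); rewrite expr0 mulr1 cabs_ge0.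
have := subrX1 (1 / 2 : R) n.
have : 0 <= (1 / 2 : R) ^+ n by rewrite exprn_ge0.
lra.
Qed.

Lemma power_series_analytic f a r M c : power_series f a r M c -> analytic_at f a.
Proof.
move=> [r0 cM h]; exists c; apply/nbhs_cabs; exists r => // s sr.
by apply: h; exact: ltW.
Qed.

Lemma power_series_analytic_near f a b r M c : power_series f a r M c ->
  cabs (b - a) < r -> analytic_at f b.
Proof. by move=> hf /(power_series_recenter hf)[d /power_series_analytic]. Qed.

(** The Taylor remainder of order two is at most (|h| / r)^2 M; divided by h it tends to 0. The
    denominator M + 1 in the radius avoids the case M = 0. *)
Lemma power_series_derive1 f a r M c : power_series f a r M c -> derive1 f a = c 1.
Proof.
move=> hf; have [r0 _ _] := hf; have M0 := power_series_bound hf.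
rewrite /derive1; apply: (@cvg_lim _ (@norm_hausdorff _ _)).
apply/cvg_cabs => e e0; apply/dnbhs_cabs.
have M1 : 0 < M + 1 by rewrite ltr_wpDl.
exists (Num.min r (r ^+ 2 * e / (M + 1))).
  by rewrite lt_min r0 /= divr_gt0 ?mulr_gt0 ?exprn_gt0.
move=> h h0; rewrite subr0 lt_min => /andP[hr h2].
have ha : h + a - a = h by rewrite addrK.
have := @power_series_taylor _ _ _ _ _ 2 (h + a) hf.
rewrite ha => /(_ (ltW hr)).
rewrite !big_ord_recl big_ord0 /= expr0 mulr1 -(power_series_center hf) addr0.
rewrite /bump /= addn0 expr1 opprD addrA => H.
have ch : 0 < cabs h by rewrite cabs_gt0.
have -> : h^-1 *: (f (h + a) - f a) - c 1 = h^-1 * (f (h + a) - f a - c 1 * h).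
  by rewrite mulrBr mulrCA mulVf ?mulr1.
rewrite cabsM cabsV mulrC ltr_pdivrMr //; apply: le_lt_trans H _.
rewrite expr_div_n mulrAC ltr_pdivrMr ?exprn_gt0 //.
have -> : cabs h ^+ 2 * M = cabs h * (cabs h * M) by ring.
have -> : e * cabs h * r ^+ 2 = cabs h * (r ^+ 2 * e) by ring.
rewrite ltr_pdivlMr // in h2; rewrite ltr_pM2l //; apply: le_lt_trans h2.
by rewrite ler_wpM2l ?cabs_ge0 // lerDl.
Qed.

(** Halving the radius pays for the factor n + 1 <= 2^n. Convergence to the derivative at s comes
    from recentering at s, where the derivative is the coefficient of index 1. *)
Lemma power_series_derive f a r M c : power_series f a r M c ->
  power_series (derive1 f) a (r / 2) (M / r) (fun n => n.+1%:R * c n.+1).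
Proof.
move=> hf; have [r0 cM h] := hf.
split=> [|n|s sr]; first by rewrite divr_gt0.
  rewrite ler_pdivlMr //; apply: le_trans (cM n.+1).
  rewrite big_ord_recl mulr_suml ler_wpDl ?mulr_ge0 ?cabs_ge0 //.
  apply: ler_sum => i _; rewrite lift0 cabsM cabs_nat exprS.
  have key : i.+1%:R * (r / 2) ^+ i <= r ^+ i.
    rewrite expr_div_n mulrA ler_pdivrMr ?exprn_gt0 // mulrC.
    by rewrite ler_wpM2l ?exprn_ge0 ?(ltW r0) // -natrX ler_nat ltn_expl.
  have -> : i.+1%:R * cabs (c i.+1) * (r / 2) ^+ i * r =
    cabs (c i.+1) * r * (i.+1%:R * (r / 2) ^+ i) by ring.
  by rewrite [leRHS]mulrA ler_wpM2l // mulr_ge0 ?cabs_ge0 // ltW.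
have sr' : cabs (s - a) < r by lra.
have [d hd d1] := power_series_recenter hf sr'.
rewrite (power_series_derive1 hd); move/(iffRL (cvg_shift 1 _ _)): d1.
apply: cvg_seq_eq => n; rewrite !seriesE addn1 big_ord_recl mulr0 mul0r add0r.
by apply: eq_bigr => i _; rewrite lift0 [c _ * _]mulrC.
Qed.

Lemma power_series_derive1n f a r M c j : power_series f a r M c ->
  derive1n j f a = j`!%:R * c j.
Proof.
move=> hf.
(* The coefficients of the j-th derivative are (n + 1) ... (n + j) c_(n + j); the radius halves with
   each derivative, but only the value at the center is read off. *)
suff [r' [M' [hf' _]]] : exists r' M', power_series (derive1n j f) a r' M'
    (fun n => (\prod_(k < j) (n + k).+1)%:R * c (n + j)%N) /\ True.
  rewrite (power_series_center hf') add0n fact_prod; congr (_%:R * _).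
  by rewrite big_add1 big_mkord; apply: eq_bigr.
elim: j => [|j [r' [M' [IH _]]]].
  exists r, M; split => //; move: hf; congr power_series.
  by apply/funext => n; rewrite big_ord0 mul1r addn0.
exists (r' / 2), (M' / r'); split => //; rewrite derive1nS.
have := power_series_derive IH; congr power_series.
apply/funext => n; rewrite big_ord_recl mulrA -natrM addn0 addSnnS.
congr (_%:R * _); congr (_ * _)%N; apply: eq_bigr => i _.
by rewrite lift0 addSnnS.
Qed.

Lemma power_series_of_coef a r M c : 0 < r -> sum_bounded (fun k => cabs (c k) * r ^+ k) M ->
  power_series (fun s => limn (series (fun n => c n * (s - a) ^+ n) : nat -> C)) a r M c.
Proof.
move=> r0 cM; split; [exact: r0|exact: cM|move=> s sr].
have [|l hl _] := @abs_cvg _ (fun n => c n * (s - a) ^+ n) M.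
  move=> n; apply: le_trans (cM n); apply: ler_sum => i _.
  by rewrite cabsM cabsX ler_wpM2l ?cabs_ge0 // lerXn2r // nnegrE ?cabs_ge0 // ltW.
by rewrite (cvg_lim _ hl).
Qed.

(** The exponent m is the index of the first nonzero coefficient, and g has the coefficients shifted
    by m. This is the isolation of zeros used throughout. *)
Lemma analytic_factor f a : analytic_at f a ->
  (\forall z \near a, f z = 0) \/
  exists m g, [/\ analytic_at g a, g a != 0 & \forall z \near a, f z = (z - a) ^+ m * g z].
Proof.
move=> /analytic_series[r [M [c hf]]]; have [r0 cM h] := hf.
have [c0|/existsNP[m0 cm0]] := pselect (forall n, c n = 0).
  left; apply/nbhs_cabs; exists r => // s sr; apply: (cvg_seq_unique (h s (ltW sr))).
  rewrite (_ : series _ = cst 0); first exact: cvg_cst.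
  by apply/funext => n; rewrite seriesE big1 // => i _; rewrite c0 mul0r.
have ex : exists m, c m != 0 by exists m0; apply/eqP.
have [m cm hm] := ex_minnP ex.
pose d n := c (n + m)%N.
have dM : sum_bounded (fun k => cabs (d k) * r ^+ k) (M / r ^+ m).
  move=> n; rewrite ler_pdivlMr ?exprn_gt0 //; apply: le_trans (cM (n + m)%N).
  rewrite -[leRHS](big_mkord xpredT (fun k => cabs (c k) * r ^+ k)).
  rewrite (@big_cat_nat _ _ _ m) ?leq_addl //= (sum_shift (fun k => cabs (c k) * r ^+ k)).
  rewrite ler_wpDl //.
    by apply: sumr_ge0 => i _; rewrite mulr_ge0 ?cabs_ge0 // exprn_ge0 // ltW.
  rewrite mulr_suml; apply: ler_sum => i _.
  by rewrite /d addnC exprD -mulrA [_ ^+ i * _]mulrC.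
have hg := power_series_of_coef a r0 dM; right.
exists m, (fun s => limn (series (fun n => d n * (s - a) ^+ n) : nat -> C)); split.
- exact: power_series_analytic hg.
- by rewrite (power_series_center hg) /d add0n.
- apply/nbhs_cabs; exists r => // s /ltW sr.
  apply: (cvg_seq_unique (h s sr)); apply/(cvg_shift m).
  have [_ _ /(_ s sr) H] := hg.
  apply: (cvg_seq_eq _ (cvgM (cvg_cst ((s - a) ^+ m)) H)) => n.
  rewrite /= !seriesE -[RHS](big_mkord xpredT (fun k => c k * (s - a) ^+ k)).
  rewrite (@big_cat_nat _ _ _ m) ?leq_addl //= (sum_shift (fun k => c k * (s - a) ^+ k)).
  rewrite [X in _ = X + _]big_nat_cond [X in _ = X + _]big1 ?add0r; last first.
    move=> i /andP[/andP[_ im] _].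
    have [->|/hm] := eqVneq (c i) 0; first by rewrite mul0r.
    by rewrite leqNgt im.
  rewrite mulr_sumr; apply: eq_bigr => i _.
  by rewrite /d [(i + m)%N]addnC exprD mulrCA.
Qed.

End AnalyticFunctions.

(** * The complex exponential and the binomial series *)

Section ComplexExponential.
Variable R : realType.
Local Notation C := (cplx R).
Implicit Types (x y z s w : C).

Lemma sum_exp_le (x : R) n : 0 <= x -> \sum_(k < n) x ^+ k / k`!%:R <= expR x.
Proof.
move=> x0; rewrite -(seriesE (exp_coeff x)) /expR.
apply: nondecreasing_cvgn_le; last exact: is_cvg_series_exp_coeff.
by apply/nondecreasing_seqP => m; rewrite [leRHS]seriesSr lerDl exp_coeff_ge0.
Qed.

Lemma cabs_expcoef z k : cabs (z ^+ k / k`!%:R) = cabs z ^+ k / k`!%:R.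
Proof. by rewrite cabsM cabsX cabsV cabs_nat. Qed.

Lemma exp_series_bounded z : sum_bounded (fun k => cabs (z ^+ k / k`!%:R)) (expR (cabs z)).
Proof.
move=> n; under eq_bigr do rewrite cabs_expcoef.
exact: sum_exp_le (cabs_ge0 z).
Qed.

Lemma cvg_series_finite (u : nat -> C) N : (forall n, u (N + n)%N = 0) ->
  series u @ \oo --> \sum_(k < N) u k.
Proof.
move=> h; apply/(cvg_shift N); rewrite [X in X @ _](_ : _ = cst (\sum_(k < N) u k)).
  exact: cvg_cst.
apply/funext => n; rewrite /cst /series /= (@big_cat_nat _ _ _ N) ?leq_addl //=.
by rewrite sum_shift [X in _ + X]big1 ?addr0 ?big_mkord.
Qed.

(** Cauchy product. The limits are left abstract because their identification with [cexp] in
    [cexp_series] itself relies on this addition formula. *)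
Lemma exp_seriesD z w (Ez Ew Ezw : C) :
  series (fun k => z ^+ k / k`!%:R) @ \oo --> Ez ->
  series (fun k => w ^+ k / k`!%:R) @ \oo --> Ew ->
  series (fun k => (z + w) ^+ k / k`!%:R) @ \oo --> Ezw -> Ezw = Ez * Ew.
Proof.
move=> hz hw hzw.
(* A triangular array: row k is z^k / k! times the series of w delayed by k places, and column n is
   a finite sum given by the binomial theorem. *)
pose a k n : C := if (k <= n)%N then z ^+ k / k`!%:R * (w ^+ (n - k) / (n - k)`!%:R) else 0.
have [||||S [S1 S2 _]] := @series_exchange _ a (fun k => z ^+ k / k`!%:R * Ew)
   (fun n => (z + w) ^+ n / n`!%:R) (fun k => cabs (z ^+ k / k`!%:R) * expR (cabs w))
   (expR (cabs z) * expR (cabs w)).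
- move=> k n.
  apply: (@le_trans _ _ (\sum_(0 <= i < n + k) cabs (a k i))).
    rewrite -(big_mkord xpredT (fun i => cabs (a k i))).
    rewrite [leRHS](@big_cat_nat _ _ _ n) ?leq_addr //= lerDl.
    by apply: sumr_ge0 => i _; exact: cabs_ge0.
  rewrite (@big_cat_nat _ _ _ k) ?leq_addl //= sum_shift.
  rewrite [X in X + _]big_nat_cond [X in X + _]big1 ?add0r; last first.
    by move=> i /andP[/andP[_ ik] _]; rewrite /a leqNgt ik cabs0.
  under eq_bigr do rewrite /a leq_addr addKn cabsM.
  by rewrite -mulr_sumr ler_wpM2l ?cabs_ge0 //; exact: exp_series_bounded.
- by move=> n; rewrite -mulr_suml ler_wpM2r ?expR_ge0 //; exact: exp_series_bounded.
- move=> k; apply/(cvg_shift k).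
  apply: (cvg_seq_eq _ (cvgM (cvg_cst (z ^+ k / k`!%:R)) hw)) => n.
  rewrite /= seriesE -/(series (a k) (n + k)) /series /=.
  rewrite (@big_cat_nat _ _ _ k) ?leq_addl //= sum_shift.
  rewrite [X in _ = X + _]big_nat_cond [X in _ = X + _]big1 ?add0r; last first.
    by move=> i /andP[/andP[_ ik] _]; rewrite /a leqNgt ik.
  by rewrite mulr_sumr; apply: eq_bigr => i _; rewrite /a leq_addr addKn.
- move=> n; have := @cvg_series_finite (fun k => a k n) n.+1.
  rewrite (_ : \sum_(k < n.+1) a k n = (z + w) ^+ n / n`!%:R).
    by apply=> i; rewrite /a leqNgt addSn ltnS leq_addr.
  rewrite addrC exprDn mulr_suml; apply: eq_bigr => i _.
  have ni : (i <= n)%N by rewrite -ltnS.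
  rewrite /a ni -mulr_natr -(bin_fact ni) !natrM.
  field.
  by rewrite !pnatr_eq0 -!lt0n bin_gt0 ni !fact_gt0.
rewrite (cvg_seq_unique hzw S2); apply: (cvg_seq_unique S1).
apply: (cvg_seq_eq _ (cvgM hz (cvg_cst Ew))) => n.
by rewrite /= !seriesE mulr_suml.
Qed.

Lemma cexp_real (t : R) : cexp (t%:C : C) = (expR t)%:C.
Proof. by rewrite /cexp /= cos0 sin0 mulr1. Qed.

(** The definition of [cexp] is matched with the series on the real axis (exponential) and on the
    imaginary axis (cosine and sine), and the addition formula joins the two. *)
Lemma cexp_series z : series (fun k => z ^+ k / k`!%:R) @ \oo --> cexp z.
Proof.
have hr (t : R) : series (fun k => (t%:C : C) ^+ k / k`!%:R) @ \oo --> ((expR t)%:C : C).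
  have e k : (t%:C : C) ^+ k / k`!%:R = (exp_coeff t k)%:C.
    by rewrite /exp_coeff /= rmorphM rmorphXn fmorphV rmorph_nat.
  apply: cvg_ReIm.
    rewrite (_ : (fun n => _) = series (exp_coeff t)); first exact: is_cvg_series_exp_coeff.
    by apply/funext => n; rewrite !seriesE Re_sum; apply: eq_bigr => i _; rewrite e.
  rewrite (_ : (fun n => _) = cst 0); first exact: cvg_cst.
  by apply/funext => n; rewrite seriesE Im_sum big1 // => i _; rewrite e.
have hi (t : R) : series (fun k => (0 +i* t : C) ^+ k / k`!%:R) @ \oo --> (cos t +i* sin t : C).
  have p2 k : (0 +i* t : C) ^+ k.*2 = ((-1) ^+ k * t ^+ k.*2)%:C.
    rewrite -mul2n !exprM (_ : (0 +i* t) ^+ 2 = (- (t ^+ 2))%:C); last first.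
      by apply/eqP; rewrite expr2 eq_complex /= !(mul0r, mulr0) sub0r addr0 expr2 !eqxx.
    by rewrite -rmorphXn -exprMn mulN1r.
  have e k : (0 +i* t : C) ^+ k / k`!%:R = (cos_coeff t k +i* sin_coeff t k).
    rewrite /cos_coeff /sin_coeff /= -[k]odd_double_half.
    rewrite -(rmorph_nat (real_complex R)) -fmorphV.
    case: (odd k) => /=.
      rewrite add1n exprS p2 /= odd_double /= doubleK.
      apply/eqP; rewrite eq_complex /= !(mul0r, mulr0, sub0r, add0r, addr0, subr0, oppr0, mul1r).
      by rewrite eqxx /= exprS; apply/eqP; ring.
    rewrite !add0n p2 odd_double /= (half_bit_double _ false).
    by apply/eqP; rewrite eq_complex /= !(mul0r, mulr0, sub0r, add0r, addr0, subr0, oppr0, mul1r) !eqxx.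
  apply: cvg_ReIm.
    rewrite (_ : (fun n => _) = series (cos_coeff t)).
      by rewrite unlock; exact: is_cvg_series_cos_coeff.
    by apply/funext => n; rewrite !seriesE Re_sum; apply: eq_bigr => i _; rewrite e.
  rewrite (_ : (fun n => _) = series (sin_coeff t)).
    by rewrite unlock; exact: is_cvg_series_sin_coeff.
  by apply/funext => n; rewrite !seriesE Im_sum; apply: eq_bigr => i _; rewrite e.
have [E hE _] := @abs_cvg _ (fun k => z ^+ k / k`!%:R) _ (exp_series_bounded z).
have zE : z = (Re z)%:C + (0 +i* Im z).
  by case: z {hE} => a b; apply/eqP; rewrite eq_complex /= addr0 add0r !eqxx.
have := hE; rewrite {1}zE => /(exp_seriesD (hr _) (hi _)) EE.
by rewrite /cexp -EE.
Qed.

Lemma cexpD z w : cexp (z + w) = cexp z * cexp w.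
Proof. exact: (exp_seriesD (@cexp_series z) (@cexp_series w) (@cexp_series (z + w))). Qed.

Lemma cexp0 : cexp (0 : C) = 1.
Proof. by rewrite (cexp_real 0) expR0. Qed.

Lemma cabs_cexp z : cabs (cexp z) = expR (Re z).
Proof.
rewrite /cexp cabsM cabs_real ger0_norm ?expR_ge0 //.
by rewrite /cabs /= cos2Dsin2 sqrtr1 mulr1.
Qed.

Lemma cexp_neq0 z : cexp z != 0.
Proof. by rewrite -cabs_gt0 cabs_cexp expR_gt0. Qed.

Lemma cexpN z : cexp (- z) = (cexp z)^-1.
Proof.
apply: (mulIf (cexp_neq0 z)); rewrite -cexpD addNr cexp0 mulVf //.
exact: cexp_neq0.
Qed.

Lemma cexp_sum (I : Type) (r : seq I) (P : pred I) (F : I -> C) :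
  cexp (\sum_(i <- r | P i) F i) = \prod_(i <- r | P i) cexp (F i).
Proof. exact: (big_morph _ cexpD cexp0). Qed.

Lemma power_series_cexp (b a : C) (r : R) : 0 < r ->
  power_series (fun s => cexp (b * s)) a r (cabs (cexp (b * a)) * expR (cabs b * r))
    (fun n => cexp (b * a) * (b ^+ n / n`!%:R)).
Proof.
move=> r0; apply: power_series_eq (_ : power_series (fun s => cexp (b * a) * cexp (b * (s - a))) _ _ _ _).
  by move=> s _; rewrite -cexpD -mulrDr addrC subrK.
apply: power_seriesZ; split=> [//|n|s _].
  apply: le_trans (sum_exp_le n _); last by rewrite mulr_ge0 ?cabs_ge0 // ltW.
  apply: ler_sum => i _; rewrite cabs_expcoef exprMn; lra.
apply: (cvg_seq_eq _ (@cexp_series (b * (s - a)))) => n; rewrite !seriesE; apply: eq_bigr => i _.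
by rewrite exprMn; ring.
Qed.

Lemma cvg_cexp (u : nat -> C) (l : C) : u @ \oo --> l -> (fun n => cexp (u n)) @ \oo --> cexp l.
Proof.
move=> /cvg_cabs h; apply/cvg_cabs => e e0.
have := power_series_cexp 1 l ltr01.
move=> /power_series_continuous /(_ e0)[r r0 hr].
apply: filterS (h r r0) => n /hr; by rewrite !mul1r.
Qed.

End ComplexExponential.

(** * Complex derivatives and functions with vanishing derivative *)

Section ComplexDerivative.
Variable R : realType.
Local Notation C := (cplx R).
Implicit Types (f h : C -> C) (b l x : C).

Lemma cvg_at_cabs f b l : f @ b --> l <->
  forall e : R, 0 < e -> exists2 r : R, 0 < r &
    forall z, cabs (z - b) < r -> cabs (f z - l) < e.
Proof.
have H := @cvg_cabs R _ (nbhs b) (nbhs_filter b) f l.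
split=> [/(iffLR H) h e /h /nbhs_cabs //|h]; apply/(iffRL H) => e /h.
by move/nbhs_cabs.
Qed.

(* Caratheodory's form of the derivative *)
Definition has_derivative f b l :=
  exists g : C -> C, [/\ forall z, f z - f b = g z * (z - b), g b = l & g @ b --> l].

Lemma has_derivative_cvg f b l : has_derivative f b l -> f @ b --> f b.
Proof.
move=> [g [fg gb gl]].
rewrite (_ : f = fun z => f b + g z * (z - b)); last first.
  by apply/funext => z; rewrite -fg addrC subrK.
rewrite [X in _ --> X](_ : _ = f b + l * (b - b)); last by rewrite subrr !mulr0.
apply: (cvgD (cvg_cst (f b)) (cvgM gl (cvgB cvg_id (cvg_cst b)))).
Qed.

Lemma has_derivativeM f h b l l' : has_derivative f b l -> has_derivative h b l' ->
  has_derivative (fun z => f z * h z) b (f b * l' + l * h b).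
Proof.
move=> hf [g' [hg' g'b g'l]]; have fc := has_derivative_cvg hf.
have [g [fg gb gl]] := hf.
exists (fun z => f z * g' z + g z * h b); split.
- move=> z; rewrite mulrDl -!mulrA -hg' [h b * _]mulrC mulrA -fg; ring.
- by rewrite gb g'b.
- exact: (cvgD (cvgM fc g'l) (cvgM gl (cvg_cst (h b)))).
Qed.

Lemma has_derivative_comp f h b l l' : has_derivative f (h b) l -> has_derivative h b l' ->
  has_derivative (fun z => f (h z)) b (l * l').
Proof.
move=> [g [fg gb gl]] hh; have hc := has_derivative_cvg hh.
have [g' [hg' g'b g'l]] := hh.
exists (fun z => g (h z) * g' z); split.
- by move=> z; rewrite fg hg' mulrA.
- by rewrite g'b gb.
- exact: (cvgM (cvg_comp _ _ hc gl) g'l).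
Qed.

Lemma has_derivativeZ (k : C) f b l : has_derivative f b l ->
  has_derivative (fun z => k * f z) b (k * l).
Proof.
move=> [g [fg gb gl]]; exists (fun z => k * g z); split.
- by move=> z; rewrite -mulrBr fg mulrA.
- by rewrite gb.
- exact: (cvgM (cvg_cst k) gl).
Qed.

Lemma power_series_has_derivative f a (r M : R) c :
  power_series f a r M c -> has_derivative f a (c 1).
Proof.
move=> hf; have [r0 _ _] := hf; have M0 := power_series_bound hf.
exists (fun z => if z == a then c 1 else (f z - f a) / (z - a)); split.
- move=> z; case: eqVneq => [->|za]; first by rewrite !subrr mulr0.
  by rewrite divfK // subr_eq0.
- by rewrite eqxx.
apply/cvg_at_cabs => e e0.
have M1 : 0 < M + 1 by rewrite ltr_wpDl.
exists (Num.min r (r ^+ 2 * e / (M + 1))).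
  by rewrite lt_min r0 /= divr_gt0 ?mulr_gt0 ?exprn_gt0.
move=> z; rewrite lt_min => /andP[hr h2].
case: ifPn => [_|za]; first by rewrite subrr cabs0.
have := @power_series_taylor _ _ _ _ _ _ 2 z hf (ltW hr).
rewrite !big_ord_recl big_ord0 /= expr0 mulr1 -(power_series_center hf) addr0.
rewrite /bump /= addn0 expr1 opprD addrA => H.
have za0 : z - a != 0 by rewrite subr_eq0.
have ch : 0 < cabs (z - a) by rewrite cabs_gt0.
have -> : (f z - f a) / (z - a) - c 1 = (z - a)^-1 * (f z - f a - c 1 * (z - a)).
  by field.
rewrite cabsM cabsV mulrC ltr_pdivrMr //; apply: le_lt_trans H _.
rewrite expr_div_n mulrAC ltr_pdivrMr ?exprn_gt0 //.
have -> : cabs (z - a) ^+ 2 * M = cabs (z - a) * (cabs (z - a) * M) by ring.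
have -> : e * cabs (z - a) * r ^+ 2 = cabs (z - a) * (r ^+ 2 * e) by ring.
rewrite ltr_pdivlMr // in h2; rewrite ltr_pM2l //; apply: le_lt_trans h2.
by rewrite ler_wpM2l ?cabs_ge0 // lerDl.
Qed.

Lemma power_series_derivative_at f a (r M : R) c b :
  power_series f a r M c -> cabs (b - a) < r -> has_derivative f b (derive1 f b).
Proof.
move=> hf /(power_series_recenter hf)[d hd _].
by rewrite (power_series_derive1 hd); exact: power_series_has_derivative hd.
Qed.

Lemma real_constant_of_derivative0 (phi : R -> R) :
  (forall t : R, 0 <= t <= 1 -> is_derive t 1 phi 0) -> phi 1 = phi 0.
Proof.
move=> h; have [] := @MVT R phi (cst 0) 0 1 ltr01.
- by move=> t; rewrite in_itv /= => /andP[t0 t1]; apply: h; rewrite !ltW.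
- apply: derivable_within_continuous => t; rewrite in_itv /= => /h[] //.
- by move=> c _; rewrite mul0r => /eqP; rewrite subr_eq0 => /eqP.
Qed.

(** Along the segment t x with 0 <= t <= 1, the real and imaginary parts of h are real functions
    with derivative 0, to which the mean value theorem applies; P stands for either part. *)
Lemma constant_of_derivative0 h (rho : R) x :
  (forall b, cabs b < rho -> has_derivative h b 0) -> cabs x < rho -> h x = h 0.
Proof.
move=> hd xr.
have key (P : C -> R) : (forall z w, P (z + w) = P z + P w) ->
    (forall (t : R) z, P (t%:C * z) = t * P z) -> (forall z, `|P z| <= cabs z) ->
    P (h x) = P (h 0).
  move=> PD PZ Pn.
  have P_B z w : P (z - w) = P z - P w.
    by rewrite PD -mulN1r (_ : -1 = (-1)%:C) ?PZ ?mulN1r // rmorphN1.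
  have := @real_constant_of_derivative0 (fun t => P (h (t%:C * x))).
  rewrite mul1r mul0r; apply => t /andP[t0 t1].
  have [g [hg gb gl]] : has_derivative h (t%:C * x) 0.
    apply: hd; rewrite cabsM cabs_real ger0_norm //; apply: le_lt_trans xr.
    by rewrite ler_piMl ?cabs_ge0.
  apply/is_derive1_caratheodory.
  exists (fun u => P (g (u%:C * x) * x)); split.
  - move=> u; rewrite -P_B hg [RHS]mulrC -PZ; congr P.
    by rewrite rmorphB /=; ring.
  - rewrite /prop_for /continuous_at /= gb mul0r.
    have -> : P 0 = 0 by have := PZ 0 0; rewrite !mul0r.
    apply/cvgrPdist_lt => e e0.
    have x1 : 0 < cabs x + 1 by rewrite ltr_wpDl ?cabs_ge0.
    move/cvg_at_cabs: gl => /(_ (e / (cabs x + 1))); rewrite divr_gt0 // => /(_ isT).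
    move=> [d d0 hd'].
    apply/nbhs_ballP; exists (d / (cabs x + 1)); first by rewrite /= divr_gt0.
    move=> u /=; rewrite /ball /= ltr_pdivlMr // => tu.
    rewrite sub0r normrN; apply: le_lt_trans (Pn _) _; rewrite cabsM.
    have /hd' : cabs (u%:C * x - t%:C * x) < d.
      rewrite -mulrBl -rmorphB /= cabsM cabs_real distrC; apply: le_lt_trans tu.
      by rewrite ler_wpM2l // lerDl.
    rewrite subr0 ltr_pdivlMr //; apply: le_lt_trans.
    by rewrite ler_wpM2l ?cabs_ge0 // lerDl.
  - by rewrite gb mul0r; have := PZ 0 0; rewrite !mul0r.
have hR := key (fun z => Re z) (@Re_add R) _ (@ler_Re_cabs R).
have hI := key (fun z => Im z) (@Im_add R) _ (@ler_Im_cabs R).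
apply/eqP; rewrite eq_complex; apply/andP; split; apply/eqP.
  by apply: hR => t z; rewrite Re_mul /= mul0r subr0.
by apply: hI => t z; rewrite Im_mul /= mul0r addr0.
Qed.

End ComplexDerivative.

(** * The principal logarithm as inverse of the exponential *)

Section ComplexLogarithm.
Variable R : realType.
Local Notation C := (cplx R).
Implicit Types (z w u : C).

Lemma Re_div_cabs z : -1 <= Re z / cabs z <= 1.
Proof.
rewrite -ler_norml normrM normfV (ger0_norm (cabs_ge0 z)).
have [->|z0] := eqVneq z 0; first by rewrite /= normr0 mul0r ler01.
by rewrite ler_pdivrMr ?cabs_gt0 // mul1r ler_Re_cabs.
Qed.

Lemma cexp_clog z : z != 0 -> cexp (clog z) = z.
Proof.
move=> z0; have cz : 0 < cabs z by rewrite cabs_gt0.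
have zr := Re_div_cabs z.
have cosz : cos (carg z) = Re z / cabs z.
  by rewrite /carg; case: ifP => _; rewrite ?cosN acosK // in_itv.
have sq : Num.sqrt (1 - (Re z / cabs z) ^+ 2) = `|Im z| / cabs z.
  have -> : 1 - (Re z / cabs z) ^+ 2 = (Im z / cabs z) ^+ 2.
    have : cabs z ^+ 2 = Re z ^+ 2 + Im z ^+ 2 by rewrite sqr_sqrtr // addr_ge0 ?sqr_ge0.
    move=> e; rewrite !expr_div_n e -e; apply: (mulIf (lt0r_neq0 (exprn_gt0 2 cz))).
    by rewrite mulrBl !mulfVK ?expf_neq0 ?lt0r_neq0 // mul1r e addrC addKr.
  by rewrite sqrtr_sqr normrM normfV (ger0_norm (cabs_ge0 z)).
have sinz : sin (carg z) = Im z / cabs z.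
  rewrite /carg; case: ifPn => [i0|]; first by rewrite sin_acos // sq ger0_norm.
  by rewrite -ltNge => i0; rewrite sinN sin_acos // sq ltr0_norm // mulNr opprK.
rewrite /cexp /clog /= cosz sinz lnK // ?posrE //.
apply/eqP; rewrite eq_complex /= !mul0r subr0 addr0.
by rewrite ![cabs z * _]mulrC !divfK ?lt0r_neq0 // !eqxx.
Qed.

Lemma clog_cexp w : `|Im w| < pi -> clog (cexp w) = w.
Proof.
move=> wpi; have cE := cabs_cexp w.
have [w1 w2] : - pi < Im w /\ Im w < pi by move: wpi; rewrite ltr_norml => /andP[].
have e0 := expR_gt0 (Re w).
have ReE : Re (cexp w) = expR (Re w) * cos (Im w) by rewrite /cexp Re_mul /= mul0r subr0.
have ImE : Im (cexp w) = expR (Re w) * sin (Im w) by rewrite /cexp Im_mul /= mul0r addr0.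
rewrite /clog /carg cE expRK ReE ImE [expR _ * cos _]mulrC mulfK ?gt_eqF //.
case: w {wpi cE ReE ImE} w1 w2 e0 => x y /= w1 w2 e0.
have [y0|y0] := leP 0 y.
  rewrite mulr_ge0 ?(ltW e0) ?sin_ge0_pi ?y0 ?(ltW w2) //.
  by rewrite cosK // in_itv /= y0 ltW.
rewrite leNgt pmulr_rlt0 //.
have -> : sin y < 0.
  by rewrite -oppr_gt0 -sinN sin_gt0_pi // oppr_gt0 y0 ltrNl.
by rewrite /= cosKN ?opprK // !ltW.
Qed.

(** A positive factor does not change the argument, so no multiple of 2 pi appears. Hence (lambda +
    z)^-s = lambda^-s (1 + z / lambda)^-s whenever lambda + z is nonzero, with no restriction on the
    size of z. *)
Lemma clog_pmul (r : R) u : 0 < r -> u != 0 -> clog (r%:C * u) = (ln r)%:C + clog u.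
Proof.
move=> r0 u0; have cu : 0 < cabs u by rewrite cabs_gt0.
apply/eqP; rewrite eq_complex /=.
rewrite cabsM cabs_real (gtr0_norm r0) lnM ?posrE // eqxx add0r /=; apply/eqP.
rewrite /carg cabsM cabs_real (gtr0_norm r0).
have -> : Im (r%:C * u) = r * Im u by rewrite Im_mul /= mul0r addr0.
have -> : Re (r%:C * u) = r * Re u by rewrite Re_mul /= mul0r subr0.
by rewrite pmulr_rge0 // -mulf_div divff ?mul1r ?gt_eqF.
Qed.

Lemma clog_real (r : R) : 0 < r -> clog (r%:C : C) = (ln r)%:C.
Proof.
move=> r0; rewrite -[X in clog X]mulr1 clog_pmul ?oner_neq0 // -[RHS]addr0; congr (_ + _).
have := @clog_cexp 0; rewrite cexp0 /= normr0; apply; exact: pi_gt0.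
Qed.

End ComplexLogarithm.

(** * The binomial and logarithm series, and their link with principal powers *)

Section BinomialSeries.
Variable R : realType.
Local Notation C := (cplx R).
Implicit Types (s x : C).

(* (1 + x)^(-s) = sum_k nbinom k s x^k, see [nbinom_series]. *)
Definition nbinom (k : nat) s : C := \prod_(j < k) (- (s + j%:R) / j.+1%:R).

(** The rising factorial of rho over k!, that is, the modulus of [nbinom k] at s = rho, where it is
    largest on the disc |s| <= rho. *)
Definition nbinom_bound (k : nat) (rho : R) : R := \prod_(j < k) ((rho + j%:R) / j.+1%:R).

Lemma nbinom0 s : nbinom 0 s = 1.
Proof. by rewrite /nbinom big_ord0. Qed.

Lemma nbinomS k s : nbinom k.+1 s = nbinom k s * (- (s + k%:R) / k.+1%:R).
Proof. by rewrite /nbinom big_ord_recr. Qed.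

Lemma nbinom_bound_ge0 k (rho : R) : 0 <= rho -> 0 <= nbinom_bound k rho.
Proof. by move=> r0; apply: prodr_ge0 => i _; rewrite divr_ge0 ?addr_ge0. Qed.

Lemma cabs_nbinom k s (rho : R) : cabs s <= rho -> cabs (nbinom k s) <= nbinom_bound k rho.
Proof.
move=> sr; elim: k => [|k IH]; first by rewrite nbinom0 cabs1 /nbinom_bound big_ord0.
have r0 : 0 <= rho by exact: le_trans (cabs_ge0 _) sr.
rewrite nbinomS /nbinom_bound big_ord_recr cabsM; apply: ler_pM; rewrite ?cabs_ge0 //.
rewrite cabsM cabsN cabsV cabs_nat ler_wpM2r ?invr_ge0 //.
by apply: le_trans (ler_cabsD _ _) _; rewrite cabs_nat lerD2r.
Qed.

(** The ratio (rho + j) / (j + 1) of consecutive values is at most 2 as soon as j >= rho; each of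
    the finitely many earlier ratios is at most rho + 1, and these go into D. *)
Lemma nbinom_bound_geometric (rho : R) : 0 <= rho ->
  exists2 D : R, 0 <= D & forall k, nbinom_bound k rho <= D * 2 ^+ k.
Proof.
move=> r0; pose j0 := (Num.truncn rho).+1.
have rj : rho <= j0%:R by apply: ltW; rewrite truncnS_gt.
have r1 : 1 <= rho + 1 by rewrite lerDr.
exists ((rho + 1) ^+ j0); first by rewrite exprn_ge0 // addr_ge0.
have key k : nbinom_bound k rho <= (rho + 1) ^+ minn k j0 * 2 ^+ k.
  elim: k => [|k IH]; first by rewrite /nbinom_bound big_ord0 min0n !expr0 mulr1.
  rewrite /nbinom_bound big_ord_recr /=.
  have k0 : 0 < k.+1%:R :> R by [].
  apply: le_trans (ler_wpM2r _ IH) _; first by rewrite divr_ge0 ?addr_ge0.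
  rewrite exprS [2 * _]mulrC !mulrA -mulrA mulrAC.
  rewrite [leRHS]mulrAC ler_wpM2r ?exprn_ge0 //.
  have [kj|jk] := ltnP k j0.
    rewrite (minn_idPl kj) exprSr.
    rewrite -[leRHS]mulrA ler_wpM2l ?exprn_ge0 ?addr_ge0 //.
    rewrite ler_pdivrMr // -natr1.
    have := ler0n R k; nra.
  rewrite (minn_idPr (leqW jk)) ler_wpM2l ?exprn_ge0 ?addr_ge0 //.
  rewrite ler_pdivrMr //.
  have : j0%:R <= k%:R :> R by rewrite ler_nat.
  rewrite -natr1; lra.
move=> k; apply: le_trans (key k) _.
by rewrite ler_wpM2r ?exprn_ge0 // ler_weXn2l // geq_minr.
Qed.

Lemma sum_half (K : R) n : 0 <= K -> \sum_(k < n) K * (1 / 2) ^+ k <= 2 * K.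
Proof.
move=> K0; rewrite -mulr_sumr mulrC ler_wpM2r //.
have := subrX1 (1 / 2 : R) n; have : 0 <= (1 / 2 : R) ^+ n by rewrite exprn_ge0.
lra.
Qed.

Lemma power_series_of_coef0 (r M : R) (c : nat -> C) : 0 < r ->
  sum_bounded (fun k => cabs (c k) * r ^+ k) M ->
  power_series (fun s => limn (series (fun n => c n * s ^+ n) : nat -> C)) 0 r M c.
Proof.
move=> r0 cM; rewrite (_ : (fun s => _) =
  (fun s => limn (series (fun n => c n * (s - 0) ^+ n) : nat -> C))).
  exact: power_series_of_coef.
by apply/funext => s; rewrite subr0.
Qed.

(** At n = 0 the division by zero returns 0, which is the right constant term for log(1 + x). *)
Definition log1p_coef (n : nat) : C := - (-1) ^+ n / n%:R.

Definition log1p_series x : C := limn (series (fun n => log1p_coef n * x ^+ n) : nat -> C).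

Lemma cabs_log1p_coef n : cabs (log1p_coef n) <= 1.
Proof.
rewrite /log1p_coef cabsM cabsN cabsX cabsN cabs1 expr1n mul1r cabsV cabs_nat.
by case: n => [|n]; rewrite ?invr0 // invf_le1 // ler1n.
Qed.

Lemma log1p_power_series :
  power_series log1p_series 0 (1 / 2) 2 log1p_coef.
Proof.
have h : sum_bounded (fun k => cabs (log1p_coef k) * (1 / 2) ^+ k) 2.
  move=> n; rewrite -[leRHS]mulr1; apply: le_trans (sum_half n ler01).
  by apply: ler_sum => i _; rewrite ler_wpM2r ?exprn_ge0 ?cabs_log1p_coef.
by apply: power_series_of_coef0 h; rewrite divr_gt0.
Qed.

(** The bound 1 lies below pi, so the series takes values in the strip on which [clog] inverts
    [cexp]. *)
Lemma log1p_series_bound x : cabs x <= 1 / 4 -> cabs (log1p_series x) <= 1.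
Proof.
move=> x4; have := @power_series_taylor _ _ _ _ _ _ 1 x log1p_power_series.
rewrite subr0 big_ord1 expr0 mulr1 /log1p_coef /= invr0 mulr0 subr0 => h.
apply: le_trans (h _) _; first lra.
by rewrite expr1; lra.
Qed.

Lemma power_series_unique_value f g a (r r' M M' : R) c :
  power_series f a r M c -> power_series g a r' M' c ->
  forall s : C, cabs (s - a) <= r -> cabs (s - a) <= r' -> f s = g s.
Proof.
move=> [_ _ hf] [_ _ hg] s h h'; exact: (cvg_seq_unique (hf s h) (hg s h')).
Qed.

(** The derivative has coefficients (-1)^n, and multiplication by 1 + x makes them cancel in
    consecutive pairs. The bound 1 / 4 is the radius 1 / 2 halved by differentiation. *)
Lemma log1p_series_derivative x : cabs x <= 1 / 4 -> (1 + x) * derive1 log1p_series x = 1.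
Proof.
move=> x4; have := power_series_derive log1p_power_series.
move=> /(power_series_mul_linear 1) h.
have r1 : 0 < 1 / 2 / 2 :> R by [].
have e : (fun n => n.+1%:R * log1p_coef n.+1 * (0 + 1) +
    match n with 0%N => 0 | m.+1 => m.+1%:R * log1p_coef m.+1 end) =
    (fun n => if n is 0 then 1 else 0).
  apply/funext => n; rewrite add0r mulr1 /log1p_coef.
  have q m : m.+1%:R * (- (-1) ^+ m.+1 / m.+1%:R) = (-1) ^+ m :> C.
    by rewrite mulrC divfK ?pnatr_eq0 // exprS mulN1r opprK.
  case: n => [|n]; first by rewrite q expr0 addr0.
  by rewrite !q exprS mulN1r addNr.
rewrite e in h.
have := power_series_unique_value h (power_series_cst 1 0 r1).
move=> /(_ x); rewrite subr0 => H; rewrite addrC; apply: H; lra.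
Qed.

(** Since the coefficients are at most D 2^k, radius 1 / 4 leaves a geometric series of ratio 1 / 2.
    Differentiation halves this radius to 1 / 8, the origin of the condition 8 |z| < lambda further
    on. *)
Lemma nbinom_power_series s : exists M, power_series
  (fun x => limn (series (fun k => nbinom k s * x ^+ k) : nat -> C)) 0 (1 / 4) M
  (fun k => nbinom k s).
Proof.
have [D D0 hD] := nbinom_bound_geometric (cabs_ge0 s).
have h : sum_bounded (fun k => cabs (nbinom k s) * (1 / 4) ^+ k) (2 * D).
  move=> n; apply: le_trans (sum_half n D0); apply: ler_sum => i _.
  apply: le_trans (ler_wpM2r _ (cabs_nbinom i (lexx _))) _; first by rewrite exprn_ge0.
  apply: le_trans (ler_wpM2r _ (hD i)) _; first by rewrite exprn_ge0.
  rewrite -mulrA ler_wpM2l // -exprMn.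
  by rewrite (_ : 2 * (1 / 4) = 1 / 2 :> R) //; field.
by exists (2 * D); apply: power_series_of_coef0 h; rewrite divr_gt0.
Qed.

(** Coefficientwise this says (n + 1) b_(n + 1) + n b_n = - s b_n, the recursion that defines the
    binomial coefficients. *)
Lemma nbinom_series_derivative s x : cabs x <= 1 / 8 ->
  let u x := limn (series (fun k => nbinom k s * x ^+ k) : nat -> C) in
  (1 + x) * derive1 u x = - s * u x.
Proof.
move=> x4 u; have [M hu] := nbinom_power_series s.
have := power_series_mul_linear 1 (power_series_derive hu).
have e : (fun n => n.+1%:R * nbinom n.+1 s * (0 + 1) +
    match n with 0%N => 0 | m.+1 => m.+1%:R * nbinom m.+1 s end) =
    (fun n => - s * nbinom n s).
  apply/funext => n; rewrite add0r mulr1.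
  have q m : m.+1%:R * nbinom m.+1 s = - (s + m%:R) * nbinom m s.
    by rewrite nbinomS mulrCA [_ * (_ / _)]mulrC divfK ?pnatr_eq0 // mulrC.
  by case: n => [|n]; rewrite q; [rewrite !addr0|ring].
rewrite e => h; have := power_series_unique_value h (power_seriesZ (- s) hu).
move=> /(_ x); rewrite subr0 => H; rewrite addrC; apply: H; lra.
Qed.

(* Both sides solve (1 + x) y' = - s y, y(0) = 1. *)
Lemma nbinom_series_exp s x : cabs x < 1 / 8 ->
  limn (series (fun k => nbinom k s * x ^+ k) : nat -> C) = cexp (- s * log1p_series x).
Proof.
move=> x8; pose u x : C := limn (series (fun k => nbinom k s * x ^+ k) : nat -> C).
have [M hu] := nbinom_power_series s.
(* One side times the inverse of the other: its derivative vanishes, so it keeps its value 1 at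
   0. *)
pose h x := u x * cexp (s * log1p_series x).
have cexp' z : has_derivative (@cexp R) z (cexp z).
  have := power_series_has_derivative (power_series_cexp 1 z ltr01).
  have -> : 1`!%:R = 1 :> C by [].
  rewrite expr1 invr1 !mulr1 mul1r; congr (has_derivative _ _ _).
  by apply/funext => w; rewrite mul1r.
have hd b : cabs b < 1 / 8 -> has_derivative h b 0.
  move=> b8; have b0 : cabs (b - 0) < 1 / 4 by rewrite subr0; lra.
  have b1 : cabs (b - 0) < 1 / 2 by rewrite subr0; lra.
  have b4 : cabs b <= 1 / 4 by lra.
  have du := power_series_derivative_at hu b0.
  have dl := power_series_derivative_at log1p_power_series b1.
  have := has_derivativeM du (has_derivative_comp (cexp' _) (has_derivativeZ s dl)).
  rewrite (_ : u b * _ + _ = 0) //.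
  have b1n : 1 + b != 0.
    apply/eqP => e; have : cabs (1 : C) <= cabs (1 + b) + cabs b.
      by rewrite -[cabs b]cabsN -{1}(addrK b 1); exact: ler_cabsD.
    rewrite e cabs0 cabs1; lra.
  have key (B U E S L U' : C) : 1 + B != 0 -> (1 + B) * L = 1 -> (1 + B) * U' = - S * U ->
      U * (E * (S * L)) + U' * E = 0.
    move=> nB e1 e2; apply: (mulfI nB); rewrite mulr0.
    transitivity (E * (U * S * ((1 + B) * L) + (1 + B) * U')); first by ring.
    by rewrite e1 e2; ring.
  exact: key b1n (log1p_series_derivative b4) (nbinom_series_derivative s (ltW b8)).
have := constant_of_derivative0 hd x8; rewrite /h.
have -> : u 0 = 1 by rewrite /u (power_series_center hu) nbinom0.
have -> : log1p_series 0 = 0.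
  by rewrite (power_series_center log1p_power_series) /log1p_coef invr0 mulr0.
rewrite mulr0 cexp0 mulr1 => H.
by apply: (mulIf (cexp_neq0 (s * log1p_series x))); rewrite H -cexpD mulNr addNr cexp0.
Qed.

(** The case s = -1 of [nbinom_series_exp]: every later coefficient contains the factor j = 1 of
    [nbinom], which is 0, so the series stops after 1 + x. *)
Lemma cexp_log1p_series x : cabs x < 1 / 8 -> cexp (log1p_series x) = 1 + x.
Proof.
move=> x8; have := nbinom_series_exp (-1) x8; rewrite opprK mul1r => <-.
apply: (@cvg_lim _ (@norm_hausdorff _ _)).
have -> : 1 + x = \sum_(k < 2) nbinom k (-1) * x ^+ k.
  rewrite !big_ord_recl big_ord0 /= nbinom0 !expr0 nbinomS nbinom0 /bump /=.
  by rewrite expr1; field.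
apply: cvg_series_finite => n.
suff -> : nbinom (2 + n) (-1) = 0 by rewrite mul0r.
rewrite /nbinom (bigD1 (Ordinal (isT : (1 < 2 + n)%N))) //=.
by rewrite addNr oppr0 !mul0r.
Qed.

Lemma clog_log1p_series x : cabs x < 1 / 8 -> clog (1 + x) = log1p_series x.
Proof.
move=> x8; rewrite -(cexp_log1p_series x8) clog_cexp //.
apply: le_lt_trans (ler_Im_cabs _) _; apply: le_lt_trans (log1p_series_bound _) _.
  lra.
by have := pi_ge2 R; lra.
Qed.

Lemma nbinom_series s x : cabs x < 1 / 8 ->
  series (fun k => nbinom k s * x ^+ k) @ \oo --> cpow (1 + x) (- s).
Proof.
move=> x8; rewrite /cpow clog_log1p_series // -nbinom_series_exp //.
have [M [_ _ /(_ x)]] := nbinom_power_series s.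
rewrite subr0 => h.
have : cabs x <= 1 / 4 by lra.
by move=> x4; exact: h.
Qed.

End BinomialSeries.

(** * Meromorphic functions *)

Section WeaklyMeromorphic.
Variable R : realType.
Local Notation C := (cplx R).
Implicit Types (f g h : C -> C) (a b s z : C).

Lemma power_series_cvg f a (r M : R) c : power_series f a r M c -> f @ a --> f a.
Proof. by move=> hf; apply/cvg_at_cabs => e e0; exact: power_series_continuous hf e0. Qed.

Lemma analytic_cvg f a : analytic_at f a -> f @ a --> f a.
Proof. by move=> /analytic_series[r [M [c /power_series_cvg]]]. Qed.

Lemma analytic_near f a : analytic_at f a -> \forall z \near a, analytic_at f z.
Proof.
move=> /analytic_series[r [M [c hf]]]; have [r0 _ _] := hf.
apply/nbhs_cabs; exists r => // z zr; exact: power_series_analytic_near hf zr.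
Qed.

Lemma analytic_eq_near f g a : (\forall z \near a, f z = g z) ->
  analytic_at f a -> analytic_at g a.
Proof.
move=> fg [c fc]; exists c; near=> z.
have <- : f z = g z by near: z.
by near: z.
Unshelve. all: by end_near. Qed.

Lemma analytic_cst (k : C) a : analytic_at (fun=> k) a.
Proof. exact: power_series_analytic (power_series_cst k a ltr01). Qed.

Lemma analyticZ (k : C) f a : analytic_at f a -> analytic_at (fun z => k * f z) a.
Proof.
by move=> /analytic_series[r [M [c /(power_seriesZ k) /power_series_analytic]]].
Qed.

Lemma analyticD f g a : analytic_at f a -> analytic_at g a ->
  analytic_at (fun z => f z + g z) a.
Proof.
move=> /analytic_series[r [M [c hf]]] /analytic_series[r' [M' [c' hg]]].
have [r0 _ _] := hf; have [r0' _ _] := hg.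
have m0 : 0 < Num.min r r' by rewrite lt_min r0.
have [mr mr'] : Num.min r r' <= r /\ Num.min r r' <= r'.
  by rewrite !ge_min !lexx orbT.
have hf' := power_series_shrink m0 mr hf.
have hg' := power_series_shrink m0 mr' hg.
exact: power_series_analytic (power_seriesD hf' hg').
Qed.

Lemma analytic_mul_linear f a (b : C) : analytic_at f a ->
  analytic_at (fun z => (z + b) * f z) a.
Proof.
by move=> /analytic_series[r [M [c /(power_series_mul_linear b) /power_series_analytic]]].
Qed.

Lemma analytic_mul_exp f a (b : C) n : analytic_at f a ->
  analytic_at (fun z => (z + b) ^+ n * f z) a.
Proof.
move=> hf; elim: n => [|n /(analytic_mul_linear b)].
  by under eq_fun do rewrite expr0 mul1r.
by under eq_fun do rewrite mulrA -exprS.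
Qed.

Lemma analytic_shift f a (b : C) : analytic_at f (a + b) -> analytic_at (fun z => f (z + b)) a.
Proof.
by move=> /analytic_series[r [M [c /power_series_shift /power_series_analytic]]].
Qed.

Lemma cvg_punctured_eq f g a (l m : C) : f @ a --> l -> g @ a --> m ->
  (\forall z \near a^', f z = g z) -> l = m.
Proof.
move=> /cvg_at_cabs fl /cvg_at_cabs gm /dnbhs_cabs[r r0 h].
apply/eqP; apply/contraT => lm.
have e0 : 0 < cabs (l - m) / 2 by rewrite divr_gt0 // cabs_gt0 subr_eq0.
have [r1 r10 h1] := fl _ e0; have [r2 r20 h2] := gm _ e0.
pose d := Num.min r (Num.min r1 r2) / 2.
have m0 : 0 < Num.min r (Num.min r1 r2) by rewrite !lt_min r0 r10.
have [d0 dm] : 0 < d /\ d < Num.min r (Num.min r1 r2) by rewrite /d; split; lra.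
move: dm; rewrite !lt_min => /and3P[dr dr1 dr2].
have zd : cabs (a + d%:C - a) = d by rewrite addrC addKr cabs_real gtr0_norm.
have := h (a + d%:C); rewrite zd => /(_ _ dr) fg.
have {}fg : f (a + d%:C) = g (a + d%:C).
  by apply: fg; rewrite -subr_eq0 -cabs_eq0 zd gt_eqF.
have := h1 (a + d%:C); have := h2 (a + d%:C); rewrite zd fg => /(_ dr2) k2 /(_ dr1) k1.
have := ler_cabsD (l - g (a + d%:C)) (g (a + d%:C) - m).
rewrite addrA subrK cabs_distC; lra.
Qed.

(** Neither the value at a nor the exact order of the pole is prescribed. This makes the class
    closed under sums and linear factors; [weakly_meromorphic_dichotomy] recovers the exact
    order. *)
Definition weakly_meromorphic_at f a := exists n g,
  analytic_at g a /\ \forall z \near a^', f z = g z / (z - a) ^+ n.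

Lemma weakly_meromorphic_eq f g a : (\forall z \near a^', f z = g z) ->
  weakly_meromorphic_at f a -> weakly_meromorphic_at g a.
Proof.
move=> fg [n [h [hh e]]]; exists n, h; split => //.
by near=> z; rewrite -(_ : f z = g z); near: z.
Unshelve. all: by end_near. Qed.

Lemma analytic_weakly_meromorphic f a : analytic_at f a -> weakly_meromorphic_at f a.
Proof.
move=> hf; exists 0%N, f; split => //.
by apply/dnbhs_cabs; exists 1 => // z _ _; rewrite expr0 divr1.
Qed.

Lemma meromorphic_weakly f a : meromorphic f -> weakly_meromorphic_at f a.
Proof.
move=> /(_ a)[/analytic_weakly_meromorphic //|[n [_ [g [ga _ e]]]]].
by exists n, g.
Qed.

Lemma weakly_meromorphicZ (k : C) f a : weakly_meromorphic_at f a ->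
  weakly_meromorphic_at (fun z => k * f z) a.
Proof.
move=> [n [h [hh /dnbhs_cabs[r r0 e]]]]; exists n, (fun z => k * h z); split.
  exact: analyticZ.
by apply/dnbhs_cabs; exists r => // z za zr; rewrite e // mulrA.
Qed.

Lemma weakly_meromorphic_mul_linear f a (b : C) : weakly_meromorphic_at f a ->
  weakly_meromorphic_at (fun z => (z + b) * f z) a.
Proof.
move=> [n [h [hh /dnbhs_cabs[r r0 e]]]]; exists n, (fun z => (z + b) * h z); split.
  exact: analytic_mul_linear.
by apply/dnbhs_cabs; exists r => // z za zr; rewrite e // mulrA.
Qed.

Lemma weakly_meromorphicD f g a : weakly_meromorphic_at f a -> weakly_meromorphic_at g a ->
  weakly_meromorphic_at (fun z => f z + g z) a.
Proof.
move=> [n [h [hh /dnbhs_cabs[r r0 e]]]] [n' [h' [hh' /dnbhs_cabs[r' r0' e']]]].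
exists (n + n')%N, (fun z => (z + - a) ^+ n' * h z + (z + - a) ^+ n * h' z); split.
  by apply: analyticD; exact: analytic_mul_exp.
apply/dnbhs_cabs; exists (Num.min r r'); first by rewrite lt_min r0.
move=> z za; rewrite lt_min => /andP[zr zr']; rewrite e // e' //.
have za0 : z - a != 0 by rewrite subr_eq0.
by rewrite exprD; field; rewrite !expf_neq0.
Qed.

Lemma weakly_meromorphic_sum n (F : nat -> C -> C) a :
  (forall k, (k < n)%N -> weakly_meromorphic_at (F k) a) ->
  weakly_meromorphic_at (fun z => \sum_(k < n) F k z) a.
Proof.
elim: n => [_|n IH h].
  by under eq_fun do rewrite big_ord0; exact: analytic_weakly_meromorphic (analytic_cst 0 a).
under eq_fun do rewrite big_ord_recr.
by apply: weakly_meromorphicD; [apply: IH => k kn; apply: h; exact: leqW|exact: h].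
Qed.

Lemma weakly_meromorphic_shift f a (b : C) : weakly_meromorphic_at f (a + b) ->
  weakly_meromorphic_at (fun z => f (z + b)) a.
Proof.
move=> [n [h [hh /dnbhs_cabs[r r0 e]]]]; exists n, (fun z => h (z + b)); split.
  exact: analytic_shift.
apply/dnbhs_cabs; exists r => // z za zr.
have E : z + b - (a + b) = z - a by ring.
by rewrite e ?E // (inj_eq (addIr b)).
Qed.

Lemma weakly_meromorphic_near_cvg f a : weakly_meromorphic_at f a ->
  \forall z \near a^', f @ z --> f z.
Proof.
move=> [n [h [/analytic_near /nbhs_cabs[r' r0' hh] /dnbhs_cabs[r r0 e]]]].
apply/dnbhs_cabs; exists (Num.min r r'); first by rewrite lt_min r0.
move=> z za; rewrite lt_min => /andP[zr zr'].
have hz := analytic_cvg (hh z zr').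
have za0 : z - a != 0 by rewrite subr_eq0.
have : (fun w => h w / (w - a) ^+ n) @ z --> h z / (z - a) ^+ n.
  apply: (cvgM hz); apply: cvgV; first exact: expf_neq0.
  have := analytic_cvg (analytic_mul_exp (- a) n (analytic_cst 1 z)).
  by under eq_fun do rewrite mulr1; rewrite mulr1.
rewrite -(e z za zr) => /cvg_at_cabs H; apply/cvg_at_cabs => eps /H[d d0 Hd].
(* The second radius keeps w away from a, the third keeps it in the disc where f is given by the
   quotient. *)
exists (Num.min d (Num.min (cabs (z - a)) (r - cabs (z - a)))).
  by rewrite !lt_min d0 subr_gt0 zr cabs_gt0 za0.
move=> w; rewrite !lt_min => /and3P[w1 w2 w3].
have wa : w != a by apply/eqP => wa; move: w2; rewrite wa cabs_distC ltxx.
have wr : cabs (w - a) < r.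
  have := ler_cabsD (w - z) (z - a); rewrite addrA subrK => e3.
  by apply: le_lt_trans e3 _; rewrite -ltrBrDr.
by have := Hd w w1; rewrite -(e w wa wr).
Qed.

(** The order m of vanishing of the numerator is compared with the exponent n of the denominator: n
    <= m gives a removable singularity, m < n a pole of order n - m. *)
Lemma weakly_meromorphic_dichotomy f a : weakly_meromorphic_at f a ->
  (exists h, analytic_at h a /\ \forall z \near a^', f z = h z) \/ exists n, pole_at f a n.
Proof.
move=> [n [h [hh /dnbhs_cabs[r r0 e]]]].
have [/nbhs_cabs[r' r0' h0]|[m [g [ga g0 /nbhs_cabs[r' r0' hg]]]]] := analytic_factor hh.
  left; exists (fun=> 0); split; first exact: analytic_cst.
  apply/dnbhs_cabs; exists (Num.min r r'); first by rewrite lt_min r0.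
  by move=> z za; rewrite lt_min => /andP[zr zr']; rewrite e // h0 // mul0r.
have [nm|mn] := leqP n m.
  left; exists (fun z => (z + - a) ^+ (m - n) * g z); split; first exact: analytic_mul_exp.
  apply/dnbhs_cabs; exists (Num.min r r'); first by rewrite lt_min r0.
  move=> z za; rewrite lt_min => /andP[zr zr']; rewrite e // hg //.
  have za0 : z - a != 0 by rewrite subr_eq0.
  by rewrite -{1}(subnK nm) exprD; field; rewrite expf_neq0.
right; exists (n - m)%N; split; first by rewrite subn_gt0.
exists g; split=> //.
apply/dnbhs_cabs; exists (Num.min r r'); first by rewrite lt_min r0.
move=> z za; rewrite lt_min => /andP[zr zr']; rewrite e // hg //.
have za0 : z - a != 0 by rewrite subr_eq0.
by rewrite -{1}(subnK (ltnW mn)) exprD; field; rewrite !expf_neq0.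
Qed.

(* [meromorphic] constrains the value of a function at its removable
   singularities, hence the repair. *)
Lemma meromorphic_regularization f : (forall a, weakly_meromorphic_at f a) ->
  exists F, meromorphic F /\ forall a, f @ a --> f a -> F a = f a.
Proof.
move=> hf.
pose P a h := analytic_at h a /\ \forall z \near a^', f z = h z.
(* The repaired value is that of an analytic extension, when there is one. All extensions agree at a
   by continuity, so where f is already continuous its value is kept. *)
pose F a := if pselect (exists h, P a h) is left e then sval (cid e) a else f a.
have Ff a : f @ a --> f a -> F a = f a.
  rewrite /F; case: pselect => // e; case: cid => h [ha fh] /= fa.
  by apply/esym/(cvg_punctured_eq fa (analytic_cvg ha)).
have Fn a : \forall z \near a^', F z = f z.
  have /dnbhs_cabs[r r0 H] := weakly_meromorphic_near_cvg (hf a).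
  by apply/dnbhs_cabs; exists r => // z za zr; apply: Ff; exact: H.
exists F; split=> // a; have /dnbhs_cabs[r r0 Fa] := Fn a.
have [e|[n [n0 [g [ga g0 /dnbhs_cabs[r' r0' fg]]]]]] := weakly_meromorphic_dichotomy (hf a).
  left; have [h [ha [/dnbhs_cabs[r' r0' fh] Fh]]] :
    exists h, analytic_at h a /\ ((\forall z \near a^', f z = h z) /\ F a = h a).
    rewrite /F; case: pselect => [{}e|]; last by move=> /(_ e).
    by case: cid => h [ha fh]; exists h.
  apply: analytic_eq_near ha; apply/nbhs_cabs; exists (Num.min r r').
    by rewrite lt_min r0.
  move=> z; rewrite lt_min => /andP[zr zr'].
  have [->//|za] := eqVneq z a.
  by rewrite Fa // fh.
right; exists n; split=> //; exists g; split=> //.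
apply/dnbhs_cabs; exists (Num.min r r'); first by rewrite lt_min r0.
by move=> z za; rewrite lt_min => /andP[zr zr']; rewrite Fa // fg.
Qed.

(** A pole is impossible: its numerator g would equal (z - a)^n h off a, hence vanish at a. In the
    analytic case the values at a agree by continuity. *)
Lemma removable_singularity f h a : analytic_at f a \/ (exists n, pole_at f a n) ->
  analytic_at h a -> (\forall z \near a^', f z = h z) -> \forall z \near a, f z = h z.
Proof.
move=> + ha /dnbhs_cabs[r r0 fh]; case=> [fa|[n [n0 [g [ga g0 /dnbhs_cabs[r' r0' fg]]]]]].
  have E : f a = h a.
    apply: (cvg_punctured_eq (analytic_cvg fa) (analytic_cvg ha)).
    by apply/dnbhs_cabs; exists r.
  apply/nbhs_cabs; exists r => // z zr; have [->//|za] := eqVneq z a; exact: fh.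
have H := analytic_mul_exp (- a) n ha.
case/eqP: g0; transitivity ((a + - a) ^+ n * h a); last first.
  by rewrite subrr expr0n gtn_eqF // mul0r.
apply: (cvg_punctured_eq (analytic_cvg ga) (analytic_cvg H)).
apply/dnbhs_cabs; exists (Num.min r r'); first by rewrite lt_min r0.
move=> z za; rewrite lt_min => /andP[zr zr']; rewrite -fh // fg //.
by rewrite mulrC divfK // expf_neq0 // subr_eq0.
Qed.

Lemma cabs_ofreal (t u : R) : cabs (t%:C - u%:C : C) = `|t - u|.
Proof. by rewrite -rmorphB cabs_real. Qed.

(* At the supremum of the t near which f and g differ, isolatedness of zeros
   excludes both agreement and disagreement. *)
Lemma meromorphic_identity f g (t0 sigma : R) :
  (forall t : R, t0 < t -> weakly_meromorphic_at f t%:C /\ weakly_meromorphic_at g t%:C) ->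
  (forall s, sigma < Re s -> f s = g s) ->
  forall t : R, t0 < t -> \forall z \near (t%:C : C)^', f z = g z.
Proof.
move=> hw fg t1 t01.
pose P (t : R) := \forall z \near (t%:C : C)^', f z = g z.
(* Zeros of f - g are isolated unless it vanishes near t, so failure to agree near t means
   disagreement at every point of a punctured disc. *)
have dich t : t0 < t -> ~ P t -> \forall z \near (t%:C : C)^', f z != g z.
  move=> /hw[wf wg] nP.
  have [n [h [hh /dnbhs_cabs[r r0 e]]]] := weakly_meromorphicD wf (weakly_meromorphicZ (-1) wg).
  have [/nbhs_cabs[r' r0' h0]|[m [k [ka k0 /nbhs_cabs[r' r0' hk]]]]] := analytic_factor hh.
    case: nP; apply/dnbhs_cabs; exists (Num.min r r'); first by rewrite lt_min r0.
    move=> z za; rewrite lt_min => /andP[zr zr']; apply/eqP; rewrite -subr_eq0.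
    by rewrite -mulN1r e // h0 // mul0r.
  have /cvg_at_cabs /(_ (cabs (k t%:C))) := analytic_cvg ka.
  rewrite cabs_gt0 => /(_ k0)[r2 r20 k2].
  apply/dnbhs_cabs; exists (Num.min r (Num.min r' r2)); first by rewrite !lt_min r0 r0'.
  move=> z za; rewrite !lt_min => /and3P[zr zr' zr2]; rewrite -subr_eq0.
  rewrite -mulN1r e // hk // !mulf_neq0 ?invr_neq0 ?expf_neq0 ?subr_eq0 //.
  by apply/eqP => kz; have := k2 z zr2; rewrite kz sub0r cabsN ltxx.
apply: contrapT => nP1.
pose S := [set t : R | t1 <= t /\ ~ P t].
have Ssig t : S t -> t <= sigma.
  move=> [_ nP]; rewrite leNgt; apply/negP => st; apply: nP.
  apply/dnbhs_cabs; exists (t - sigma); rewrite ?subr_gt0 // => z _ zr; apply: fg.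
  have := ler_Re_cabs (z - t%:C); rewrite Re_add Re_opp /= ler_norml; lra.
have S1 : S t1 by split.
have hs : has_sup S by split; [exists t1|exists sigma => t /Ssig].
have us := sup_upper_bound hs; have s1 : t1 <= sup S by exact: us.
have s0 : t0 < sup S by exact: lt_le_trans s1.
(* If f and g agree around the supremum, they also agree around all points of S close to it, which
   contradicts adherence. *)
have [Ps|nPs] := pselect (P (sup S)).
  have /dnbhs_cabs[r r0 hr] := Ps.
  have [t [tt1 nPt] tr] := sup_adherent r0 hs.
  have ts : t <= sup S by apply: us; split.
  have tns : t != sup S by apply/eqP => E; apply: nPt; rewrite E.
  have tlt : t < sup S by rewrite lt_neqAle tns.
  have st0 : 0 <= sup S - t by rewrite subr_ge0.
  apply: nPt; apply/dnbhs_cabs; exists (Num.min (sup S - t) (r - (sup S - t))).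
    by rewrite lt_min subr_gt0 tlt; lra.
  move=> z zt; rewrite lt_min => /andP[z1 z2]; apply: hr.
    have e1 : cabs ((sup S)%:C - t%:C : C) = sup S - t.
      by rewrite cabs_ofreal (ger0_norm st0).
    by apply/eqP => E; move: z1; rewrite E e1 ltxx.
  have e2 : cabs (t%:C - (sup S)%:C : C) = sup S - t.
    by rewrite cabs_ofreal distrC (ger0_norm st0).
  have := ler_cabsD (z - t%:C) (t%:C - (sup S)%:C).
  rewrite addrA subrK e2 => e3.
  by apply: le_lt_trans e3 _; rewrite -ltrBrDr.
have /dnbhs_cabs[r r0 hr] := dich _ s0 nPs.
(* If they differ throughout a punctured disc of radius r, the point r / 2 to the right of the
   supremum still belongs to S. *)
have r2 : 0 < r / 2 by rewrite divr_gt0.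
suff : S (sup S + r / 2) by move/us; lra.
split; first by lra.
move=> /dnbhs_cabs[r' r0' hr'].
pose d := Num.min r' (r / 2) / 2.
have m0 : 0 < Num.min r' (r / 2) by rewrite lt_min r0'.
have [d0 dm] : 0 < d /\ d < Num.min r' (r / 2) by rewrite /d; split; lra.
move: dm; rewrite lt_min => /andP[dr' dr].
pose t := sup S + r / 2 + d.
have n1 : cabs (t%:C - (sup S)%:C : C) = r / 2 + d.
  have -> : cabs (t%:C - (sup S)%:C : C) = `|r / 2 + d|.
    by rewrite cabs_ofreal; congr (`|_|); rewrite /t; ring.
  by rewrite ger0_norm // addr_ge0 ?ltW.
have n2 : cabs (t%:C - (sup S + r / 2)%:C : C) = d.
  have -> : cabs (t%:C - (sup S + r / 2)%:C : C) = `|d|.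
    by rewrite cabs_ofreal; congr (`|_|); rewrite /t; ring.
  by rewrite ger0_norm // ltW.
have : f t%:C != g t%:C.
  apply: hr; last by rewrite n1; lra.
  by rewrite -subr_eq0 -cabs_eq0 n1 gt_eqF // addr_gt0.
case/eqP; apply: hr'; last by rewrite n2.
by rewrite -subr_eq0 -cabs_eq0 n2 gt_eqF.
Qed.

End WeaklyMeromorphic.

(** * The zeta function of L + z *)

Section PowerSeriesOperations.
Variable R : realType.
Local Notation C := (cplx R).
Implicit Types (f g : C -> C) (a s z : C).

Lemma power_series_fsum n (F : nat -> C -> C) a (r : R) : 0 < r ->
  (forall k, (k < n)%N -> exists M c, power_series (F k) a r M c) ->
  exists M c, power_series (fun s => \sum_(k < n) F k s) a r M c.
Proof.
move=> r0; elim: n => [|n IH] h.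
  exists (cabs (0 : C)), (fun n => if n is 0 then 0 else 0).
  by apply: power_series_eq (power_series_cst 0 a r0) => s _; rewrite big_ord0.
have [k kn|M [c hM]] := IH; first by apply: h; exact: leqW.
have [M' [c' hM']] := h n (ltnSn n).
exists (M + M'), (fun k => c k + c' k).
by apply: power_series_eq (power_seriesD hM hM') => s _; rewrite big_ord_recr.
Qed.

(** The binomial coefficient is multiplied in one linear factor at a time, the factor of index j
    costing at most r + |a| + j in the norm. For k >= 1 it has a simple zero at 0 with derivative
    (-1)^k / k, whence the two coefficients at a = 0. *)
Lemma power_series_nbinom f a (r M : R) c k : power_series f a r M c ->
  exists d, [/\ power_series (fun s => nbinom k s * f s) a r
      (nbinom_bound k (cabs a + r) * M) d,
    a = 0 -> (0 < k)%N -> d 0 = 0 & a = 0 -> (0 < k)%N ->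
    d 1 = (-1) ^+ k / k%:R * c 0].
Proof.
move=> hf; have [r0 _ _] := hf; have M0 := power_series_bound hf.
have rho0 : 0 <= cabs a + r by rewrite addr_ge0 ?cabs_ge0 // ltW.
elim: k => [|k [d [hd d0 d1]]].
  exists c; split; [|by []|by []]; rewrite /nbinom_bound big_ord0 mul1r.
  by apply: power_series_eq hf => s _; rewrite nbinom0 mul1r.
have h := power_seriesZ (- (k.+1%:R)^-1) (power_series_mul_linear k%:R hd).
have k0 : 0 < k.+1%:R :> R by [].
have kC : k.+1%:R != 0 :> C by rewrite pnatr_eq0.
exists (fun n => - (k.+1%:R)^-1 * (d n * (a + k%:R) + (if n is m.+1 then d m else 0))).
split.
- apply: power_series_weaken (power_series_eq _ h); last first.
    by move=> s _; rewrite nbinomS; field.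
  rewrite cabsN cabsV cabs_nat /nbinom_bound big_ord_recr /= -/(nbinom_bound k _).
  set X := nbinom_bound k _.
  have X0 : 0 <= X by exact: nbinom_bound_ge0.
  have -> : X * ((cabs a + r + k%:R) / k.+1%:R) * M =
    k.+1%:R^-1 * ((r + (cabs a + k%:R)) * (X * M)) by ring.
  rewrite ler_wpM2l ?invr_ge0 // ler_wpM2r ?mulr_ge0 // lerD2l.
  by apply: le_trans (ler_cabsD _ _) _; rewrite cabs_nat.
- move=> a0 _; rewrite addr0 a0 add0r.
  have [k00|k1] := posnP k; first by rewrite k00 mulr0 mulr0.
  by rewrite d0 // mul0r mulr0.
- move=> a0 _; rewrite a0 add0r /=.
  have [k00|k1] := posnP k.
    rewrite k00 mulr0 add0r divr1 expr1; congr (_ * _); first by rewrite invr1.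
    have := power_series_center hd; have := power_series_center hf.
    by rewrite k00 nbinom0 mul1r => -> ->.
  rewrite d0 // d1 // addr0 exprS.
  have kk : k%:R != 0 :> C by rewrite pnatr_eq0 -lt0n.
  by rewrite [_ * c 0 * _]mulrAC divfK //; ring.
Qed.

Lemma analytic_nbinom f a k : analytic_at f a -> analytic_at (fun s => nbinom k s * f s) a.
Proof.
move=> /analytic_series[r [M [c /(power_series_nbinom k)[d [/power_series_analytic h _ _]]]]].
exact: h.
Qed.

Lemma derive1_nbinom f k : analytic_at f 0 -> (0 < k)%N ->
  derive1 (fun s => nbinom k s * f s) 0 = (-1) ^+ k / k%:R * f 0.
Proof.
move=> /analytic_series[r [M [c hf]]] k0.
have [d [hd _ d1]] := power_series_nbinom k hf.
by rewrite (power_series_derive1 hd) (d1 (erefl _) k0) (power_series_center hf).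
Qed.

Lemma derive1_eq_near f g a : analytic_at g a -> (\forall s \near a, f s = g s) ->
  derive1 f a = derive1 g a.
Proof.
move=> /analytic_series[r [M [c hg]]] /nbhs_cabs[r' r'0 fg].
have [r0 _ _] := hg.
have [m0 m1 m2] : [/\ 0 < Num.min r r' / 2, Num.min r r' / 2 <= r & Num.min r r' / 2 < r'].
  have : 0 < Num.min r r' by rewrite lt_min r0.
  have [|] := leP r r' => ? ?; split; lra.
have h := power_series_shrink m0 m1 hg.
rewrite (power_series_derive1 h); apply: (power_series_derive1 (power_series_eq _ h)).
by move=> s sr; rewrite fg //; exact: le_lt_trans sr _.
Qed.

Lemma derive1D_analytic f g a : analytic_at f a -> analytic_at g a ->
  derive1 (fun s => f s + g s) a = derive1 f a + derive1 g a.
Proof.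
move=> /analytic_series[r [M [c hf]]] /analytic_series[r' [M' [c' hg]]].
have [r0 _ _] := hf; have [r0' _ _] := hg.
have m0 : 0 < Num.min r r' by rewrite lt_min r0.
have [mr mr'] : Num.min r r' <= r /\ Num.min r r' <= r'.
  by rewrite !ge_min !lexx orbT.
have hf' := power_series_shrink m0 mr hf.
have hg' := power_series_shrink m0 mr' hg.
by rewrite (power_series_derive1 (power_seriesD hf' hg')) (power_series_derive1 hf')
  (power_series_derive1 hg').
Qed.

Lemma derive1Z_analytic (k : C) f a : analytic_at f a ->
  derive1 (fun s => k * f s) a = k * derive1 f a.
Proof.
move=> /analytic_series[r [M [c hf]]].
by rewrite (power_series_derive1 (power_seriesZ k hf)) (power_series_derive1 hf).
Qed.

Lemma analytic_fsum n (F : nat -> C -> C) a :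
  (forall k, (k < n)%N -> analytic_at (F k) a) ->
  analytic_at (fun s => \sum_(k < n) F k s) a /\
  derive1 (fun s => \sum_(k < n) F k s) a = \sum_(k < n) derive1 (F k) a.
Proof.
elim: n => [_|n IH h].
  rewrite big_ord0; under eq_fun do rewrite big_ord0; split; first exact: analytic_cst.
  by rewrite (power_series_derive1 (power_series_cst 0 a ltr01)).
have [k kn|h1 h2] := IH; first by apply: h; exact: leqW.
rewrite big_ord_recr /= -h2; under eq_fun do rewrite big_ord_recr /=; split.
  exact: (analyticD h1 (h n (ltnSn n))).
exact: (derive1D_analytic h1 (h n (ltnSn n))).
Qed.

End PowerSeriesOperations.

(** * The binomial remainder at a single eigenvalue *)

Section BinomialRemainder.
Variable R : realType.
Local Notation C := (cplx R).
Implicit Types (a s z : C) (x : R).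

(** For x > 0 this is x^(-s): the sign is built in. *)
Definition rpow (x : R) s : C := cexp (- s * (ln x)%:C).

Definition remainder z K (x : R) s : C :=
  cpow (x%:C + z) (- s) - \sum_(k < K) (z / x%:C) ^+ k * (nbinom k s * rpow x s).

(** For x >= 1 the norm bound is x^(r - Re a), the size of x^(-s) at the leftmost point of the
    disc. *)
Lemma rpow_power_series x a (r : R) : 0 < r ->
  power_series (rpow x) a r (expR (- Re a * ln x) * expR (`|ln x| * r))
    (fun n => rpow x a * ((- ln x)%:C ^+ n / n`!%:R)).
Proof.
move=> r0; have := power_series_cexp (- ln x)%:C a r0.
rewrite cabs_cexp cabs_real normrN Re_mul /= mul0r subr0.
have -> : - ln x * Re a = - Re a * ln x by rewrite mulNr mulNr mulrC.
have -> : cexp ((- ln x)%:C * a) = rpow x a.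
  by rewrite /rpow rmorphN /= mulNr mulNr mulrC.
apply: power_series_eq => s _; rewrite /rpow rmorphN /= mulNr mulNr mulrC //.
Qed.

Lemma rpow0 x : rpow x 0 = 1.
Proof. by rewrite /rpow oppr0 mul0r cexp0. Qed.

Lemma rpowDn x s k : 0 < x -> rpow x (s + k%:R) = rpow x s / x%:C ^+ k.
Proof.
move=> x0; rewrite /rpow opprD mulrDl cexpD; congr (_ * _).
rewrite mulNr cexpN; congr (_^-1).
rewrite -(rmorph_nat (real_complex R)) -rmorphM cexp_real -rmorphXn expRM_natl lnK //.
Qed.

Lemma rpow_cpow x s : 0 < x -> cpow (x%:C) (- s) = rpow x s.
Proof. by move=> x0; rewrite /cpow clog_real. Qed.

Lemma cpow_rpow x z s : 0 < x -> x%:C + z != 0 ->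
  cpow (x%:C + z) (- s) = rpow x s * cpow (1 + z / x%:C) (- s).
Proof.
move=> x0 xz.
have xC : x%:C != 0 :> C by rewrite -cabs_gt0 cabs_real gtr0_norm.
have e : x%:C + z = x%:C * (1 + z / x%:C) by field.
rewrite /cpow e clog_pmul //; first by rewrite mulrDr cexpD.
by apply: contra xz => /eqP h; rewrite e h mulr0.
Qed.

Lemma remainder_series z K x s : 0 < x -> 8 * cabs z < x ->
  series (fun j => (z / x%:C) ^+ (K + j) * (nbinom (K + j) s * rpow x s)) @ \oo -->
  remainder z K x s.
Proof.
move=> x0 zx.
have xC : x%:C != 0 :> C by rewrite -cabs_gt0 cabs_real gtr0_norm.
have x8 : cabs (z / x%:C) < 1 / 8.
  by rewrite cabsM cabsV cabs_real gtr0_norm // ltr_pdivrMr //; lra.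
have xz : x%:C + z != 0.
  apply/eqP => e; have : cabs (x%:C : C) = cabs z.
    by rewrite -[x%:C](addrK z) e sub0r cabsN.
  by rewrite cabs_real gtr0_norm // => E; have := cabs_ge0 z; lra.
rewrite /remainder (cpow_rpow _ x0 xz).
have h := @nbinom_series R s _ x8; move/(iffRL (cvg_shift K _ _)): h => h.
apply: (cvg_seq_eq _ (cvgB (cvgM (cvg_cst (rpow x s)) h)
  (cvg_cst (\sum_(k < K) (z / x%:C) ^+ k * (nbinom k s * rpow x s))))) => n.
rewrite ?fctE /= {1}/series /= (@big_cat_nat _ _ _ K) ?leq_addl //= sum_shift seriesE.
rewrite big_mkord mulrDr !mulr_sumr addrC.
rewrite (_ : \sum_(i < K) rpow x s * (nbinom i s * (z / x%:C) ^+ i) =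
  \sum_(k < K) (z / x%:C) ^+ k * (nbinom k s * rpow x s)); last first.
  by apply: eq_bigr => i _; ring.
by rewrite addKr; apply: eq_bigr => i _; ring.
Qed.

(** Nothing relates z to x here, and the bound is not explicit: this serves the finitely many
    eigenvalues not large compared with z. *)
Lemma remainder_power_series z K x a (r : R) : 0 < r ->
  exists M c, power_series (remainder z K x) a r M c.
Proof.
move=> r0.
have [k _|M [c h]] := @power_series_fsum R K
    (fun k s => (z / x%:C) ^+ k * (nbinom k s * rpow x s)) a r r0.
  have [d [hd _ _]] := power_series_nbinom k (rpow_power_series x a r0).
  by eexists; eexists; exact: power_seriesZ hd.
have h2 := power_series_cexp (- clog (x%:C + z)) a r0.
eexists; eexists; apply: power_series_eq (power_seriesD h2 (power_seriesZ (-1) h)).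
by move=> s _; rewrite /remainder mulN1r /cpow mulNr mulNr mulrC.
Qed.

(** The subtracted term k = 0 contributes ln x; a term k >= 1 contributes only through the simple
    zero of its binomial coefficient, with derivative (-1)^k / k. *)
Lemma derive1_remainder z K x :
  derive1 (remainder z K x) 0 =
  - clog (x%:C + z) + (0 < K)%:R * (ln x)%:C -
    \sum_(1 <= k < K) (z / x%:C) ^+ k * ((-1) ^+ k / k%:R).
Proof.
have hr := rpow_power_series x 0 (@ltr01 R).
have ar := power_series_analytic hr.
have an k : analytic_at (fun s => (z / x%:C) ^+ k * (nbinom k s * rpow x s)) 0.
  by apply: analyticZ; exact: analytic_nbinom.
have [h1 h2] := @analytic_fsum R K _ 0 (fun k _ => an k).
have h3 := power_series_cexp (- clog (x%:C + z)) 0 (@ltr01 R).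
have -> : remainder z K x = fun s => cexp (- clog (x%:C + z) * s) +
  (-1) * \sum_(k < K) (z / x%:C) ^+ k * (nbinom k s * rpow x s).
  by apply/funext => s; rewrite /remainder mulN1r /cpow mulNr mulNr mulrC.
rewrite derive1D_analytic; [|exact: power_series_analytic h3|exact: analyticZ].
rewrite (derive1Z_analytic _ h1) h2 (power_series_derive1 h3) mulr0 cexp0 expr1 divr1 mul1r.
rewrite mulN1r -addrA; congr (_ + _).
have d0 : derive1 (fun s => (z / x%:C) ^+ 0 * (nbinom 0 s * rpow x s)) 0 = - (ln x)%:C.
  rewrite (_ : (fun s => _) = rpow x); last by apply/funext => s; rewrite expr0 nbinom0 !mul1r.
  by rewrite (power_series_derive1 hr) rpow0 mul1r expr1 divr1 rmorphN.
have dk k : (0 < k)%N -> derive1 (fun s => (z / x%:C) ^+ k * (nbinom k s * rpow x s)) 0 =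
    (z / x%:C) ^+ k * ((-1) ^+ k / k%:R).
  move=> k0; rewrite (derive1Z_analytic _ (analytic_nbinom k ar)).
  by rewrite (derive1_nbinom ar k0) rpow0 mulr1.
case: K h1 h2 => [|K] _ _; first by rewrite big_ord0 big_geq // mul0r subr0 oppr0.
rewrite big_ord_recl d0 mul1r opprD opprK; congr (_ - _).
rewrite big_add1 /= big_mkord; apply: eq_bigr => i _; exact: (dk i.+1).
Qed.

(** The j-th term of the tail has norm at most D (2 |z| / x)^(K + j) x^(r - Re a), and 2 |z| / x <=
    1 / 2. The geometric sum leaves D x^-p with a D that depends on z, K and the disc but not on
    x. *)
Lemma remainder_power_series_large z K a (r : R) (p : nat) : 0 < r -> p%:R <= Re a - r + K%:R ->
  exists2 D : R, 0 <= D & forall x, 1 <= x -> 8 * cabs z < x ->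
    exists c, power_series (remainder z K x) a r (D * x ^- p) c.
Proof.
move=> r0 pK.
have rho0 : 0 <= cabs a + r by rewrite addr_ge0 ?cabs_ge0 // ltW.
have [D D0 hD] := nbinom_bound_geometric rho0.
exists (2 * (D * (2 * cabs z) ^+ K)).
  by rewrite !mulr_ge0 // exprn_ge0 // mulr_ge0 // cabs_ge0.
move=> x x1 zx; have x0 : 0 < x by lra.
have lx : 0 <= ln x by rewrite ln_ge0.
have hr := rpow_power_series x a r0; rewrite (ger0_norm lx) in hr.
set Mx := _ * expR _ in hr.
have Mx0 : 0 <= Mx by rewrite mulr_ge0 // expR_ge0.
(* The hypothesis on K says that the exponent r - Re a - K is at most -p, and x >= 1. *)
have key : x ^- K * Mx <= x ^- p.
  have xE n : x ^+ n = expR (n%:R * ln x) by rewrite expRM_natl lnK.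
  rewrite /Mx !xE -!expRN -!expRD ler_expR -subr_ge0.
  have -> : - (p%:R * ln x) - (- (K%:R * ln x) + (- Re a * ln x + ln x * r)) =
    (Re a - r + K%:R - p%:R) * ln x by ring.
  by rewrite mulr_ge0 // subr_ge0.
pose y := 2 * cabs z / x.
have y0 : 0 <= y by rewrite divr_ge0 ?mulr_ge0 ?cabs_ge0 // ltW.
have y1 : y <= 1 / 2 by rewrite ler_pdivrMr //; lra.
have yz : 2 * cabs (z / x%:C) = y by rewrite cabsM cabsV cabs_real gtr0_norm // mulrA.
have hq j : exists c, power_series (fun s => (z / x%:C) ^+ (K + j) * (nbinom (K + j) s * rpow x s))
    a r (D * y ^+ K * Mx * (1 / 2) ^+ j) c.
  have [d [hd _ _]] := power_series_nbinom (K + j) hr.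
  eexists; apply: power_series_weaken (power_seriesZ _ hd).
  rewrite cabsX.
  have h1 : cabs (z / x%:C) ^+ (K + j) * (nbinom_bound (K + j) (cabs a + r) * Mx) <=
      cabs (z / x%:C) ^+ (K + j) * (D * 2 ^+ (K + j) * Mx).
    by rewrite ler_wpM2l ?exprn_ge0 ?cabs_ge0 // ler_wpM2r.
  apply: le_trans h1 _.
  have -> : cabs (z / x%:C) ^+ (K + j) * (D * 2 ^+ (K + j) * Mx) = D * y ^+ K * Mx * y ^+ j.
    by rewrite -yz !exprMn !exprD; ring.
  by rewrite ler_wpM2l ?mulr_ge0 ?exprn_ge0 // lerXn2r // nnegrE.
have [c hc] := choice hq.
have C0 : 0 <= D * y ^+ K * Mx by rewrite !mulr_ge0 ?exprn_ge0.
have [d [hd _ _]] := power_series_sum r0 hc (fun n => sum_half n C0).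
exists d; apply: (power_series_weaken _ (power_series_eq _ hd)); last first.
  by move=> s _; apply: (@cvg_lim _ (@norm_hausdorff _ _)); exact: remainder_series.
have -> : 2 * (D * y ^+ K * Mx) = 2 * (D * (2 * cabs z) ^+ K) * (x ^- K * Mx).
  by rewrite /y expr_div_n; ring.
by rewrite ler_wpM2l // !mulr_ge0 // exprn_ge0 // mulr_ge0 // cabs_ge0.
Qed.

End BinomialRemainder.

(** * Sums of remainders over the spectrum and the continuation of the zeta function *)

Section SpectralZeta.
Variable R : realType.
Local Notation C := (cplx R).
Variables (J : set nat) (lam : nat -> R) (p : nat) (delta B : R).
Hypothesis delta0 : 0 < delta.
Hypothesis lam_ge : forall q, q \in J -> delta <= lam q.
Hypothesis lam_summable : sum_bounded (fun q => if q \in J then lam q ^- p else 0) B.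
Implicit Types (a s z : C).

Lemma lam_gt0 q : q \in J -> 0 < lam q.
Proof. by move=> /lam_ge; exact: lt_le_trans. Qed.

Lemma mask_ge0 q : 0 <= (if q \in J then lam q ^- p else 0).
Proof. by case: ifPn => // /lam_gt0 h; rewrite invr_ge0 exprn_ge0 // ltW. Qed.

(** Far out in the summable family every single term is below L^-p, which forces the eigenvalue
    above L. *)
Lemma lam_unbounded (L : R) : 0 < L -> exists Q, forall q, (Q <= q)%N -> q \in J -> L < lam q.
Proof.
move=> L0; have e0 : 0 < L ^- p / 2 by rewrite divr_gt0 ?invr_gt0 ?exprn_gt0.
have [Q hQ] := sum_bounded_tail mask_ge0 lam_summable e0; exists Q => q Qq qJ.
have := hQ (q - Q).+1; rewrite big_ord_recr /= subnKC // qJ => h.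
have {}h : lam q ^- p < L ^- p.
  apply: (@le_lt_trans _ _ (L ^- p / 2)).
    by apply: le_trans h; rewrite lerDr; apply: sumr_ge0 => i _; exact: mask_ge0.
  by move: e0; set X := L ^- p; lra.
rewrite ltNge; apply: contraTN h => lL; rewrite -leNgt.
rewrite lef_pV2 ?posrE ?exprn_gt0 ?lam_gt0 // lerXn2r // nnegrE ltW // lam_gt0 //.
Qed.

Definition rem_term z K q s : C := if q \in J then remainder z K (lam q) s else 0.

(** With K = 0 nothing is subtracted and this is the Dirichlet series of L + z; in particular
    [rem_sum 0 0] is that of L. *)
Definition rem_sum z K s : C := limn (series (fun q => rem_term z K q s) : nat -> C).

Lemma rem_sum_analytic z K a : p%:R < Re a + K%:R ->
  [/\ analytic_at (rem_sum z K) a,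
      series (fun q => rem_term z K q a) @ \oo --> rem_sum z K a &
      series (fun q => derive1 (rem_term z K q) a) @ \oo --> derive1 (rem_sum z K) a].
Proof.
(* The distance from a to the line Re s = p - K, the largest radius that
   [remainder_power_series_large] allows. *)
move=> pK; pose r := Re a + K%:R - p%:R.
have r0 : 0 < r by rewrite /r subr_gt0.
have pK' : p%:R <= Re a - r + K%:R by rewrite /r; lra.
have [D D0 hD] := remainder_power_series_large z r0 pK'.
have L0 : 0 < Num.max 1 (8 * cabs z) by rewrite lt_max ltr01.
have [Q hQ] := lam_unbounded L0.
(* From Q on the eigenvalues exceed both 1 and 8 |z| and the bounds are multiples of lambda^-p; the
   finitely many indices before Q may have any bound. *)
have ex q : exists Mc : R * (nat -> C), power_series (rem_term z K q) a r Mc.1 Mc.2 /\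
    ((Q <= q)%N -> Mc.1 = D * (if q \in J then lam q ^- p else 0)).
  rewrite /rem_term; case: ifPn => [qJ|_]; last first.
    exists (0, fun n => if n is 0 then 0 else 0) => /=; split; last by rewrite mulr0.
    by rewrite -[X in power_series _ _ _ X _](@cabs0 R); exact: power_series_cst.
  have [Qq|qQ] := leqP Q q.
    have := hQ q Qq qJ; rewrite gt_max => /andP[/ltW l1 l2].
    by have [c hc] := hD _ l1 l2; exists (D * lam q ^- p, c).
  have [M [c hc]] := remainder_power_series z K (lam q) a r0.
  by exists (M, c).
have [Mc hMc] := choice ex.
have M0 q : 0 <= (Mc q).1 by exact: power_series_bound (hMc q).1.
have sb : sum_bounded (fun q => (Mc q).1) (\sum_(q < Q) (Mc q).1 + D * B).
  move=> n; apply: (@le_trans _ _ (\sum_(0 <= q < n + Q) (Mc q).1)).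
    rewrite -(big_mkord xpredT (fun q => (Mc q).1)).
    rewrite [leRHS](@big_cat_nat _ _ _ n) ?leq_addr //= lerDl.
    by apply: sumr_ge0.
  rewrite (@big_cat_nat _ _ _ Q) ?leq_addl //= big_mkord lerD2l.
  rewrite (sum_shift (fun q => (Mc q).1)).
  under eq_bigr => i _ do rewrite (hMc (Q + i)%N).2 ?leq_addr //.
  rewrite -mulr_sumr ler_wpM2l //; apply: le_trans (lam_summable (n + Q)).
  rewrite -(big_mkord xpredT (fun q => if q \in J then lam q ^- p else 0)).
  rewrite [leRHS](@big_cat_nat _ _ _ Q) ?leq_addl //= sum_shift lerDr.
  by apply: sumr_ge0 => i _; exact: mask_ge0.
have [d [hd hc hcv]] := power_series_sum r0 (fun q => (hMc q).1) sb.
split.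
- exact: power_series_analytic hd.
- by apply: hcv; rewrite subrr cabs0 ltW.
- rewrite (power_series_derive1 hd); apply: cvg_seq_eq (hc 1) => n.
  congr (series _ n); apply/funext => q.
  by rewrite (power_series_derive1 (hMc q).1).
Qed.

(** Since lambda^-s / lambda^K = lambda^-(s + K), the term of index K summed over the spectrum is a
    multiple of the Dirichlet series of L at s + K, which converges under the same condition. *)
Lemma rem_sum_step z K s : p%:R < Re s + K%:R ->
  rem_sum z K s = rem_sum z K.+1 s + z ^+ K * nbinom K s * rem_sum 0 0 (s + K%:R).
Proof.
move=> pK.
have pK1 : p%:R < Re s + K.+1%:R by rewrite -natr1; lra.
have pK2 : p%:R < Re (s + K%:R) + 0%:R.
  by rewrite addr0 Re_add -(rmorph_nat (real_complex R)).
have [_ h _] := rem_sum_analytic z pK.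
have [_ h1 _] := rem_sum_analytic z pK1.
have [_ h2 _] := rem_sum_analytic 0 pK2.
apply: (cvg_seq_unique h).
apply: (cvg_seq_eq _ (cvgD h1 (cvgM (cvg_cst (z ^+ K * nbinom K s)) h2))) => n.
rewrite ?fctE /= !seriesE mulr_sumr -big_split; apply: eq_bigr => q _ /=.
rewrite /rem_term; case: ifPn => [qJ|_]; last by rewrite mulr0 addr0.
have l0 := lam_gt0 qJ.
have lC : (lam q)%:C != 0 :> C by rewrite -cabs_gt0 cabs_real gtr0_norm.
rewrite /remainder big_ord_recr big_ord0 subr0 addr0 rpow_cpow // rpowDn //= expr_div_n.
by field; rewrite expf_neq0.
Qed.

Section Continuation.
Variables (Z : C -> C) (sigma : R).
Hypothesis Zmero : meromorphic Z.
Hypothesis Zsum : forall s, sigma < Re s -> Z s = rem_sum 0 0 s.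

(* The remainder converges for Re s + K > p: the larger K, the further to the
   left this expression continues zeta(s; L + z). *)
Definition zeta_expansion z K s : C :=
  \sum_(k < K) z ^+ k * (nbinom k s * Z (s + k%:R)) + rem_sum z K s.

Let sigma0 := Num.max sigma p%:R.

(** Raising K moves one term out of the remainder, and this term is the new summand wherever Z (s +
    K) is given by its series. *)
Lemma zeta_expansion_step z K K' s : (K <= K')%N -> sigma0 < Re s + K%:R ->
  zeta_expansion z K s = zeta_expansion z K' s.
Proof.
move=> KK; elim: K' KK => [|K' IH]; first by rewrite leqn0 => /eqP ->.
rewrite leq_eqVlt => /predU1P[->//|]; rewrite ltnS => KK hs.
rewrite IH // /zeta_expansion big_ord_recr /= -addrA; congr (_ + _).
have {}hs : sigma0 < Re s + K'%:R.
  by apply: lt_le_trans hs _; rewrite lerD2l ler_nat.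
move: hs; rewrite gt_max => /andP[h1 h2].
rewrite rem_sum_step // addrC -mulrA Zsum //.
by rewrite Re_add -(rmorph_nat (real_complex R)).
Qed.

Lemma zeta_expansion_weakly_meromorphic z K a : p%:R < Re a + K%:R ->
  weakly_meromorphic_at (zeta_expansion z K) a.
Proof.
move=> pK; apply: weakly_meromorphicD; last first.
  by apply: analytic_weakly_meromorphic; have [] := rem_sum_analytic z pK.
apply: (@weakly_meromorphic_sum R K (fun k s => z ^+ k * (nbinom k s * Z (s + k%:R)))).
move=> k _; apply: weakly_meromorphicZ.
have h : weakly_meromorphic_at (fun s => Z (s + k%:R)) a.
  exact: (weakly_meromorphic_shift (meromorphic_weakly _ Zmero)).
(* The induction runs over the factors of the binomial coefficient only; the shift by k stays
   fixed. *)
elim: {1}k => [|j IH]; first by under eq_fun do rewrite nbinom0 mul1r.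
have := weakly_meromorphicZ (- (j.+1%:R)^-1) (weakly_meromorphic_mul_linear j%:R IH).
apply: weakly_meromorphic_eq; apply/dnbhs_cabs; exists 1 => // s _ _.
by rewrite nbinomS; ring.
Qed.

(** The number of terms is chosen at each point separately; by [zeta_expansion_step] the choice does
    not matter, so the expansions glue. The result is then repaired at its removable
    singularities. *)
Lemma zeta_continuation_exists z : exists F : C -> C, meromorphic F /\
  exists sigma' : R, forall s, sigma' < Re s -> F s = rem_sum z 0 s.
Proof.
pose N (s : C) := (Num.truncn (sigma0 - Re s)).+1.
have hN s : sigma0 < Re s + (N s)%:R.
  by rewrite addrC -ltrBlDr /N truncnS_gt.
pose F s := zeta_expansion z (N s) s.
have FE s K : sigma0 < Re s + K%:R -> F s = zeta_expansion z K s.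
  move=> hK; rewrite /F (zeta_expansion_step z (leq_maxl (N s) K)) //.
  by rewrite -(zeta_expansion_step z (leq_maxr (N s) K)).
have Fw a : weakly_meromorphic_at F a.
  (* One term more than needed at a, so that the same expansion is valid on the whole unit disc
     around a. *)
  have hK : sigma0 < Re a + (N a).+1%:R - 1 by rewrite -natr1; have := hN a; lra.
  apply: (@weakly_meromorphic_eq R (zeta_expansion z (N a).+1)).
    apply/dnbhs_cabs; exists 1 => // s _ sa; apply/esym/FE.
    have := ler_Re_cabs (s - a); rewrite Re_add Re_opp ler_norml => /andP[h1 _]; lra.
  apply: zeta_expansion_weakly_meromorphic.
  have ps : p%:R <= sigma0 by rewrite le_max lexx orbT.
  lra.
have [G [Gm GF]] := meromorphic_regularization Fw.
have F0 s : sigma0 < Re s -> F s = rem_sum z 0 s.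
  by move=> hs; rewrite (@FE s 0) ?addr0 // /zeta_expansion big_ord0 add0r.
exists G; split=> //; exists sigma0 => s hs; rewrite -F0 //; apply: GF.
(* The repair keeps the value of F at s because F is continuous there, being equal to the analytic
   Dirichlet series on a disc. *)
have [ans _ _] : [/\ analytic_at (rem_sum z 0) s, True & True].
  have h : p%:R < Re s + 0%:R by rewrite addr0; apply: le_lt_trans hs; rewrite le_max lexx orbT.
  by have [? _ _] := rem_sum_analytic z h.
apply: analytic_cvg; apply: analytic_eq_near ans.
apply/nbhs_cabs; exists (Re s - sigma0); first by rewrite subr_gt0.
move=> w ws; apply/esym/F0.
have := ler_Re_cabs (w - s); rewrite Re_add Re_opp ler_norml => /andP[h1 _]; lra.
Qed.

(** The expansion with a fixed number p + 1 of terms is meromorphic only on Re s > -1. This is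
    enough for the identity theorem along the real axis from the far right down to 0. *)
Lemma zeta_continuation_near0 z F (sigma' : R) : meromorphic F ->
  (forall s, sigma' < Re s -> F s = rem_sum z 0 s) ->
  \forall s \near (0 : C)^', F s = zeta_expansion z p.+1 s.
Proof.
move=> Fm FS.
apply: (@meromorphic_identity R F (zeta_expansion z p.+1) (-1) (Num.max sigma' sigma0) _ _ 0).
- move=> t t1; split; first exact: meromorphic_weakly.
  by apply: zeta_expansion_weakly_meromorphic; rewrite /= -natr1; lra.
- move=> s; rewrite gt_max => /andP[h1 h2]; rewrite FS //.
  rewrite -(zeta_expansion_step z (leq0n p.+1)) ?addr0 //.
  by rewrite /zeta_expansion big_ord0 add0r.
- by rewrite ltrN10.
Qed.

End Continuation.
End SpectralZeta.

(** * The derivative at 0 of the zeta function, and its expansion in z *)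

Section ZetaAtZero.
Variable R : realType.
Local Notation C := (cplx R).
Variables (J : set nat) (lam : nat -> R) (p : nat) (delta B : R).
Hypothesis p1 : (1 <= p)%N.
Hypothesis delta0 : 0 < delta.
Hypothesis lam_ge : forall q, q \in J -> delta <= lam q.
Hypothesis lam_summable : sum_bounded (fun q => if q \in J then lam q ^- p else 0) B.
Variables (Z : C -> C) (sigma : R).
Hypothesis Zmero : meromorphic Z.
Hypothesis Zsum : forall s, sigma < Re s -> Z s = rem_sum J lam 0 0 s.
Hypothesis Z0 : analytic_at Z 0.
Hypothesis Zpole : forall j, (1 <= j < p)%N -> analytic_at Z j%:R \/ pole_at Z j%:R 1.
Implicit Types (a s z : C).

Let lgt0 q : q \in J -> 0 < lam q.
Proof. by move=> /lam_ge; exact: lt_le_trans. Qed.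

Let lamC q : q \in J -> (lam q)%:C != 0 :> C.
Proof. by move=> /lgt0 l0; rewrite -cabs_gt0 cabs_real gtr0_norm. Qed.

Lemma rem_term00 q s : rem_term J lam 0 0 q s = if q \in J then rpow (lam q) s else 0.
Proof.
rewrite /rem_term; case: ifPn => // qJ.
by rewrite /remainder big_ord0 subr0 addr0 rpow_cpow // lgt0.
Qed.

Lemma cabs_rpow (x : R) s : cabs (rpow x s) = expR (- Re s * ln x).
Proof. by rewrite /rpow cabs_cexp Re_mul /= mulr0 subr0 Re_opp. Qed.

(** Dominated convergence along p + 1 / (n + 1): the Dirichlet series tends to sum lambda^-p, and
    for n large it represents Z at these points. *)
Lemma zeta_at_p_cvg : exists2 S : C,
  series (fun q => if q \in J then rpow (lam q) p%:R else 0) @ \oo --> S &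
  exists2 t : nat -> C, (forall n, t n != 0) /\ t @ \oo --> 0 &
    (\forall n \near \oo, Z (p%:R + t n) = rem_sum J lam 0 0 (p%:R + t n)) /\
    (fun n => rem_sum J lam 0 0 (p%:R + t n)) @ \oo --> S.
Proof.
pose t n : C := (n.+1%:R^-1 : R)%:C.
have tR n : (p%:R + t n) = (p%:R + n.+1%:R^-1)%:C by rewrite rmorphD /= rmorph_nat.
have ti n : 0 < n.+1%:R^-1 :> R by rewrite invr_gt0.
have pt n : p%:R < Re (p%:R + t n) + 0%:R by rewrite tR addr0 /= ltrDl.
have rp q : q \in J -> rpow (lam q) p%:R = (lam q ^- p)%:C.
  move=> qJ; rewrite -[p%:R]add0r rpowDn ?lgt0 // rpow0 mul1r.
  by rewrite -rmorphXn -fmorphV.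
have [S hS _] : exists2 S : C,
    series (fun q => if q \in J then rpow (lam q) p%:R else 0) @ \oo --> S & cabs S <= B.
  apply: abs_cvg => n; apply: le_trans (lam_summable n); apply: ler_sum => q _.
  case: ifPn => [qJ|_]; last by rewrite cabs0.
  by rewrite rp // cabs_real ger0_norm // invr_ge0 exprn_ge0 // ltW // lgt0.
exists S => //; exists t.
  split=> [n|]; first by rewrite -cabs_gt0 cabs_real gtr0_norm.
  apply/cvg_cabs0; rewrite (_ : (fun n => _) = @harmonic R); first exact: cvg_harmonic.
  by apply/funext => n; rewrite subr0 cabs_real gtr0_norm.
split.
  (* [Zsum] holds only beyond sigma. The identity theorem carries it towards p on punctured discs;
     continuity of Z at p + t n, true for n large, then gives equality at the point itself. *)
  have wp : weakly_meromorphic_at Z p%:R by exact: meromorphic_weakly.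
  have /dnbhs_cabs[r r0 hr] := weakly_meromorphic_near_cvg wp.
  have [N hN] : exists N, forall n, (N <= n)%N -> n.+1%:R^-1 < r.
    have := @cvg_harmonic R; move=> /cvgrPdist_lt /(_ r r0)[N _ hN]; exists N => n /hN /=.
    by rewrite sub0r normrN gtr0_norm.
  exists N => // n /hN nr /=.
  have c1 : Z @ (p%:R + t n) --> Z (p%:R + t n).
    apply: hr; last by rewrite addrC addKr cabs_real gtr0_norm.
    by rewrite -subr_eq0 [p%:R + _]addrC addrK -cabs_gt0 cabs_real gtr0_norm.
  have [an _ _] := rem_sum_analytic delta0 lam_ge lam_summable 0 (pt n).
  apply: (cvg_punctured_eq c1 (analytic_cvg an)); rewrite tR.
  apply: (@meromorphic_identity R Z (rem_sum J lam 0 0) p%:R sigma); last by rewrite ltrDl.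
  - move=> u pu; split; first exact: meromorphic_weakly.
    apply: analytic_weakly_meromorphic.
    have pu' : p%:R < Re (u%:C : C) + 0%:R by rewrite addr0.
    by have [] := rem_sum_analytic delta0 lam_ge lam_summable 0 pu'.
  - exact: Zsum.
(* For 0 < t <= 1 the factor lambda^-t is at most 1 if lambda >= 1, and at most 1 / lambda <= 1 /
   delta otherwise. *)
pose D : R := Num.max 1 delta^-1.
have D1 : 1 <= D by rewrite le_max lexx.
apply: (@dominated_series_cvg R (fun n q => rem_term J lam 0 0 q (p%:R + t n))
   (fun q => if q \in J then rpow (lam q) p%:R else 0) _ S
   (fun q => D * if q \in J then lam q ^- p else 0) (D * B)); last exact: hS.
- move=> n q; rewrite rem_term00; case: ifPn => [qJ|_]; last by rewrite cabs0 mulr0.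
  have l0 := lgt0 qJ; rewrite cabs_rpow tR /= opprD mulrDl expRD mulrC.
  have -> : expR (- p%:R * ln (lam q)) = lam q ^- p.
    by rewrite mulNr expRN expRM_natl lnK.
  rewrite ler_wpM2r ?invr_ge0 ?exprn_ge0 ?(ltW l0) //.
  have [l1|l1] := leP 1 (lam q).
    apply: le_trans D1; rewrite -expR0 ler_expR mulNr oppr_le0 mulr_ge0 ?ln_ge0 //.
  apply: (@le_trans _ _ delta^-1); last by rewrite le_max lexx orbT.
  apply: (@le_trans _ _ (lam q)^-1); last by rewrite lef_pV2 ?posrE // lam_ge.
  have -> : (lam q)^-1 = expR (- 1 * ln (lam q)) by rewrite mulN1r expRN lnK.
  rewrite ler_expR ler_wnM2r ?ln_le0 ?(ltW l1) // lerN2 invf_le1 // ler1n //.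
- by move=> n; rewrite -mulr_sumr ler_wpM2l ?(le_trans ler01) // lam_summable.
- move=> q; under eq_fun do rewrite rem_term00; case: ifPn => qJ; last exact: cvg_cst.
  rewrite /rpow; apply: cvg_cexp.
  rewrite -[X in - X * _]addr0.
  apply: cvgM (cvg_cst _); apply: cvgN; apply: cvgD (cvg_cst _) _.
  apply/cvg_cabs0; rewrite (_ : (fun n => _) = @harmonic R); first exact: cvg_harmonic.
  by apply/funext => n; rewrite subr0 cabs_real gtr0_norm.
- by move=> n; have [_ h _] := rem_sum_analytic delta0 lam_ge lam_summable 0 (pt n).
Qed.

(* The hypotheses say nothing about a pole at p itself; it is excluded because
   Z stays bounded along p + 1/(n+1). *)
Lemma zeta_at_p : exists h : C -> C, [/\ analytic_at h p%:R,
  (\forall s \near (p%:R : C)^', Z s = h s) &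
  series (fun q => if q \in J then rpow (lam q) p%:R else 0) @ \oo --> h p%:R].
Proof.
have [S hS [t [t0 tl] [ZS SS]]] := zeta_at_p_cvg.
have pt : (fun n => p%:R + t n) @ \oo --> (p%:R : C).
  by rewrite -[X in _ --> X]addr0; exact: (cvgD (cvg_cst _) tl).
have lift_near (P : C -> Prop) : (\forall s \near (p%:R : C)^', P s) ->
    \forall n \near \oo, P (p%:R + t n).
  move=> /dnbhs_cabs[r r0 h]; move/cvg_cabs: pt => /(_ r r0).
  by apply: filterS => n; apply: h; rewrite -subr_eq0 addrC addKr.
have [[h [ha Zh]]|[n [n0 [g [ga g0 Zg]]]]] :=
    weakly_meromorphic_dichotomy (meromorphic_weakly p%:R Zmero).
  exists h; split; [exact: ha|exact: Zh|].
  suff -> : h p%:R = S by exact: hS.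
  apply: (@cvg_seq_unique R (fun n => h (p%:R + t n))).
    by apply: (cvg_comp _ _ pt); exact: analytic_cvg.
  apply: cvg_trans SS; apply: near_eq_cvg.
  by apply: filterS2 ZS (lift_near _ Zh) => m <- <-.
(* At a pole of order n, g (p + t) = Z (p + t) t^n along the sequence; the first factor converges
   and the second tends to 0, so g would vanish at p. *)
case/eqP: g0; apply: (@cvg_seq_unique R (fun m => g (p%:R + t m))).
  by apply: (cvg_comp _ _ pt); exact: analytic_cvg.
have h1 : (fun m => rem_sum J lam 0 0 (p%:R + t m) * t m ^+ n) @ \oo --> (0 : C).
  have tn : (fun m => t m ^+ n) @ \oo --> (0 : C).
    rewrite (_ : (0 : C) = 0 ^+ n); last by rewrite expr0n gtn_eqF.
    elim: n {n0 Zg} => [|n IH].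
      by under eq_fun do rewrite expr0; exact: cvg_cst.
    by under eq_fun do rewrite exprS; rewrite exprS; exact: (cvgM tl IH).
  by rewrite -[X in _ --> X](mulr0 S); exact: (cvgM SS tn).
apply: cvg_trans h1; apply: near_eq_cvg.
apply: filterS2 ZS (lift_near _ Zg) => m <- ->.
by rewrite [p%:R + t m]addrC addrK divfK // expf_neq0.
Qed.

Lemma nbinom_zeta_analytic k : (k < p)%N -> exists h : C -> C,
  analytic_at h 0 /\ \forall s \near (0 : C)^', nbinom k s * Z (s + k%:R) = h s.
Proof.
case: k => [|k] kp.
  exists Z; split=> //; apply/dnbhs_cabs; exists 1 => // s _ _.
  by rewrite nbinom0 mul1r addr0.
have [|[_ [g [ga _ /dnbhs_cabs[r r0 Zg]]]]] := @Zpole k.+1 kp.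
  move=> Za; exists (fun s => nbinom k.+1 s * Z (s + k.+1%:R)); split.
    by apply: analytic_nbinom; apply: analytic_shift; rewrite add0r.
  by apply/dnbhs_cabs; exists 1.
have ga' : analytic_at (fun s => g (s + k.+1%:R)) 0 by apply: analytic_shift; rewrite add0r.
have [h [ha hg]] : exists h : C -> C, analytic_at h 0 /\
    forall s, s != 0 -> nbinom k.+1 s * (g (s + k.+1%:R) / s) = h s.
  (* The factor -s, present from [nbinom 1] on, cancels the denominator; each further factor is
     linear. *)
  elim: {1}k => [|j [h [ha hg]]].
    exists (fun s => -1 * g (s + k.+1%:R)); split; first exact: analyticZ.
    by move=> s s0; rewrite nbinomS nbinom0; field.
  exists (fun s => - (j.+2%:R)^-1 * ((s + j.+1%:R) * h s)); split.
    by apply: analyticZ; exact: analytic_mul_linear.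
  by move=> s s0; rewrite nbinomS -hg //; ring.
exists h; split=> //; apply/dnbhs_cabs; exists r => // s s0 sr.
rewrite -hg // Zg ?expr1 ?addrK //; last by rewrite subr0 in sr.
by rewrite -subr_eq0 addrK.
Qed.

(** A logarithm of the factor of the regularized determinant at [lam q]. The outer [else] gives 0,
    the logarithm of the empty factor. *)
Definition ell z q : C := if q \in J then
  clog ((lam q)%:C + z) - (ln (lam q))%:C +
    \sum_(1 <= k < p) (-1) ^+ k * (z ^+ k * (lam q)%:C ^- k / k%:R) else 0.

(** The constants A_k are fixed before z and before the continuation F: they are minus the
    derivatives at 0 of the analytic extensions of [nbinom k s * Z (s + k)]. *)
Lemma logdet_expansion : exists A : nat -> C,
  forall z F (sigma' : R), meromorphic F ->
  (forall s, sigma' < Re s -> F s = rem_sum J lam z 0 s) ->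
  series (ell z) @ \oo --> - derive1 F 0 - \sum_(k < p) A k * z ^+ k.
Proof.
have hk k : exists h : C -> C, (k < p)%N ->
    analytic_at h 0 /\ \forall s \near (0 : C)^', nbinom k s * Z (s + k%:R) = h s.
  have [kp|pk] := ltnP k p; last by exists (fun=> 0).
  by have [h hh] := nbinom_zeta_analytic kp; exists h.
have [h hh] := choice hk.
have [g [ga Zg gS]] := zeta_at_p.
exists (fun k => - derive1 (h k) 0) => z F sigma' Fm FS.
have pK : p%:R < Re (0 : C) + p.+1%:R by rewrite add0r ltr_nat.
have [San Scv Sd] := rem_sum_analytic delta0 lam_ge lam_summable z pK.
pose H s : C := \sum_(k < p) z ^+ k * h k s.
have [Han Hd] : analytic_at H 0 /\ derive1 H 0 = \sum_(k < p) z ^+ k * derive1 (h k) 0.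
  have [k kp|h1 h2] := @analytic_fsum R p (fun k s => z ^+ k * h k s) 0.
    by apply: analyticZ; have [] := hh k kp.
  split=> //; rewrite h2; apply: eq_bigr => k _.
  exact: (derive1Z_analytic _ (hh k (ltn_ord k)).1).
have ga' : analytic_at (fun s => g (s + p%:R)) 0 by apply: analytic_shift; rewrite add0r.
have gan := analytic_nbinom p ga'.
have gd := derive1_nbinom ga' p1; rewrite add0r in gd.
pose G s := H s + (z ^+ p * (nbinom p s * g (s + p%:R)) + rem_sum J lam z p.+1 s).
have Gan2 := analyticD (analyticZ (z ^+ p) gan) San.
have Gan : analytic_at G 0 := analyticD Han Gan2.
have FG : \forall s \near (0 : C)^', F s = G s.
  have h1 : \forall s \near (0 : C)^', F s = zeta_expansion J lam Z z p.+1 s.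
    exact: (zeta_continuation_near0 delta0 lam_ge lam_summable Zmero Zsum Fm FS).
  have h2 : \forall s \near (0 : C)^', \sum_(k < p) z ^+ k * (nbinom k s * Z (s + k%:R)) = H s.
    suff key m : (m <= p)%N -> \forall s \near (0 : C)^',
        \sum_(k < m) z ^+ k * (nbinom k s * Z (s + k%:R)) = \sum_(k < m) z ^+ k * h k s.
      exact: key (leqnn p).
    elim: m => [_|m IH mp].
      by apply/dnbhs_cabs; exists 1 => // s _ _; rewrite !big_ord0.
    apply: filterS2 (IH (ltnW mp)) (hh m mp).2 => s e1 e2.
    by rewrite !big_ord_recr /= e1 e2.
  have h3 : \forall s \near (0 : C)^', Z (s + p%:R) = g (s + p%:R).
    move/dnbhs_cabs: Zg => [r r0 hr]; apply/dnbhs_cabs; exists r => // s s0 sr.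
    have s' : s + p%:R != p%:R by rewrite -subr_eq0 addrK.
    have sr' : cabs (s + p%:R - p%:R) < r by rewrite addrK -[s]subr0.
    exact: (hr _ s' sr').
  apply: filterS3 h1 h2 h3 => s e1 e2 e3.
  by rewrite e1 /zeta_expansion big_ord_recr /= e2 e3 -addrA.
(* The difference quotient at 0 involves F 0, so agreement off 0 does not suffice. *)
have FG0 : \forall s \near (0 : C), F s = G s.
  apply: removable_singularity Gan FG.
  by have [?|?] := Fm 0; [left|right].
rewrite (derive1_eq_near Gan FG0) (derive1D_analytic Han Gan2).
rewrite (derive1D_analytic (analyticZ _ gan) San) (derive1Z_analytic _ gan) Hd gd.
have -> : - (\sum_(k < p) z ^+ k * derive1 (h k) 0 +
   (z ^+ p * ((-1) ^+ p / p%:R * g p%:R) + derive1 (rem_sum J lam z p.+1) 0)) -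
   \sum_(k < p) - derive1 (h k) 0 * z ^+ k =
   - (z ^+ p * ((-1) ^+ p / p%:R) * g p%:R) - derive1 (rem_sum J lam z p.+1) 0.
  have -> : \sum_(k < p) - derive1 (h k) 0 * z ^+ k = - \sum_(k < p) z ^+ k * derive1 (h k) 0.
    by rewrite -sumrN; apply: eq_bigr => k _; ring.
  ring.
(* The remainder with p + 1 terms has a summand k = p too many in its derivative; it cancels,
   eigenvalue by eigenvalue, against the contribution of zeta at p. *)
apply: (cvg_seq_eq _ (cvgB (cvgN (cvgM (cvg_cst (z ^+ p * ((-1) ^+ p / p%:R))) gS)) Sd)) => n.
rewrite ?fctE /= !seriesE mulr_sumr -!sumrN -big_split; apply: eq_bigr => q _ /=.
rewrite /ell /rem_term; case: ifPn => qJ; last first.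
  by rewrite (power_series_derive1 (power_series_cst 0 0 ltr01)) mulr0 oppr0 addr0.
rewrite derive1_remainder mul1r big_nat_recr //=.
have rp : rpow (lam q) p%:R = ((lam q)%:C ^+ p)^-1.
  by have := rpowDn 0 p (lgt0 qJ); rewrite add0r rpow0 mul1r.
rewrite rp.
rewrite (_ : \sum_(1 <= k < p) (-1) ^+ k * (z ^+ k * (lam q)%:C ^- k / k%:R) =
  \sum_(1 <= k < p) (z / (lam q)%:C) ^+ k * ((-1) ^+ k / k%:R)); last first.
  by apply: eq_bigr => k _; rewrite expr_div_n; ring.
by rewrite expr_div_n; ring.
Qed.

(** [ell z q] is the logarithm series at z / lambda without its terms below p. Its norm at radius r
    is therefore at most 2 (r / lambda)^p, and the M-test applies. *)
Lemma ell_power_series : exists r M c, [/\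
  power_series (fun z => limn (series (ell z) : nat -> C)) 0 r M c,
  forall k, (k < p)%N -> c k = 0 &
  forall q (z : C), q \in J -> cabs z <= r -> (lam q)%:C + z != 0].
Proof.
(* This makes |z / lambda| <= 1 / 16 for every eigenvalue, safely below the 1 / 8 required by
   [clog_log1p_series]. *)
have [r [r0 rE]] : exists r : R, 0 < r /\ r = delta / 16.
  by exists (delta / 16); rewrite divr_gt0.
pose c q n : C := if q \in J then (if (n < p)%N then 0 else log1p_coef R n / (lam q)%:C ^+ n) else 0.
pose M q : R := 2 * r ^+ p * (if q \in J then lam q ^- p else 0).
have hps q : power_series (fun z => ell z q) 0 r (M q) (c q).
  have [qJ|qJ] := boolP (q \in J); last first.
    have := power_series_cst (0 : C) 0 r0; rewrite cabs0 /M /ell /c (negPf qJ) mulr0.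
    by congr (power_series _ _ _ _ _); apply/funext => -[].
  have l0 := lgt0 qJ; have lC := lamC qJ.
  have rl : r / lam q <= 1 / 16.
    by rewrite ler_pdivrMr // rE; have := lam_ge qJ; lra.
  have rl0 : 0 <= r / lam q by rewrite divr_ge0 // ltW.
  split=> [//|n|z].
    have h1 : \sum_(k < n) cabs (c q k) * r ^+ k <= \sum_(k < n + p) cabs (c q k) * r ^+ k.
      rewrite -!(big_mkord xpredT (fun k => cabs (c q k) * r ^+ k)).
      rewrite [leRHS](@big_cat_nat _ _ _ n) ?leq_addr //= lerDl; apply: sumr_ge0 => i _.
      by rewrite mulr_ge0 ?cabs_ge0 // exprn_ge0 // ltW.
    apply: le_trans h1 _.
    rewrite -(big_mkord xpredT (fun k => cabs (c q k) * r ^+ k)).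
    rewrite (@big_cat_nat _ _ _ p) ?leq_addl //= (sum_shift (fun k => cabs (c q k) * r ^+ k)).
    rewrite [X in X + _]big_nat_cond [X in X + _]big1 ?add0r; last first.
      by move=> i /andP[/andP[_ ip] _]; rewrite /c qJ ip cabs0 mul0r.
    have C0 : 0 <= (r / lam q) ^+ p by rewrite exprn_ge0.
    have -> : M q = 2 * (r / lam q) ^+ p by rewrite /M qJ expr_div_n mulrA.
    apply: le_trans (sum_half n C0); apply: ler_sum => i _.
    rewrite /c qJ ltnNge leq_addr /= cabsM cabsV cabsX cabs_real gtr0_norm //.
    have -> : cabs (log1p_coef R (p + i)) / lam q ^+ (p + i) * r ^+ (p + i) =
      cabs (log1p_coef R (p + i)) * ((r / lam q) ^+ p * (r / lam q) ^+ i).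
      by rewrite -exprD expr_div_n; ring.
    apply: (@le_trans _ _ (1 * ((r / lam q) ^+ p * (r / lam q) ^+ i))).
      by rewrite ler_wpM2r ?cabs_log1p_coef // mulr_ge0 // exprn_ge0.
    rewrite mul1r ler_wpM2l // lerXn2r ?nnegrE //; lra.
  rewrite subr0 => zr.
  have x16 : cabs (z / (lam q)%:C) <= 1 / 16.
    rewrite cabsM cabsV cabs_real gtr0_norm //; apply: le_trans rl.
    by rewrite ler_wpM2r // invr_ge0 ltW.
  have x8 : cabs (z / (lam q)%:C) < 1 / 8 by lra.
  have [_ _ /(_ (z / (lam q)%:C))] := log1p_power_series R.
  rewrite subr0 => hl; have {}hl := hl (le_trans x16 _).
  have {}hl : series (fun n => log1p_coef R n * (z / (lam q)%:C) ^+ n) @ \oo -->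
    log1p_series (z / (lam q)%:C) by apply: hl; lra.
  have xz : 1 + z / (lam q)%:C != 0.
    apply/eqP => e; have : cabs (1 : C) <= cabs (z / (lam q)%:C).
      by rewrite -[1](addrK (z / (lam q)%:C)) e sub0r cabsN.
    by rewrite cabs1; lra.
  have -> : ell z q = log1p_series (z / (lam q)%:C) -
      \sum_(k < p) log1p_coef R k * (z / (lam q)%:C) ^+ k.
    rewrite /ell qJ (_ : (lam q)%:C + z = (lam q)%:C * (1 + z / (lam q)%:C)); last by field.
    rewrite clog_pmul // clog_log1p_series // [_ + log1p_series _]addrC addrK; congr (_ + _).
    (* The sum in [ell] starts at 1; the term of index 0 can be added since its coefficient is 0. *)
    rewrite -(big_mkord xpredT (fun k => log1p_coef R k * (z / (lam q)%:C) ^+ k)).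
    rewrite big_ltn // {1}/log1p_coef invr0 mulr0 mul0r add0r -sumrN.
    by apply: eq_bigr => k _; rewrite /log1p_coef expr_div_n; ring.
  move/(iffRL (cvg_shift p _ _)): hl => hl; apply/(cvg_shift p).
  apply: (cvg_seq_eq _ (cvgB hl (cvg_cst _))) => n; rewrite ?fctE /= /series /=.
  rewrite [X in X - _](@big_cat_nat _ _ _ p) ?leq_addl //=.
  rewrite [RHS](@big_cat_nat _ _ _ p) ?leq_addl //= !sum_shift [X in X + _ - _]big_mkord [X in X - _]addrC addrK.
  rewrite [X in _ = X + _]big_nat_cond [X in _ = X + _]big1 ?add0r; last first.
    by move=> i /andP[/andP[_ ip] _]; rewrite /c qJ ip mul0r.
  apply: eq_bigr => i _; rewrite /c qJ ltnNge leq_addr /= expr_div_n; ring.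
have sb : sum_bounded M (2 * r ^+ p * B).
  move=> n; rewrite -mulr_sumr ler_wpM2l ?lam_summable //.
  by rewrite mulr_ge0 // exprn_ge0 // ltW.
have [d [hd hc _]] := power_series_sum r0 hps sb.
exists r, (2 * r ^+ p * B), d; split=> [|k kp|q z qJ zr].
- exact: hd.
- apply: (cvg_seq_unique (hc k)); rewrite (_ : series _ = cst 0); first exact: cvg_cst.
  apply/funext => n; rewrite seriesE big1 // => q _.
  by rewrite /c kp; case: ifP.
- apply/eqP => e; have : cabs ((lam q)%:C : C) = cabs z.
    by rewrite -[(lam q)%:C](addrK z) e sub0r cabsN.
  rewrite cabs_real (gtr0_norm (lgt0 qJ)); have := lam_ge qJ; rewrite rE in zr; lra.
Qed.

End ZetaAtZero.

(** * Eigenvalues and singular values *)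

Section PowerMean.
Variable R : realType.

(** Convexity: a power lies above its tangent at m. The inductive step multiplies by x and gains the
    square (p + 1) m^p (x - m)^2. *)
Lemma exprn_tangent (x m : R) p : 0 <= x -> 0 <= m ->
  m ^+ p.+1 + p.+1%:R * m ^+ p * (x - m) <= x ^+ p.+1.
Proof.
move=> x0 m0; elim: p => [|p IH]; first by rewrite !expr1 expr0; lra.
have h1 : 0 <= x * (x ^+ p.+1 - (m ^+ p.+1 + p.+1%:R * m ^+ p * (x - m))).
  by rewrite mulr_ge0 // subr_ge0.
have h2 : 0 <= p.+1%:R * m ^+ p * (x - m) ^+ 2.
  by rewrite mulr_ge0 ?sqr_ge0 // mulr_ge0 ?exprn_ge0.
rewrite -subr_ge0; apply: le_trans (addr_ge0 h1 h2) _.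
rewrite le_eqVlt; apply/orP; left; apply/eqP.
by rewrite -[p.+2%:R]natr1 !exprS; ring.
Qed.

(** Jensen's inequality for weights of total mass W at most 1: the tangents at the mean m are
    averaged. With q for the exponent, the missing mass leaves the nonnegative surplus (q - 1) m^q
    (1 - W). *)
Lemma power_mean_le n (s w : nat -> R) p : (0 < p)%N ->
  (forall i, 0 <= s i) -> (forall i, 0 <= w i) -> \sum_(i < n) w i <= 1 ->
  (\sum_(i < n) s i * w i) ^+ p <= \sum_(i < n) s i ^+ p * w i.
Proof.
case: p => // p _ s0 w0 w1.
have [m mE] : exists m, \sum_(i < n) s i * w i = m by eexists.
have m0 : 0 <= m by rewrite -mE; apply: sumr_ge0 => i _; rewrite mulr_ge0.
rewrite mE.
have W0 : 0 <= \sum_(i < n) w i by apply: sumr_ge0.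
apply: (@le_trans _ _ (\sum_(i < n) (m ^+ p.+1 + p.+1%:R * m ^+ p * (s i - m)) * w i)).
  have -> : \sum_(i < n) (m ^+ p.+1 + p.+1%:R * m ^+ p * (s i - m)) * w i =
      m ^+ p.+1 * \sum_(i < n) w i + p.+1%:R * m ^+ p * (m - m * \sum_(i < n) w i).
    transitivity (m ^+ p.+1 * \sum_(i < n) w i + p.+1%:R * m ^+ p *
      (\sum_(i < n) s i * w i - m * \sum_(i < n) w i)); last by rewrite mE.
    rewrite !mulr_sumr -sumrB mulr_sumr -big_split.
    by apply: eq_bigr => i _ /=; ring.
  move: (\sum_(i < n) w i) W0 w1 => W W0 w1.
  rewrite -subr_ge0.
  have -> : m ^+ p.+1 * W + p.+1%:R * m ^+ p * (m - m * W) - m ^+ p.+1 =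
     p%:R * m ^+ p.+1 * (1 - W).
    by rewrite -[p.+1%:R]natr1 exprS; ring.
  by rewrite !mulr_ge0 ?exprn_ge0 // subr_ge0.
by apply: ler_sum => i _; rewrite ler_wpM2r // exprn_tangent.
Qed.

End PowerMean.

(** * Bessel's inequality, orthonormal families and summability of eigenvalues *)

Section InnerProductSpace.
Variables (R : realType) (H : completeNormedModType R[i]) (dot : {dot H for Num.conj}).
Hypothesis norm_dot : forall u : H, `|u| ^+ 2 = dot u u.
Local Notation C := (cplx R).
Implicit Types (u v : H).

Lemma dotC u v : dot u v = Num.conj (dot v u).
Proof. by rewrite hermC expr0 mul1r. Qed.

Lemma cabs_conj (x : R[i]) : cabs (Num.conj x) = cabs x.
Proof. by apply: complexI; rewrite -!cabsE norm_conjC. Qed.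

Lemma dotZl (a : R[i]) u v : dot (a *: u) v = a * dot u v.
Proof. exact: linearZl_LR. Qed.

Lemma dotZr (a : R[i]) u v : dot u (a *: v) = Num.conj a * dot u v.
Proof. exact: linearZr_LR. Qed.

Definition orthonormal_on (P : pred nat) (v : nat -> H) :=
  forall i j, P i -> P j -> dot (v i) (v j) = (i == j)%:R.

Lemma bessel n (P : pred nat) (v : nat -> H) u : orthonormal_on P v ->
  \sum_(i < n | P i) cabs (dot u (v i)) ^+ 2 <= Re (dot u u).
Proof.
move=> ov; pose w := \sum_(i < n | P i) dot u (v i) *: v i.
have wv (j : 'I_n) : P j -> dot w (v j) = dot u (v j).
  move=> Pj; rewrite /w linear_sumlz (bigD1 j) //= big1 ?addr0.
    by rewrite dotZl ov // eqxx mulr1.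
  move=> i /andP[Pi]; rewrite -val_eqE => /negPf ij.
  by rewrite dotZl ov // ij mulr0.
have ortho : dot (u - w) w = 0.
  rewrite {2}/w linear_sumr big1 // => j Pj.
  by rewrite /= dotZr linearBl /= wv // subrr mulr0.
have ww : dot w w = \sum_(i < n | P i) (cabs (dot u (v i)) ^+ 2)%:C.
  rewrite {2}/w linear_sumr; apply: eq_bigr => j Pj.
  by rewrite /= dotZr wv // mulrC -normCK cabsE rmorphXn.
have uu : dot u u = dot (u - w) (u - w) + dot w w.
  have E (a : H) : dot (a + w) (a + w) = dot a a + dot a w + (dot w a + dot w w).
    by rewrite linearDl /= !linearDr.
  rewrite -{1 2}[u](subrK w) E ortho addr0 [dot w (u - w)]dotC ortho rmorph0 add0r //.
have := dnorm_ge0 dot (u - w); rewrite uu ww -rmorph_sum /= Re_add /=.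
by rewrite lecE /= => /andP[_ h]; rewrite lerDr.
Qed.

(** A dimension count extends the family: as long as m < n, orthogonality to m vectors is m linear
    conditions on n coefficients, and a nonzero solution can be normalized. *)
Lemma exists_orthonormal (V : set H) n (b : 'I_n -> H) :
  V = [set u | exists c : 'I_n -> R[i], u = \sum_i c i *: b i] ->
  (forall c : 'I_n -> R[i], \sum_i c i *: b i = 0 -> forall i, c i = 0) ->
  exists v : nat -> H, (forall i, (i < n)%N -> V (v i)) /\ orthonormal_on (fun i => i < n)%N v.
Proof.
move=> VE indep.
suff key m : (m <= n)%N -> exists v : nat -> H, (forall i, (i < m)%N -> V (v i)) /\
    orthonormal_on (fun i => i < m)%N v by exact: key.
elim: m => [_|m IH mn]; first by exists (fun=> 0).
have [v [Vv ov]] := IH (ltnW mn).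
pose M : 'M[R[i]]_(n, m) := \matrix_(i, k) dot (b i) (v k).
(* A combination of the b i in the kernel of M is orthogonal to all the v k. *)
have : kermx M != 0.
  rewrite kermx_eq0 /row_free; apply: contraTN mn => /eqP <-.
  by rewrite -leqNgt rank_leq_col.
move=> /rowV0Pn[c /sub_kermxP cM c0].
pose w := \sum_i c 0 i *: b i.
have w0 : w != 0.
  apply: contra c0 => /eqP /(indep (fun i => c 0 i)) h; apply/eqP/rowP => i.
  by rewrite h mxE.
have wv k : (k < m)%N -> dot w (v k) = 0.
  move=> km; have := congr1 (fun A : 'rV_m => A 0 (Ordinal km)) cM.
  rewrite !mxE => <-; rewrite /w linear_sumlz; apply: eq_bigr => i _.
  transitivity (c 0 i * dot (b i) (v k)); first exact: linearZl_LR.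
  by rewrite mxE.
pose al := (sqrtC (dot w w))^-1.
have ww : dot (al *: w) (al *: w) = 1.
  rewrite dnormZ normfV (ger0_norm (sqrt_dnorm_ge0 dot w)) exprVn sqrtCK mulVf //.
  by rewrite dnorm_eq0.
exists (fun i => if i == m then al *: w else v i); split=> [i|i j].
  rewrite ltnS leq_eqVlt; case: eqVneq => [_ _|_ /= /Vv //].
  rewrite VE; exists (fun i => al * c 0 i); rewrite /w scaler_sumr.
  by apply: eq_bigr => k _; rewrite scalerA.
rewrite ltnS leq_eqVlt => /orP[/eqP ->|im]; rewrite ltnS leq_eqVlt => /orP[/eqP ->|jm].
- by rewrite eqxx ww.
- by rewrite eqxx (ltn_eqF jm) dotZl (wv _ jm) mulr0 (gtn_eqF jm).
- by rewrite eqxx (ltn_eqF im) dotZr dotC (wv _ im) rmorph0 mulr0.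
- by rewrite (ltn_eqF im) (ltn_eqF jm) ov.
Qed.

(** For a unit vector v, the Cauchy-Schwarz inequality is Bessel's inequality with a single
    vector. *)
Lemma cvg_dot (x : nat -> H) (l v : H) : dot v v = 1 -> x @ \oo --> l ->
  (fun n => dot (x n) v : C) @ \oo --> (dot l v : C).
Proof.
move=> vv xl; have v1 u : cabs (dot u v) <= cabs `|u|.
  have ov : orthonormal_on (fun i => i == 0)%N (fun=> v) by move=> i j /eqP -> /eqP ->.
  have := bessel 1 u ov; rewrite big_mkcond big_ord1 /= -norm_dot => h.
  rewrite -ler_sqr ?nnegrE ?cabs_ge0 //; apply: le_trans h _.
  rewrite -cabsX; exact: le_trans (ler_norm _) (ler_Re_cabs _).
apply/cvg_cabs => e e0.
have eC : 0 < e%:C :> R[i] by rewrite ltcR.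
move/cvgrPdistC_lt: xl => /(_ _ eC); apply: filterS => n h.
rewrite -linearBl; apply: le_lt_trans (v1 _) _.
by rewrite -ltcR -cabsE normr_id.
Qed.

(* mu q = sum_n s n <u q, e n> <f n, u q>; by Bessel the weights w below have row
   and column sums at most 1, so Jensen's inequality applies. *)
Lemma schatten_eigenvalues (p : nat) (T : H -> H) (P : pred nat) (mu : nat -> R) (u : nat -> H) :
  (0 < p)%N -> schatten dot p T -> orthonormal_on P u ->
  (forall q, P q -> T (u q) = (mu q)%:C *: u q) -> (forall q, P q -> 0 <= mu q) ->
  exists M : R, sum_bounded (fun q => if P q then mu q ^+ p else 0) M.
Proof.
move=> p0 [s [e [f [s0 orth sp sT]]]] ou Tu mu0.
have oe : orthonormal_on (fun n => s n != 0) e by move=> m n hm hn; have [] := orth m n hm hn.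
have of_ : orthonormal_on (fun n => s n != 0) f by move=> m n hm hn; have [] := orth m n hm hn.
(* From a b <= (a^2 + b^2) / 2. The weights are cut off where s n = 0, since e n and f n are
   unconstrained there. *)
pose w q n : R := if s n != 0 then
  (cabs (dot (u q) (e n)) ^+ 2 + cabs (dot (u q) (f n)) ^+ 2) / 2 else 0.
have w0 q n : 0 <= w q n.
  by rewrite /w; case: ifP => // _; rewrite divr_ge0 // addr_ge0 // sqr_ge0.
have split_sum (Q : pred nat) (x y : nat -> R) N :
    \sum_(i < N | Q i) (x i + y i) / 2 = (\sum_(i < N | Q i) x i + \sum_(i < N | Q i) y i) / 2.
  by rewrite -big_split mulr_suml.
have wn q N : P q -> \sum_(n < N) w q n <= 1.
  move=> Pq; rewrite (_ : \sum_(n < N) w q n = \sum_(n < N | s n != 0)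
    (cabs (dot (u q) (e n)) ^+ 2 + cabs (dot (u q) (f n)) ^+ 2) / 2); last first.
    by rewrite [RHS]big_mkcond.
  have /= -> := split_sum (fun n => s n != 0) (fun n => cabs (dot (u q) (e n)) ^+ 2)
    (fun n => cabs (dot (u q) (f n)) ^+ 2) N.
  have := bessel N (u q) oe; have := bessel N (u q) of_; rewrite ou // eqxx /=; lra.
have wq n Q : s n != 0 -> \sum_(q < Q | P q) w q n <= 1.
  move=> sn; rewrite /w sn.
  have /= -> := split_sum P (fun q => cabs (dot (u q) (e n)) ^+ 2)
    (fun q => cabs (dot (u q) (f n)) ^+ 2) Q.
  have := bessel Q (e n) ou; have := bessel Q (f n) ou.
  rewrite oe // of_ // eqxx /=.
  under eq_bigr do rewrite dotC cabs_conj.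
  under [in X in _ -> X -> _]eq_bigr do rewrite dotC cabs_conj.
  lra.
pose M := limn (series (fun n => s n ^+ p)).
have sM N : \sum_(n < N) s n ^+ p <= M.
  rewrite -(seriesE (fun n => s n ^+ p)); apply: nondecreasing_cvgn_le => //.
  by apply/nondecreasing_seqP => m; rewrite [leRHS]seriesSr lerDl exprn_ge0.
pose x q N : C := \sum_(n < N) (s n)%:C * dot (u q) (e n) * dot (f n) (u q).
have xmu q : P q -> x q @ \oo --> ((mu q)%:C : C).
  move=> Pq; have uq : dot (u q) (u q) = 1 by rewrite ou // eqxx.
  have h1 := sT (u q); rewrite (Tu q Pq) in h1.
  have h2 := cvg_dot uq h1; rewrite dotZl uq mulr1 in h2.
  apply: (cvg_seq_eq _ h2) => N; rewrite seriesE linear_sumlz; apply: eq_bigr => n _.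
  exact: linearZl_LR.
have xw q N : cabs (x q N) <= \sum_(n < N) s n * w q n.
  apply: le_trans (cabs_sum _ _ _) _; apply: ler_sum => n _.
  rewrite !cabsM cabs_real ger0_norm // /w; case: ifPn => [_|/negPn/eqP ->]; last first.
    by rewrite !mul0r.
  rewrite -mulrA ler_wpM2l // [dot (f n) _]dotC cabs_conj.
  have := sqr_ge0 (cabs (dot (u q) (e n)) - cabs (dot (u q) (f n))); rewrite sqrrB; lra.
exists M => Q.
(* The inequality is proved for the truncation at N of the expansion of mu q, so that all sums are
   finite and can be exchanged; then N grows. *)
have bound N : \sum_(q < Q) (if P q then cabs (x q N) ^+ p else 0) <= M.
  rewrite -big_mkcond /=.
  apply: (@le_trans _ _ (\sum_(q < Q | P q) \sum_(n < N) s n ^+ p * w q n)).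
    apply: ler_sum => q Pq; apply: le_trans (power_mean_le p0 s0 (w0 q) (wn q N Pq)).
    rewrite lerXn2r ?nnegrE ?cabs_ge0 ?xw //.
    by apply: sumr_ge0 => n _; rewrite mulr_ge0.
  rewrite exchange_big /=; apply: le_trans (sM N); apply: ler_sum => n _.
  rewrite -mulr_sumr; have [->|sn] := eqVneq (s n) 0; first by rewrite expr0n gtn_eqF // mul0r.
  by rewrite ler_piMr ?exprn_ge0 // wq.
have lim : (fun N => \sum_(q < Q) (if P q then cabs (x q N) ^+ p else 0)) @ \oo -->
    \sum_(q < Q) (if P q then mu q ^+ p else 0).
  elim: Q {bound} => [|Q IH].
    by rewrite big_ord0; under eq_fun do rewrite big_ord0; exact: cvg_cst.
  rewrite big_ord_recr /=; under eq_fun do rewrite big_ord_recr /=.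
  apply: cvgD IH _; case: ifPn => [PQ|_]; last exact: cvg_cst.
  have h := cvg_cabs_norm (xmu Q PQ); rewrite cabs_real ger0_norm ?mu0 // in h.
  elim: {p0 sp M sM} p => [|p IHp].
    by rewrite expr0; under eq_fun do rewrite expr0; exact: cvg_cst.
  by rewrite exprS; under eq_fun do rewrite exprS; exact: (cvgM h IHp).
rewrite -(cvg_lim _ lim) //; apply: limr_le; first exact: cvgP lim.
exact: nearW.
Qed.

End InnerProductSpace.

(** * The spectral family: orthonormal eigenvectors and lower bounds *)

Section SpectralFamily.
Variables (R : realType) (H : completeNormedModType R[i]) (dot : {dot H for Num.conj}).
Variables (L : operator H) (p : nat).
Local Notation C := (cplx R).
Hypothesis norm_dot : forall u : H, `|u| ^+ 2 = dot u u.
Hypothesis p1 : (1 <= p)%N.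
Hypothesis Lsa : self_adjoint dot L.
Hypothesis Lnn : nonnegative dot L.
Hypothesis L0 : resolvent_set L 0.
Hypothesis Lschatten : exists2 T, is_resolvent L (-1) T & schatten dot p T.

(** Inside one eigenspace there are as many indices as its dimension, and an orthonormal family of
    that size is distributed over them injectively. For distinct eigenvalues self-adjointness gives
    (lam q - lam r) <u q, u r> = 0. *)
Lemma orthonormal_eigenvectors (J : set nat) (lam : nat -> R) : spec_enum L J lam ->
  exists u : nat -> H, orthonormal_on dot (fun q => q \in J) u /\
    forall q, q \in J -> dom L (u q) /\ L (u q) = (lam q)%:C *: u q.
Proof.
move=> [_ _ _ mult].
have ex mu : exists w : nat -> H, forall q r, J q -> lam q = mu -> J r -> lam r = mu ->
    Defs.eigenspace L mu%:C (w q) /\ dot (w q) (w r) = (q == r)%:R.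
  have [n [b [VE indep]] /card_set_bijP[f [fA finj _]]] := mult mu.
  have [v [Vv ov]] := exists_orthonormal dot VE indep.
  exists (fun q => v (f q)) => q r Jq lq Jr lr.
  have fq : (f q < n)%N by exact: (fA q).
  have fr : (f r < n)%N by exact: (fA r).
  split; first exact: Vv.
  rewrite ov //; congr (nat_of_bool _)%:R; apply/eqP/eqP => [h|-> //].
  by apply: finj => //; rewrite inE.
have [W hW] := choice ex.
exists (fun q => W (lam q) q).
have eig q : J q -> dom L (W (lam q) q) /\ L (W (lam q) q) = (lam q)%:C *: W (lam q) q.
  by move=> Jq; have [] := hW _ q q Jq erefl Jq erefl.
split=> [q r|q]; last by rewrite inE => /eig.
rewrite !inE => Jq Jr; have [lqr|lqr] := eqVneq (lam q) (lam r).
  by rewrite lqr; have [] := hW (lam r) q r Jq lqr Jr erefl.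
have [dq Lq] := eig q Jq; have [dr Lr] := eig r Jr.
have [_ /(_ (W (lam r) r) (L (W (lam r) r)))[sa _]] := Lsa.
have := sa (conj dr erefl) _ dq; rewrite Lq Lr dotZl dotZr.
have -> : Num.conj ((lam r)%:C : R[i]) = (lam r)%:C by exact: conjc_real.
move=> /eqP; rewrite -subr_eq0 -mulrBl mulf_eq0 -rmorphB /=.
rewrite -cabs_eq0 cabs_real normr_eq0 subr_eq0 (negPf lqr) /= => /eqP ->.
by have [qr|] := eqVneq q r; first by rewrite qr eqxx in lqr.
Qed.

Lemma spec_enum_bounds (J : set nat) (lam : nat -> R) : spec_enum L J lam ->
  exists delta B : R, [/\ 0 < delta, forall q, q \in J -> delta <= lam q &
    sum_bounded (fun q => if q \in J then lam q ^- p else 0) B].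
Proof.
move=> en; have [u [ou eig]] := orthonormal_eigenvectors en.
have [Jdown mono spec _] := en.
have lgt0 q : q \in J -> 0 < lam q.
  move=> qJ; have [dq Lq] := eig q qJ; rewrite lt_neqAle; apply/andP; split.
    apply/eqP => l0; have : spectrum L 0.
      by rewrite spec; exists q; rewrite -?l0 // -in_setE.
    by apply.
  have := Lnn dq; rewrite Lq dotZl ou // eqxx mulr1.
  by rewrite ler0c.
(* The family is nondecreasing on an initial segment of nat, so [lam 0] is its minimum; if 0 is not
   in J, then J is empty and any positive number serves. *)
have [delta [d0 hd]] : exists delta : R, 0 < delta /\ forall q, q \in J -> delta <= lam q.
  have [J0|nJ0] := boolP (0%N \in J).
    exists (lam 0%N); split; first exact: lgt0.
    by move=> q; rewrite inE; exact: mono.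
  exists 1; split=> // q; rewrite inE => /(Jdown 0%N q (leq0n q)) J0.
  by case/negP: nJ0; rewrite inE.
have [T [_ _ T3] Tsch] := Lschatten.
have Tu q : q \in J -> T (u q) = ((1 + lam q)^-1)%:C *: u q.
  move=> qJ; have [dq Lq] := eig q qJ; have := T3 _ dq.
  rewrite Lq scaleN1r opprK -[X in _ + X]scale1r -scalerDl linearZ_LR /= => h.
  rewrite -{2}h scalerA.
  have -> : (lam q)%:C + 1 = (1 + lam q)%:C :> R[i] by rewrite rmorphD /= addrC.
  rewrite -rmorphM mulVf ?scale1r // gt_eqF // addr_gt0 // lgt0 //.
have mu0 q : q \in J -> 0 <= (1 + lam q)^-1.
  by move=> qJ; rewrite invr_ge0 addr_ge0 // ltW // lgt0.
have [M hM] := schatten_eigenvalues norm_dot p1 Tsch ou Tu mu0.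
(* Jensen bounds the powers of 1 / (1 + lambda), the eigenvalues of the resolvent at -1; for lambda
   >= delta one has 1 / lambda <= ((1 + delta) / delta) / (1 + lambda). *)
exists delta, (((1 + delta) / delta) ^+ p * M); split=> // n.
have c0 : 0 <= (1 + delta) / delta by rewrite divr_ge0 ?addr_ge0 // ltW.
apply: le_trans (ler_wpM2l (exprn_ge0 p c0) (hM n)).
rewrite mulr_sumr; apply: ler_sum => q _; case: ifPn => [qJ|_]; last by rewrite mulr0.
have l0 := lgt0 _ qJ; have dl := hd _ qJ.
rewrite -exprVn -exprMn lerXn2r ?nnegrE ?invr_ge0 ?(ltW l0) //.
  by rewrite mulr_ge0 ?mu0.
rewrite -subr_ge0 (_ : _ - _ = (lam q - delta) / (delta * lam q * (1 + lam q))).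
  by rewrite divr_ge0 ?subr_ge0 // !mulr_ge0 ?addr_ge0 // ltW.
by field; rewrite !gt_eqF // addr_gt0.
Qed.

(* Should the spectrum have no enumeration, [spec_family] is the empty family and
   there is nothing to bound. *)
Lemma spec_family_bounds : exists delta B : R,
  [/\ 0 < delta,
    forall q, q \in (spec_family L).1 -> delta <= (spec_family L).2 q,
    sum_bounded (fun q => if q \in (spec_family L).1 then (spec_family L).2 q ^- p else 0) B &
    forall z : C, resolvent_set L (- z) ->
      forall q, q \in (spec_family L).1 -> ((spec_family L).2 q)%:C + z != 0].
Proof.
rewrite /spec_family; case: xgetP => [[J lam] _ /= en|_] /=.
  have [delta [B [d0 hd hB]]] := spec_enum_bounds en.
  exists delta, B; split=> // z rz q qJ; apply/eqP => e.
  have [_ _ spec _] := en.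
  suff : spectrum L (- z) by apply.
  rewrite spec; exists q; first by rewrite -in_setE.
  by rewrite -[LHS](addrK z) e sub0r.
exists 1, 0; split=> // [q|n|z _ q]; rewrite ?in_set0 //.
by rewrite big1 // => q _; rewrite in_set0.
Qed.

End SpectralFamily.

(** * Spectral sums and products in terms of the family, and the determinant formula *)

Section Main.
Variables (R : realType) (H : completeNormedModType R[i]) (L : operator H).
Local Notation C := (cplx R).
Let J := (spec_family L).1.
Let lam := (spec_family L).2.

Lemma zeta_sum_rem_sum (z s : C) : (forall q, q \in J -> 0 < lam q) ->
  (forall q, q \in J -> (lam q)%:C + z != 0) ->
  zeta_sum L z s = rem_sum J lam z 0 s.
Proof.
move=> l0 hz; rewrite /zeta_sum /spec_sum /rem_sum /J /lam.
move: l0 hz; rewrite /J /lam; case: (spec_family L) => J' lam' /= l0 hz.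
congr (lim (_ @ \oo)); apply/funext => n; rewrite seriesE big_mkcond.
apply: eq_bigr => q _; rewrite /rem_term; have [qJ|//] := boolP ((q : nat) \in J').
by rewrite hz //= /remainder big_ord0 subr0.
Qed.

Lemma spec_prod_cvg (F : R -> C) (l : C) :
  (fun n => \prod_(q < n) (if (q : nat) \in J then F (lam q) else 1)) @ \oo --> l ->
  spec_prod L F = l.
Proof.
rewrite /spec_prod /J /lam; case: (spec_family L) => J' lam' /= h.
apply: (@cvg_lim _ (@norm_hausdorff _ _)).
by apply: cvg_seq_eq h => n; rewrite [RHS]big_mkcond.
Qed.

End Main.

Theorem theorem4p5 (R : realType) (H : completeNormedModType R[i])
    (dot : {dot H for Num.conj}) (L : operator H) (p : nat) :
  (forall u : H, `|u| ^+ 2 = dot u u) ->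
  separable H ->
  (1 <= p)%N ->
  self_adjoint dot L ->
  nonnegative dot L ->
  resolvent_set L 0 ->
  (exists2 T, is_resolvent L (-1) T & schatten dot p T) ->
  discrete_dimension_spectrum L ->
  analytic_at (zeta L 0) 0 ->
  (forall j : nat, (1 <= j < p)%N ->
    analytic_at (zeta L 0) j%:R \/ pole_at (zeta L 0) j%:R 1) ->
  forall z : cplx R, resolvent_set L (- z) ->
  det_zeta L z =
    cexp (\sum_(0 <= j < p) z ^+ j / (j`!)%:R * derive1n j (logdet_zeta L) 0)
    * det_reg p L z.
Proof.
move=> norm_dot _ p1 Lsa Lnn L0 Lsch [Zcont _] Z0 Zpole z rz.
have [delta [B [d0 hd hB hres]]] := spec_family_bounds norm_dot p1 Lsa Lnn L0 Lsch.
pose J := (spec_family L).1; pose lam := (spec_family L).2.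
have l0 q : q \in J -> 0 < lam q by move=> /hd; exact: lt_le_trans.
have [Zm [sigma Zs]] := Zcont.
have Zsum s : sigma < complex.Re s -> zeta L 0 s = rem_sum J lam 0 0 s.
  move=> /Zs ->; apply: zeta_sum_rem_sum => // q /l0 lq.
  by rewrite addr0 -cabs_gt0 cabs_real gtr0_norm.
have [A hA] := logdet_expansion p1 d0 hd hB Zm Zsum Z0 Zpole.
(* This is used twice: for all w near 0, to find the Taylor coefficients, and for the given z, which
   may be far from 0. *)
have logdetE w : (forall q, q \in J -> (lam q)%:C + w != 0) ->
    series (ell J lam p w) @ \oo --> logdet_zeta L w - \sum_(k < p) A k * w ^+ k.
  move=> hw; have [F [Fm [s' FS]]] := zeta_continuation_exists d0 hd hB Zm Zsum w.
  (* [zeta L w] is a choice; it is a continuation because one exists. *)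
  have [Gm [s'' GS]] : zeta_continuation L w (zeta L w).
    apply: xgetPex; exists F; split=> //; exists s' => s hs.
    by rewrite (FS s hs) -zeta_sum_rem_sum.
  apply: (hA w (zeta L w) s'' Gm) => s hs.
  by rewrite (GS s hs) zeta_sum_rem_sum.
have [r [M [c [hE c0 hr]]]] := ell_power_series p1 d0 hd hB.
have [r0 _ _] := hE.
have polyA : exists M' d, power_series (fun w : cplx R => \sum_(k < p) A k * w ^+ k) 0 r M' d /\
    forall k, (k < p)%N -> d k = A k.
  pose d k := if (k < p)%N then A k else 0.
  have sb : sum_bounded (fun k => cabs (d k) * r ^+ k) (\sum_(k < p) cabs (A k) * r ^+ k).
    move=> n; apply: (@le_trans _ _ (\sum_(0 <= k < n + p) cabs (d k) * r ^+ k)).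
      rewrite -(big_mkord xpredT (fun k => cabs (d k) * r ^+ k)).
      rewrite [leRHS](@big_cat_nat _ _ _ n) ?leq_addr //= lerDl; apply: sumr_ge0 => i _.
      by rewrite mulr_ge0 ?cabs_ge0 // exprn_ge0 // ltW.
    rewrite (@big_cat_nat _ _ _ p) ?leq_addl //= sum_shift big_mkord.
    rewrite [X in _ + X]big1 ?addr0 => [|i _]; last first.
      by rewrite /d ltnNge leq_addr cabs0 mul0r.
    by apply: ler_sum => i _; rewrite /d ltn_ord.
  exists (\sum_(k < p) cabs (A k) * r ^+ k), d; split; last by move=> k kp; rewrite /d kp.
  apply: power_series_eq (power_series_of_coef0 r0 sb) => w _.
  apply: (@cvg_lim _ (@norm_hausdorff _ _)).
  have -> : \sum_(k < p) A k * w ^+ k = \sum_(k < p) d k * w ^+ k.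
    by apply: eq_bigr => i _; rewrite /d ltn_ord.
  by apply: cvg_series_finite => n; rewrite /d ltnNge leq_addr mul0r.
have [M' [d [hP dA]]] := polyA.
(* Below degree p the coefficients c vanish, so those of the logarithm of the determinant are the A
   k. *)
have logps : power_series (logdet_zeta L) 0 r (M' + M) (fun k => d k + c k).
  apply: power_series_eq (power_seriesD hP hE) => w wr; rewrite subr0 in wr.
  have h := logdetE w (fun q qJ => hr q w qJ wr).
  by rewrite (cvg_lim _ h) // addrC subrK.
have -> : \sum_(0 <= j < p) z ^+ j / (j`!)%:R * derive1n j (logdet_zeta L) 0 =
    \sum_(k < p) A k * z ^+ k.
  rewrite big_mkord; apply: eq_bigr => j _.
  rewrite (power_series_derive1n j logps) dA // c0 // addr0.
  by field; rewrite pnatr_eq0 -lt0n fact_gt0.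
have hz := logdetE z (hres z rz).
(* Exponentiation turns the convergent series of the [ell z q] into the product; the branch of the
   logarithm disappears by [cexp_clog]. *)
have -> : det_reg p L z = cexp (logdet_zeta L z - \sum_(k < p) A k * z ^+ k).
  apply: spec_prod_cvg; apply: cvg_seq_eq (cvg_cexp hz) => n.
  rewrite seriesE cexp_sum; apply: eq_bigr => q _; rewrite /ell.
  case: ifPn => qJ; last by rewrite cexp0.
  have lq := l0 _ qJ; have lqz := hres z rz _ qJ.
  rewrite cexpD cexpD cexp_clog // cexpN cexp_real lnK //; congr (_ * _).
  have lqC : (lam q)%:C != 0 :> cplx R by rewrite -cabs_gt0 cabs_real gtr0_norm.
  by field.
by rewrite -cexpD addrC subrK.
Qed.
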